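(* Let $0<\alpha<2$ and let $X=\{X(t):t\in\mathbb{R}\}$ be a stationary real harmonizable symmetric $\alpha$-stable process with finite control measure $m$ and symmetric spectral density $f$, $m(\mathbb{R})=1$. Let $(x(1),\dots,x(n))=(X(t_1),\dots,X(t_n))$ be a sample of $X$ at equidistant points $t_1<\dots<t_n$, $n\in\mathbb{N}$, with $t_j=j\delta$, $\delta>0$, for $j=1,\dots,n$. For fixed $N\in\mathbb{N}$ denote by $\{\hat Z_{k,n}\}_{k=1}^N$ the iterative periodogram frequency estimators, and by $\{\hat a_{k,n}\}_{k=1}^N$, $\{\hat b_{k,n}\}_{k=1}^N$ the regression estimators for $\{a_{[k]}\}_{k=1}^N$, $\{b_{[k]}\}_{k=1}^N$, all defined in the context. Then $$\lim_{n\to\infty}n\left(|Z_{[k]}|-\hat Z_{k,n}\right)=0,\qquad\lim_{n\to\infty}\hat a_{k,n}=a_{[k]},\qquad\lim_{n\to\infty}\hat b_{k,n}=b_{[k]}\qquad\text{almost surely}$$ for $k=1,\dots,N$.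
   Context: Stationary real harmonizable symmetric $\alpha$-stable (SRH $S\alpha S$) process: $X(t)=\mathrm{Re}\left(\int_{\mathbb{R}}e^{itx}M(dx)\right)$, where $M$ is an isotropic complex $S\alpha S$ random measure on $\mathbb{R}$ with finite control measure $m$, i.e. $M$ is independently scattered, $\sigma$-additive, complex-valued, and for every Borel $A$ the vector $(\mathrm{Re}\,M(A),\mathrm{Im}\,M(A))$ has characteristic function $s\mapsto\exp\{-m(A)\int_{S^1}|(\theta,s)|^\alpha\gamma(d\theta)\}$ with $\gamma$ uniform on the unit circle $S^1$. The measure $m$ is absolutely continuous with respect to Lebesgue measure; its density $f$ is the spectral density of $X$, so $f$ is a symmetric probability density. The process is given by its LePage series representation $$X(t)=\sum_{k=1}^\infty\left(a_k\cos(Z_kt)+b_k\sin(Z_kt)\right),\quad a_k=(C_\alpha b_\alpha^{-1}m(\mathbb{R}))^{1/\alpha}\Gamma_k^{-1/\alpha}G_k^{(1)},\quad b_k=(C_\alpha b_\alpha^{-1}m(\mathbb{R}))^{1/\alpha}\Gamma_k^{-1/\alpha}G_k^{(2)},$$ where $\{\Gamma_k\}$ are the arrival times of a unit rate Poisson process, $\{G_k^{(1)}\},\{G_k^{(2)}\}$ are i.i.d. standard normal sequences, $\{Z_k\}$ are i.i.d. with density $f$, all sequences being mutually independent; $b_\alpha=2^{\alpha/2}\Gamma(1+\alpha/2)$, $C_\alpha=\left(\int_0^\infty x^{-\alpha}\sin(x)dx\right)^{-1}$. Put $R_k=(a_k^2+b_k^2)^{1/2}$. Let $R_{[k]}$ be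 the $k$-th largest amplitude, $R_{[1]}>R_{[2]}>\dots>0$ almost surely, and let $Z_{[k]},a_{[k]},b_{[k]}$ be the frequency and coefficients associated with $R_{[k]}$. Estimators: for a vector $y=(y(1),\dots,y(n))$ its periodogram is $I_n(\theta)=\left|n^{-1}\sum_{j=1}^ny(j)e^{-ij\theta}\right|^2$, and frequencies $\theta>0$ are read off from $\theta\mapsto I_n(\delta\theta)$. Set $x^{(0)}(j)=x(j)$. For $k=1,\dots,N$ successively: let $I_n^{(k-1)}$ be the periodogram of $x^{(k-1)}(1),\dots,x^{(k-1)}(n)$; let $\hat Z_{k,n}$ be the location of its largest peak, i.e. a maximizer over $\theta>0$ of $\theta\mapsto I_n^{(k-1)}(\delta\theta)$; let $(\hat a_{k,n},\hat b_{k,n})$ be the regression coefficients of $x^{(k-1)}$ on the cosine and sine at frequency $\hat Z_{k,n}$, given explicitly by $$\hat a_{k,n}=\frac2n\sum_{j=1}^nx^{(k-1)}(j)\cos(j\delta\hat Z_{k,n}),\qquad\hat b_{k,n}=\frac2n\sum_{j=1}^nx^{(k-1)}(j)\sin(j\delta\hat Z_{k,n});$$ and form the residuals $x^{(k)}(j)=x^{(k-1)}(j)-\hat a_{k,n}\cos(j\delta\hat Z_{k,n})-\hat b_{k,n}\sin(j\delta\hat Z_{k,n})$, $j=1,\dots,n$.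
   Formalization: Among the infinitely many alias maximizers, the estimate of Z_[k] is assumed, a.s. for large n, to lie in the same band [lπ/δ,(l+1)π/δ) as |Z_[k]|; and the limit of the sine coefficient is sgn(Z_[k]) b_[k] instead of b_[k], since Z_[k] may be negative. *)

(* Defs.v *)
From HB Require Import structures.
From mathcomp Require Import all_boot all_order all_algebra.
From mathcomp Require Import all_classical all_reals all_analysis.
From mathcomp Require Import complex.

Set Implicit Arguments.
Unset Strict Implicit.
Unset Printing Implicit Defensive.

Import Order.TTheory GRing.Theory Num.Theory.
Import numFieldNormedType.Exports.

Local Open Scope classical_set_scope.
Local Open Scope ring_scope.

(* Mutual independence: the product rule over every finite subfamily. *)
Definition mutually_independent d (T : measurableType d) (R : realType)
    (P : probability T R) d' (S : measurableType d') (I : eqType)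
    (X : I -> T -> S) : Prop :=
  forall (s : seq I) (B : I -> set S), uniq s ->
    (forall i, measurable (B i)) ->
    P (\bigcap_(i in [set` s]) (X i @^-1` B i))
    = (\prod_(i <- s) P (X i @^-1` B i))%E.

Definition has_distribution d (T : measurableType d) (R : realType)
    (P : probability T R) (Y : T -> R) (law : set R -> \bar R) : Prop :=
  forall A : set R, measurable A -> P (Y @^-1` A) = law A.

Definition cis (R : realType) (u : R) : R[i] := Complex (cos u) (sin u).

Definition rv2 (T : Type) (R : realType) (Y : T -> R[i]) (w : T) : R * R :=
  (complex.Re (Y w), complex.Im (Y w)).

Definition charfun2 d (T : measurableType d) (R : realType)
    (P : probability T R) (Y : T -> R[i]) (s : R * R) : R[i] :=
  let dot w := s.1 * (rv2 Y w).1 + s.2 * (rv2 Y w).2 in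
  Complex (\int[P]_(w in setT) cos (dot w)) (\int[P]_(w in setT) sin (dot w)).

(* The integral of |(theta, s)|^alpha over the unit circle with respect to the
   uniform probability measure, parametrised by theta = (cos u, sin u). *)
Definition circle_moment (R : realType) (alpha : R) (s : R * R) : R :=
  (2 * pi)^-1 * \int[lebesgue_measure]_(u in `[0, 2 * pi])
    (`|s.1 * cos u + s.2 * sin u| `^ alpha).

(* M is only constrained on Borel sets. *)
Definition isotropic_stable_measure d (T : measurableType d) (R : realType)
    (P : probability T R) (alpha : R)
    (m : {finite_measure set (measurableTypeR R) -> \bar R})
    (M : set R -> T -> R[i]) : Prop :=
  [/\ forall A, measurable A -> measurable_fun setT (rv2 (M A)),
      forall A : nat -> set R, (forall i, measurable (A i)) ->
        trivIset setT A -> mutually_independent P (fun i => rv2 (M (A i))),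
      forall A : nat -> set R, (forall i, measurable (A i)) ->
        trivIset setT A ->
        {ae P, forall w,
          (\sum_(i < n) (rv2 (M (A i)) w).1) @[n --> \oo]
            --> (rv2 (M (\bigcup_i A i)) w).1 /\
          (\sum_(i < n) (rv2 (M (A i)) w).2) @[n --> \oo]
            --> (rv2 (M (\bigcup_i A i)) w).2} &
      forall (A : set R) (s : R * R), measurable A ->
        charfun2 P (M A) s
        = Complex (expR (- (fine (m A) * circle_moment alpha s))) 0].

Definition cvg_in_prob d (T : measurableType d) (R : realType)
    (P : probability T R) (Y_ : nat -> T -> R[i]) (Y : T -> R[i]) : Prop :=
  forall e : R, 0 < e ->
    P [set w | e < ComplexField.Normc.normc (Y_ n w - Y w)] @[n --> \oo]
      --> 0%E.

(* Simple functions are given by finite lists of coefficients and sets. *)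
Definition simple_fct (R : realType) (s : seq (R[i] * set R)) (x : R) : R[i] :=
  \sum_(p <- s) p.1 * Complex (\1_(p.2) x) 0.

Definition simple_integral (T : Type) (R : realType) (M : set R -> T -> R[i])
    (s : seq (R[i] * set R)) (w : T) : R[i] :=
  \sum_(p <- s) p.1 * M p.2 w.

(* Y is (a version of) the stochastic integral of g with respect to M: a limit
   in probability of integrals of simple functions converging to g in
   L^alpha(m). *)
Definition is_stable_integral d (T : measurableType d) (R : realType)
    (P : probability T R) (alpha : R)
    (m : {finite_measure set (measurableTypeR R) -> \bar R})
    (M : set R -> T -> R[i]) (g : R -> R[i]) (Y : T -> R[i]) : Prop :=
  measurable_fun setT (rv2 Y) /\
  exists s : nat -> seq (R[i] * set R),
    [/\ forall n p, p \in s n -> measurable p.2,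
        (\int[m]_(x in setT)
          (ComplexField.Normc.normc (simple_fct (s n) x - g x) `^ alpha)%:E)%E
          @[n --> \oo] --> 0%E &
        cvg_in_prob P (fun n => simple_integral M (s n)) Y].

Definition is_SRH_SaS d (T : measurableType d) (R : realType)
    (P : probability T R) (alpha : R)
    (m : {finite_measure set (measurableTypeR R) -> \bar R})
    (X : R -> {RV P >-> R}) : Prop :=
  exists M : set R -> T -> R[i],
    isotropic_stable_measure P alpha m M /\
    forall t, exists Y : T -> R[i],
      is_stable_integral P alpha m M (fun x => cis (t * x)) Y /\
      {ae P, forall w, X t w = complex.Re (Y w)}.

Definition is_symmetric_spectral_density (R : realType)
    (m : {finite_measure set (measurableTypeR R) -> \bar R}) (f : R -> R)
    : Prop :=
  [/\ measurable_fun setT f, forall x, 0 <= f x, forall x, f (- x) = f x &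
      forall A : set R, measurable A ->
        m A = (\int[lebesgue_measure]_(x in A) (f x)%:E)%E].

(* Improper: for alpha <= 1 the integral over ]0, +oo[ is only conditionally
   convergent. *)
Definition C_stable (R : realType) (alpha : R) : R :=
  (lim ((\int[lebesgue_measure]_(x in `]0%R, c]) (x `^ (- alpha) * sin x))
        @[c --> +oo]))^-1.

Definition Euler_Gamma (R : realType) (s : R) : R :=
  \int[lebesgue_measure]_(x in `]0%R, +oo[) (x `^ (s - 1) * expR (- x)).

Definition b_stable (R : realType) (alpha : R) : R :=
  2 `^ (alpha / 2) * Euler_Gamma (1 + alpha / 2).

(* From here on sequences are indexed from 0: Gam 0 is the first arrival time,
   and index k stands for the (k+1)-st term of the series. *)
Definition interarrival (T : Type) (R : realType) (Gam : nat -> T -> R)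
    (k : nat) (w : T) : R :=
  if k is k'.+1 then Gam k w - Gam k' w else Gam 0%N w.

Definition merge4 (A : Type) (E G1 G2 Z : nat -> A)
    (i : (nat + nat) + (nat + nat)) : A :=
  match i with
  | inl (inl k) => E k
  | inl (inr k) => G1 k
  | inr (inl k) => G2 k
  | inr (inr k) => Z k
  end.

(* Arrival times of a unit rate Poisson process are partial sums of i.i.d.
   standard exponential interarrival times. *)
Definition LePage_variables d (T : measurableType d) (R : realType)
    (P : probability T R) (f : R -> R)
    (Gam G1 G2 Z : nat -> {RV P >-> R}) : Prop :=
  let E := interarrival (fun k => Gam k : T -> R) in
  [/\ forall k, has_distribution P (E k) (exponential_prob 1),
      forall k, has_distribution P (G1 k) (normal_prob 0 1) /\
                has_distribution P (G2 k) (normal_prob 0 1),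
      forall k, has_distribution P (Z k)
        (fun A => \int[lebesgue_measure]_(x in A) (f x)%:E)%E &
      mutually_independent P (merge4 E (fun k => G1 k : T -> R)
        (fun k => G2 k : T -> R) (fun k => Z k : T -> R))].

Definition LePage_coef (T : Type) (R : realType) (alpha mass : R)
    (Gam G : nat -> T -> R) (k : nat) (w : T) : R :=
  (C_stable alpha * (b_stable alpha)^-1 * mass) `^ alpha^-1
  * Gam k w `^ (- alpha^-1) * G k w.

Definition is_LePage_series d (T : measurableType d) (R : realType)
    (P : probability T R) (a b Z : nat -> T -> R) (X : R -> {RV P >-> R})
    : Prop :=
  forall t, {ae P, forall w,
    series (fun k => a k w * cos (Z k w * t) + b k w * sin (Z k w * t)) @ \oo
      --> X t w}.

Definition amplitude (T : Type) (R : realType) (a b : nat -> T -> R) (k : nat)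
    (w : T) : R :=
  Num.sqrt (a k w ^+ 2 + b k w ^+ 2).

(* The index of the (k+1)-st largest term of r: exactly k terms exceed it. *)
Definition kth_largest (R : realType) (r : nat -> R) (k : nat) : nat :=
  xget 0%N [set i | ([set j | r i < r j] #= `I_k)%card].

(* c_[k+1]: the term of the sequence c attached to the (k+1)-st largest
   amplitude. *)
Definition by_amplitude (T : Type) (R : realType) (a b c : nat -> T -> R)
    (k : nat) (w : T) : R :=
  c (kth_largest (fun j => amplitude a b j w) k) w.

(* Vectors (y(1), ..., y(n)) are given by functions on nat, of which only the
   values at 1, ..., n are used. *)
Definition periodogram (R : realType) (n : nat) (y : nat -> R) (u : R) : R :=
  ComplexField.Normc.normc
    (Complex n%:R^-1 0
     * \sum_(1 <= j < n.+1) Complex (y j) 0 * cis (- (j%:R * u))) ^+ 2.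

Definition is_largest_peak (R : realType) (delta : R) (n : nat)
    (y : nat -> R) (theta : R) : Prop :=
  0 < theta /\ forall theta', 0 < theta' ->
    periodogram n y (delta * theta') <= periodogram n y (delta * theta).

Definition cos_regression (R : realType) (delta : R) (n : nat) (y : nat -> R)
    (z : R) : R :=
  2 / n%:R * \sum_(1 <= j < n.+1) y j * cos (j%:R * delta * z).

Definition sin_regression (R : realType) (delta : R) (n : nat) (y : nat -> R)
    (z : R) : R :=
  2 / n%:R * \sum_(1 <= j < n.+1) y j * sin (j%:R * delta * z).

(* x^(k), with z k the (k+1)-st frequency estimate. *)
Fixpoint residual (R : realType) (delta : R) (n : nat) (x : nat -> R)
    (z : nat -> R) (k : nat) (j : nat) : R :=
  if k is k'.+1 then
    let y := residual delta n x z k' in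
    y j - cos_regression delta n y (z k') * cos (j%:R * delta * z k')
        - sin_regression delta n y (z k') * sin (j%:R * delta * z k')
  else x j.

(* Sampling at step delta only sees frequencies up to reflections at the
   multiples of pi / delta: the periodogram u |-> I_n(delta u) is even and
   2 pi / delta-periodic, so that it has a maximizer in every Nyquist band
   [l pi / delta, (l + 1) pi / delta], and bands have to be distinguished. *)
Definition same_Nyquist_band (R : realType) (delta u v : R) : Prop :=
  Num.floor (delta * u / pi) = Num.floor (delta * v / pi).

(* Main.v *)
From HB Require Import structures.
Require Import Defs.
From mathcomp Require Import all_boot all_order all_algebra.
From mathcomp Require Import all_classical all_reals all_analysis.
From mathcomp Require Import measurable_realfun complex ring lra zify.
Set Implicit Arguments.
Unset Strict Implicit.
Unset Printing Implicit Defensive.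
Import Order.TTheory GRing.Theory Num.Theory.
Import numFieldNormedType.Exports.
Local Open Scope classical_set_scope.
Local Open Scope ring_scope.

(** Outside a null set the sample is a deterministic object: a superposition
    of infinitely many tones with frequencies [delta * Z k], finitely many of
    which account for it up to a small mean square, uniformly in the sample
    size (this is what [approximated] expresses).

    For such a sample the estimators are controlled by the Dirichlet kernel,
    the mean of the [n] unit vectors of angles [u], ..., [n u].  It is small
    at angles away from the multiples of 2 pi, hence for large [n] an angle
    resonates with at most one of finitely many frequencies
    ([frequencies_separated]), and the Fourier transform of the sample at that
    angle consists of one tone and an error; the discarded tones only
    contribute the square root of their mean square
    ([fourier_le_mean_square], [fourier_single_tone]).  At the frequency of the
    largest amplitude the transform has modulus close to half this amplitude,
    and strictly less is available at any other frequency.  A maximizer of the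
    periodogram must therefore resonate with that frequency, with a kernel of
    modulus close to 1, which forces a distance of order smaller than 1/n
    ([dirichlet_peak], [peak_localizes]).  This is the rate of the theorem; the
    Nyquist band of the maximizer decides between the aliases
    ([alias_unique], [peak_cvg]).  An error of order smaller than 1/n in the
    frequency shifts the phase by a vanishing amount at all sampling times, so
    that the regression coefficients converge ([regression_cvg]) and the
    residuals are again a superposition of the remaining tones
    ([residual_approximated]): the argument can be iterated
    ([periodogram_iteration_consistent]).

    The LePage series converges at each time, without any uniformity in the
    time, so a different argument bounds the mean square of its tail.  Shifting
    the time rotates the Gaussian pairs [(G1 k, G2 k)] by angles that depend on
    the frequencies only, and the law of a Gaussian pair is invariant under
    rotations ([rotate_pair]).  Hence the tail of the series is stationary
    ([excess_shift]), and the maximal inequality of ergodic theory bounds the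
    probability that one of its running mean squares exceeds [lam] by its
    variance over [lam] ([maximal_count], [excess_prob]).  The arrival times
    grow linearly ([ae_arrival_growth]), so this variance is bounded by the
    tail of the series of the k^(- 2 / alpha), which vanishes because alpha < 2
    ([tail_mean_square]).

    Finally frequencies and amplitudes have to be in general position:
    given all the other variables, [Z k] and [G1 k] have a law without atoms
    and would have to belong to a countable set ([ae_generic]).  The
    amplitudes are positive because the constants C_alpha and b_alpha are. *)

Local Notation normc := ComplexField.Normc.normc.

(** * The Dirichlet kernel *)

Section kernel.
Variable R : realType.
Implicit Types (u v t : R) (z w : R[i]) (n h j : nat).

Lemma cisD u v : cis (u + v) = cis u * cis v :> R[i].
Proof. by apply/eqP; rewrite eq_complex /= cosD sinD; apply/andP; split; apply/eqP; ring. Qed.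

Lemma cis0 : cis 0 = 1 :> R[i].
Proof. by rewrite /cis cos0 sin0. Qed.

Lemma normc_ge0 z : 0 <= normc z.
Proof. by case: z => a b /=; exact: sqrtr_ge0. Qed.

Lemma sqr_normcE z : normc z ^+ 2 = complex.Re z ^+ 2 + complex.Im z ^+ 2.
Proof. by case: z => a b /=; rewrite sqr_sqrtr// addr_ge0// sqr_ge0. Qed.

Lemma normc_cis u : normc (cis u) = 1.
Proof. by rewrite /= cos2Dsin2 sqrtr1. Qed.

Lemma normc_real (a : R) : normc (Complex a 0) = `|a|.
Proof. by rewrite /= expr0n addr0 sqrtr_sqr. Qed.

Lemma normc_sum (I : Type) (r : seq I) (P : pred I) (F : I -> R[i]) :
  normc (\sum_(i <- r | P i) F i) <= \sum_(i <- r | P i) normc (F i).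
Proof.
elim/big_rec2: _ => [|i x y _ le_xy]; first by rewrite ComplexField.Normc.normc0.
by rewrite (le_trans (le_normcD _ _))// lerD2l.
Qed.

Lemma Re_sum (I : Type) (r : seq I) (P : pred I) (F : I -> R[i]) :
  complex.Re (\sum_(i <- r | P i) F i) = \sum_(i <- r | P i) complex.Re (F i).
Proof. by elim/big_rec2: _ => // i c [a b] _ /= ->; case: (F i). Qed.

Lemma Im_sum (I : Type) (r : seq I) (P : pred I) (F : I -> R[i]) :
  complex.Im (\sum_(i <- r | P i) F i) = \sum_(i <- r | P i) complex.Im (F i).
Proof. by elim/big_rec2: _ => // i c [a b] _ /= ->; case: (F i). Qed.

(** The bounds of the real and imaginary parts by the modulus carry every
    passage from the Fourier transform to the two regression coefficients. *)
Lemma Re_le_normc z : `|complex.Re z| <= normc z.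
Proof.
by rewrite -(ler_pXn2r (_ : 0 < 2)%N) ?nnegrE ?normc_ge0// sqr_normcE real_normK ?num_real// lerDl sqr_ge0.
Qed.

Lemma Im_le_normc z : `|complex.Im z| <= normc z.
Proof.
by rewrite -(ler_pXn2r (_ : 0 < 2)%N) ?nnegrE ?normc_ge0// sqr_normcE real_normK ?num_real// lerDr sqr_ge0.
Qed.

Lemma mulc_real (a : R) z : Complex a 0 * z = Complex (a * complex.Re z) (a * complex.Im z).
Proof. by case: z => x y; apply/eqP; rewrite eq_complex /=; apply/andP; split; apply/eqP; ring. Qed.

Definition dirichlet n u : R[i] :=
  Complex n%:R^-1 0 * \sum_(1 <= j < n.+1) cis (j%:R * u).

Lemma dirichlet_le1 n u : normc (dirichlet n u) <= 1.
Proof.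
rewrite /dirichlet ComplexField.Normc.normcM normc_real ger0_norm ?invr_ge0//.
case: n => [|n]; first by rewrite invr0 mul0r.
rewrite ler_pdivrMl ?ltr0n// mulr1 (le_trans (normc_sum _ _ _))//.
under eq_bigr do rewrite normc_cis.
by rewrite big_const_nat iter_addr_0 subn1.
Qed.

Lemma dirichlet_telescope n u :
  (1 - cis u) * \sum_(1 <= j < n.+1) cis (j%:R * u) = cis u - cis (n.+1%:R * u).
Proof.
elim: n => [|n IH]; first by rewrite big_geq// mulr0 mul1r subrr.
rewrite big_nat_recr//= mulrDr IH.
have -> : n.+2%:R * u = n.+1%:R * u + u by rewrite -(natr1 n.+1) mulrDl mul1r.
by rewrite cisD; ring.
Qed.

(** A geometric sum: away from the multiples of 2 pi the kernel is [O(1/n)]. *)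
Lemma dirichlet_far n u : (0 < n)%N -> normc (dirichlet n u) * normc (1 - cis u) <= 2 / n%:R.
Proof.
move=> n0; rewrite /dirichlet ComplexField.Normc.normcM normc_real ger0_norm ?invr_ge0//.
rewrite -mulrA -ComplexField.Normc.normcM (mulrC _ (1 - _)) dirichlet_telescope.
rewrite mulrC ler_pM2r ?invr_gt0 ?ltr0n// (le_trans (le_normcD _ _))//.
by rewrite normcN !normc_cis.
Qed.

Lemma dirichletE n u : dirichlet n u =
  Complex (n%:R^-1 * \sum_(1 <= j < n.+1) cos (j%:R * u))
          (n%:R^-1 * \sum_(1 <= j < n.+1) sin (j%:R * u)).
Proof.
by rewrite /dirichlet mulc_real Re_sum Im_sum.
Qed.

(** Let [m] be the mean of the [n] unit vectors of angles [u], ..., [n u]; their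
    mean square deviation from [m] is one minus the squared modulus of [m].  The
    vectors of indices [j] and [j + h] are at a squared distance
    [2 - 2 cos (h u)], which is at most twice the sum of their squared
    deviations; summing over [j <= n - h], at least half of all indices, bounds
    the deviation from below. *)
Lemma dirichlet_shift n h u : (0 < n)%N -> (h.*2 <= n)%N ->
  1 - cos (h%:R * u) <= 4 * (1 - normc (dirichlet n u) ^+ 2).
Proof.
move=> n0 hn; rewrite sqr_normcE dirichletE /=.
set p := n%:R^-1 * _; set q := n%:R^-1 * _.
have nR0 : 0 < n%:R :> R by rewrite ltr0n.
pose dev j := (cos (j%:R * u) - p) ^+ 2 + (sin (j%:R * u) - q) ^+ 2.
have dev0 j : 0 <= dev j by rewrite addr_ge0// sqr_ge0.
have sum_dev : \sum_(1 <= j < n.+1) dev j = n%:R * (1 - (p ^+ 2 + q ^+ 2)).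
  have -> : \sum_(1 <= j < n.+1) dev j = \sum_(1 <= j < n.+1)
      ((1 + p ^+ 2 + q ^+ 2) - 2 * p * cos (j%:R * u) - 2 * q * sin (j%:R * u)).
    apply: eq_bigr => j _; rewrite /dev.
    have := cos2Dsin2 (j%:R * u); lra.
  rewrite 2!sumrB -!mulr_sumr.
  have -> : \sum_(1 <= j < n.+1) cos (j%:R * u) = n%:R * p by rewrite /p mulrA divff ?mul1r// gt_eqF.
  have -> : \sum_(1 <= j < n.+1) sin (j%:R * u) = n%:R * q by rewrite /q mulrA divff ?mul1r// gt_eqF.
  by rewrite big_const_nat iter_addr_0 subn1 /= -mulr_natl; ring.
have pairs : \sum_(1 <= j < (n - h).+1) (2 - 2 * cos (h%:R * u)) <=
    \sum_(1 <= j < (n - h).+1) (2 * dev j + 2 * dev (j + h)%N).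
  apply: ler_sum => j _; rewrite /dev natrD [(j%:R + h%:R) * u]mulrDl.
  set x := j%:R * u; set y := h%:R * u.
  have -> : 2 - 2 * cos y = (cos (x + y) - cos x) ^+ 2 + (sin (x + y) - sin x) ^+ 2.
    have -> : cos y = cos ((x + y) - x) by rewrite addrC addKr.
    rewrite cosB; have := cos2Dsin2 x; have := cos2Dsin2 (x + y); lra.
  move: (cos x) (cos _) (sin x) (sin _) => c1 c2 s1 s2.
  have := sqr_ge0 (c1 + c2 - 2 * p); have := sqr_ge0 (s1 + s2 - 2 * q); lra.
have dev1 : \sum_(1 <= j < (n - h).+1) dev j <= \sum_(1 <= j < n.+1) dev j.
  rewrite [leRHS](@big_cat_nat _ _ _ (n - h).+1)//= ?lerDl ?sumr_ge0//; lia.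
have dev2 : \sum_(1 <= j < (n - h).+1) dev (j + h)%N <= \sum_(1 <= j < n.+1) dev j.
  have -> : \sum_(1 <= j < (n - h).+1) dev (j + h)%N = \sum_(1 + h <= j < n.+1) dev j.
    by rewrite big_addn subSn//; lia.
  rewrite [leRHS](@big_cat_nat _ _ _ h.+1)//= ?add1n ?lerDr ?sumr_ge0//; lia.
rewrite big_const_nat iter_addr_0 subn1 big_split /= -!mulr_sumr in pairs.
have pairs2 : (2 - 2 * cos (h%:R * u)) * (n - h)%:R <= 4 * (n%:R * (1 - (p ^+ 2 + q ^+ 2))).
  by rewrite mulr_natr; move: dev1 dev2; rewrite sum_dev; lra.
have c1 := cos_le1 (h%:R * u).
have hn2 : n%:R <= 2 * (n - h)%:R :> R by rewrite -natrM ler_nat; lia.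
rewrite -(ler_pM2l nR0).
have : n%:R * (1 - cos (h%:R * u)) <= (2 * (n - h)%:R) * (1 - cos (h%:R * u)).
  by rewrite ler_wpM2r// subr_ge0.
lra.
Qed.

Lemma cis_2pi (q : int) : cis (2 * pi * q%:~R) = 1 :> R[i].
Proof.
have cisn (k : nat) : cis (2 * pi * k%:R) = 1 :> R[i].
  elim: k => [|k IH]; first by rewrite mulr0 cis0.
  rewrite -[k.+1]addn1 natrD mulrDr mulr1 cisD IH mul1r /cis mulr_natl.
  by rewrite cos2pi sin2pi.
case: q => k; first exact: cisn.
rewrite NegzE mulrNz mulrN.
have := cisD (2 * pi * k.+1%:R) (- (2 * pi * k.+1%:R)).
by rewrite subrr cis0 cisn mul1r => <-.
Qed.

Lemma cos_Dperiod u (q : int) : cos (u + 2 * pi * q%:~R) = cos u :> R.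
Proof. by have := cisD u (2 * pi * q%:~R); rewrite cis_2pi mulr1 => -[]. Qed.

Lemma dirichlet_Dperiod n u (q : int) : dirichlet n (u + 2 * pi * q%:~R) = dirichlet n u.
Proof.
congr (_ * _); apply: eq_bigr => j _; rewrite mulrDr cisD.
have -> : j%:R * (2 * pi * q%:~R) = 2 * pi * (q * j)%:~R :> R by rewrite intrM; ring.
by rewrite cis_2pi mulr1.
Qed.

Lemma reduce_angle u : exists q : int, `|u - 2 * pi * q%:~R| <= pi.
Proof.
have pi0 := pi_gt0 R.
exists (Num.floor ((u + pi) / (2 * pi))).
have p2 : 0 < 2 * pi :> R by rewrite mulr_gt0.
have := floor_le ((u + pi) / (2 * pi)); have := floorD1_gt ((u + pi) / (2 * pi)).
rewrite ler_pdivlMr// ltr_pdivrMr// intrD1 ler_norml.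
set k := (Num.floor _)%:~R; move=> h1 h2; lra.
Qed.

(** Between [- pi] and [pi] the cosine is close to 1 only near zero. *)
Lemma cos_gt_small t (eta : R) : 0 < eta <= pi / 2 -> `|t| <= pi -> cos eta < cos t -> `|t| < eta.
Proof.
move=> /andP[e0 e1] tpi; rewrite -(cos_norm t) => c.
have pi0 := pi_gt0 R.
rewrite -ltr_cos// in_itv /=; apply/andP; split => //; lra.
Qed.

(** If the kernel has modulus close to 1, then by [dirichlet_shift] the cosines
    of [h u] are close to 1 for all [h <= n / 2].  Modulo 2 pi the angle [u] is
    a [v] with modulus at most pi, and by induction on [h] the multiples [h v]
    cannot wrap around the circle: a step from [h v] to [(h + 1) v] moves by at
    most [eta], too little to reach the neighbourhood of another multiple of
    2 pi.  So [h v] is smaller than [eta] for [h = n / 2]. *)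
Lemma dirichlet_peak (eta : R) n u : 0 < eta <= pi / 2 -> (1 < n)%N ->
  4 * (1 - normc (dirichlet n u) ^+ 2) < 1 - cos eta ->
  exists q : int, n%:R * `|u - 2 * pi * q%:~R| <= 3 * eta.
Proof.
move=> eta_b n1 Dn; have [q uq] := reduce_angle u; exists q.
set v := u - _ in uq *.
have /andP[eta0 eta1] := eta_b.
have Dv : dirichlet n u = dirichlet n v by rewrite -(dirichlet_Dperiod n v q) /v subrK.
have small h : (h.*2 <= n)%N -> `|h%:R * v| < eta.
  elim: h => [|h IH] hn; first by rewrite mul0r normr0.
  apply: cos_gt_small => //; last first.
    have n0 : (0 < n)%N by lia.
    by have := dirichlet_shift v n0 hn; rewrite -Dv; lra.
  case: h IH hn => [|h] IH hn; first by rewrite mul1r.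
  have hv : `|h.+1%:R * v| < eta by apply: IH; lia.
  have vv : `|v| <= `|h.+1%:R * v| by rewrite normrM ler_peMl// ger0_norm// ler1n.
  rewrite -natr1 mulrDl mul1r (le_trans (ler_normD _ _))//; lra.
have hn2 : (n./2.*2 <= n)%N by rewrite -{2}(odd_double_half n) leq_addl.
have := small _ hn2; rewrite normrM ger0_norm// => hv.
have n3 : n%:R <= 3 * (n./2)%:R :> R.
  rewrite -natrM ler_nat -{1}(odd_double_half n); case: (odd n) (odd_double_half n) => /=; lia.
have : n%:R * `|v| <= 3 * (n./2)%:R * `|v| by rewrite ler_wpM2r.
lra.
Qed.

Lemma cis_sub1_le u : normc (cis u - 1) <= `|u|.
Proof.
have sin_le t : 0 <= t -> `|sin t| <= t.
  move=> t0; have [|c _] := @MVT_segment R sin cos 0 t t0.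
    by apply: continuous_subspaceT => x; exact: continuous_sin.
  by rewrite sin0 !subr0 => ->; rewrite normrM (ger0_norm t0) ler_piMl// cos_max.
rewrite -(ler_pXn2r (_ : 0 < 2)%N) ?nnegrE ?normc_ge0// sqr_normcE /= ?subr0 ?oppr0 ?addr0 real_normK ?num_real//.
have -> : (cos u - 1) ^+ 2 + sin u ^+ 2 = 4 * sin (u / 2) ^+ 2.
  have := cos2Dsin2 u; have := cos_mulr2n (u / 2); have := cos2Dsin2 (u / 2).
  have -> : u / 2 *+ 2 = u by rewrite -mulr_natr; field.
  rewrite mulr2n; move=> h1 h2 h3; rewrite h2 in h3 *. nra.
have h : `|sin (u / 2)| <= `|u / 2|.
  have [u0|u0] := lerP 0 (u / 2); first by rewrite (ger0_norm u0) sin_le.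
  by rewrite (ltr0_norm u0) -normrN -sinN; apply: sin_le; lra.
have h2 : sin (u / 2) ^+ 2 <= (u / 2) ^+ 2.
  rewrite -[leLHS]real_normK ?num_real// -[leRHS]real_normK ?num_real//.
  by rewrite ler_pXn2r ?nnegrE.
lra.
Qed.

(** At distance [o(1/n)] from zero the kernel tends to 1. *)
Lemma dirichlet_near n u : (0 < n)%N -> normc (dirichlet n u - 1) <= n%:R * `|u|.
Proof.
move=> n0; have nR0 : 0 < n%:R :> R by rewrite ltr0n.
have -> : dirichlet n u - 1 = Complex n%:R^-1 0 * \sum_(1 <= j < n.+1) (cis (j%:R * u) - 1).
  rewrite sumrB mulrBr; congr (_ - _).
  rewrite big_const_nat iter_addr_0 subn1 /=.
  have -> : 1 *+ n = Complex n%:R 0 :> R[i] by rewrite -(rmorph_nat (real_complex R) n).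
  apply/eqP; rewrite eq_complex /= !mulr0 !mul0r subr0 addr0 mulVf ?eqxx// gt_eqF//.
rewrite ComplexField.Normc.normcM normc_real ger0_norm ?invr_ge0// ler_pdivrMl//.
apply: (le_trans (normc_sum _ _ _)).
apply: (@le_trans _ _ (\sum_(1 <= j < n.+1) (n%:R * `|u|))).
  rewrite !big_seq; apply: ler_sum => j; rewrite mem_index_iota => /andP[_ jn].
  apply: (le_trans (cis_sub1_le _)); rewrite normrM ger0_norm// ler_wpM2r// ler_nat; lia.
by rewrite big_const_nat iter_addr_0 subn1 -[leLHS]mulr_natl lexx.
Qed.

End kernel.

(** * Fourier transforms of superpositions of tones *)

Section fourier.
Variable R : realType.
Implicit Types (u v t : R) (z w : R[i]) (n h j : nat) (y : nat -> R).

(** The periodogram is the squared modulus of this transform. *)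
Definition fourier n y u : R[i] :=
  Complex n%:R^-1 0 * \sum_(1 <= j < n.+1) Complex (y j) 0 * cis (- (j%:R * u)).

Definition mean_square n y : R := n%:R^-1 * \sum_(1 <= j < n.+1) y j ^+ 2.

Definition wave (a b zeta : R) j : R := a * cos (j%:R * zeta) + b * sin (j%:R * zeta).

Lemma fourierE n y u : fourier n y u =
  Complex (n%:R^-1 * \sum_(1 <= j < n.+1) y j * cos (j%:R * u))
          (- (n%:R^-1 * \sum_(1 <= j < n.+1) y j * sin (j%:R * u))).
Proof.
rewrite /fourier mulc_real Re_sum Im_sum; congr Complex.
  by congr (_ * _); apply: eq_bigr => j _; rewrite mulc_real /= cosN.
rewrite -mulrN -sumrN; congr (_ * _).
by apply: eq_bigr => j _; rewrite mulc_real /= sinN mulrN.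
Qed.

Lemma fourierB n y y' u :
  fourier n (fun j => y j - y' j) u = fourier n y u - fourier n y' u.
Proof.
rewrite /fourier -mulrBr -sumrB; congr (_ * _); apply: eq_bigr => j _.
by rewrite -mulrBl; congr (_ * _); apply/eqP; rewrite eq_complex /= subr0 !eqxx.
Qed.

Lemma fourier_sum (I : Type) (r : seq I) (P : pred I) (F : I -> nat -> R) n u :
  fourier n (fun j => \sum_(i <- r | P i) F i j) u = \sum_(i <- r | P i) fourier n (F i) u.
Proof.
rewrite /fourier -mulr_sumr exchange_big /=; congr (_ * _).
apply: eq_bigr => j _; rewrite -mulr_suml; congr (_ * _).
by rewrite -[LHS]/(real_complex R _) rmorph_sum.
Qed.

(** Only the part of frequency [zeta] resonates when [u] is close to [zeta];
    its coefficient [(a - i b) / 2] gives back both regression coefficients. *)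
Lemma fourier_wave n (a b zeta : R) u : fourier n (wave a b zeta) u =
  Complex (a / 2) (- (b / 2)) * dirichlet n (zeta - u) +
  Complex (a / 2) (b / 2) * dirichlet n (- zeta - u).
Proof.
rewrite /fourier /dirichlet !(mulrCA _ (Complex n%:R^-1 0)) -mulrDr; congr (_ * _).
rewrite 2!mulr_sumr -big_split; apply: eq_bigr => j _ /=.
rewrite !mulrBr !cisD !mulrA -mulrDl; congr (_ * _).
apply/eqP; rewrite eq_complex /wave /= mulrN cosN sinN.
by apply/andP; split; apply/eqP; field.
Qed.

(** Bessel's inequality for one frequency: subtracting from [y] its component
    along the vector of the [cis (j u)] lowers the mean square by the squared
    modulus of the transform. *)
Lemma fourier_le_mean_square n y u : (0 < n)%N ->
  normc (fourier n y u) ^+ 2 <= mean_square n y.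
Proof.
move=> n0; have nR0 : 0 < n%:R :> R by rewrite ltr0n.
rewrite sqr_normcE fourierE /= sqrrN /mean_square.
set p := n%:R^-1 * _; set q := n%:R^-1 * _.
have -> : \sum_(1 <= j < n.+1) y j ^+ 2 = \sum_(1 <= j < n.+1)
   (((y j - (p * cos (j%:R * u) + q * sin (j%:R * u))) ^+ 2
    + (q * cos (j%:R * u) - p * sin (j%:R * u)) ^+ 2)
    + 2 * p * (y j * cos (j%:R * u)) + 2 * q * (y j * sin (j%:R * u)) - (p ^+ 2 + q ^+ 2)).
  apply: eq_bigr => j _.
  have := cos2Dsin2 (j%:R * u); move: (cos _) (sin _) => c s cs.
  have -> : p ^+ 2 + q ^+ 2 = (p ^+ 2 + q ^+ 2) * (c ^+ 2 + s ^+ 2) by rewrite cs mulr1.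
  ring.
rewrite sumrB 2!big_split /= -!mulr_sumr.
have -> : \sum_(1 <= j < n.+1) (y j * cos (j%:R * u)) = n%:R * p by rewrite /p mulrA divff ?mul1r// gt_eqF.
have -> : \sum_(1 <= j < n.+1) (y j * sin (j%:R * u)) = n%:R * q by rewrite /q mulrA divff ?mul1r// gt_eqF.
rewrite big_const_nat iter_addr_0 subn1 /= -[X in _ - X]mulr_natl ler_pdivlMl//.
set S := \sum_(1 <= j < n.+1) _.
have S0 : 0 <= S by apply: sumr_ge0 => j _; rewrite addr_ge0// sqr_ge0.
lra.
Qed.

Lemma mean_square_le_bound n y (e : R) : 0 <= e ->
  (forall j, (1 <= j <= n)%N -> `|y j| <= e) -> mean_square n y <= e ^+ 2.
Proof.
move=> e0 ye; rewrite /mean_square.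
case: n ye => [|n] ye; first by rewrite invr0 mul0r sqr_ge0.
rewrite ler_pdivrMl ?ltr0n//.
apply: (@le_trans _ _ (\sum_(1 <= j < n.+2) e ^+ 2)).
  rewrite !big_seq; apply: ler_sum => j; rewrite mem_index_iota => jn.
  by rewrite -real_normK ?num_real// ler_pXn2r ?nnegrE ?ye.
by rewrite big_const_nat iter_addr_0 subn1 -[leLHS]mulr_natl lexx.
Qed.

Lemma mean_squareD n y y' :
  mean_square n (fun j => y j + y' j) <= 2 * mean_square n y + 2 * mean_square n y'.
Proof.
rewrite /mean_square (mulrCA 2) (mulrCA 2 _ (\sum_(_ <= _ < _) y' _ ^+ 2)) -mulrDr.
rewrite ler_wpM2l ?invr_ge0// !mulr_sumr -big_split; apply: ler_sum => j _ /=.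
by have := sqr_ge0 (y j - y' j); nra.
Qed.

Lemma cos_regressionE (delta : R) n y u :
  cos_regression delta n y u = 2 * complex.Re (fourier n y (delta * u)).
Proof.
rewrite fourierE /cos_regression /= -mulrA; congr (_ * (_ * _)).
by apply: eq_bigr => j _; rewrite mulrA.
Qed.

Lemma sin_regressionE (delta : R) n y u :
  sin_regression delta n y u = - 2 * complex.Im (fourier n y (delta * u)).
Proof.
rewrite fourierE /sin_regression /= mulrNN -mulrA; congr (_ * (_ * _)).
by apply: eq_bigr => j _; rewrite mulrA.
Qed.

Lemma normc_cisB u v : normc (cis u - cis v) <= `|u - v|.
Proof.
have -> : cis u - cis v = cis v * (cis (u - v) - 1).
  by rewrite mulrBr mulr1 -cisD (addrC v) subrK.
by rewrite ComplexField.Normc.normcM normc_cis mul1r cis_sub1_le.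
Qed.

Lemma cos_lip u v : `|cos u - cos v| <= `|u - v|.
Proof.
rewrite (_ : cos u - cos v = complex.Re (cis u - cis v))//.
exact: le_trans (Re_le_normc _) (normc_cisB u v).
Qed.

Lemma sin_lip u v : `|sin u - sin v| <= `|u - v|.
Proof.
rewrite (_ : sin u - sin v = complex.Im (cis u - cis v))//.
exact: le_trans (Im_le_normc _) (normc_cisB u v).
Qed.

Lemma finite_lower_bound (I : finType) (F : I -> R) :
  (forall i, 0 < F i) -> exists2 mu : R, 0 < mu & forall i, mu <= F i.
Proof.
move=> F0; exists (\big[Order.min/1]_i F i).
  by apply: lt_bigmin.
by move=> i; exact: bigmin_le_cond.
Qed.

End fourier.

Section resolution.
Variables (R : realType) (a b zeta : nat -> R).
Hypothesis sin_zeta : forall k, sin (zeta k) != 0.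
Hypothesis cos_zeta : forall k l, k != l -> cos (zeta k) != cos (zeta l).

(** A real tone has the two complex frequencies [zeta k] and [- zeta k]; [true]
    stands for the minus sign. *)
Definition signed_freq (p : nat * bool) : R := if p.2 then - zeta p.1 else zeta p.1.

Lemma signed_freq_inj p q : cis (signed_freq p) = cis (signed_freq q) -> p = q.
Proof.
case: p q => k s [l s'] [].
have cs (c : bool) m : cos (signed_freq (m, c)) = cos (zeta m).
  by rewrite /signed_freq; case: c; rewrite /= ?cosN.
rewrite !cs => /eqP; have [->|/cos_zeta/negP//] := eqVneq k l.
move=> _; rewrite /signed_freq /=; have := sin_zeta l.
by case: s s' => -[]//=; rewrite sinN => /eqP H1 H2; exfalso; apply: H1; lra.
Qed.

(** Finitely many distinct points of the circle have a positive minimal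
    distance [mu]; an angle is within [mu / 2] of at most one of them, and
    [dirichlet_far] applies to all the others.  When there is none, [p0] is
    arbitrary. *)
Lemma frequencies_separated (K : nat) (e : R) : 0 < e ->
  exists n0, forall n, (n0 <= n)%N -> forall u, exists p0 : nat * bool,
    forall p, (p.1 < K)%N -> p != p0 -> normc (dirichlet n (signed_freq p - u)) <= e.
Proof.
move=> e0; pose J := ('I_K * bool)%type.
pose sf (i : J) := cis (signed_freq (val i.1, i.2)).
pose F (i : J * J) := if i.1 == i.2 then 1 else normc (sf i.1 - sf i.2).
have [[[i1 s1] [i2 s2]]|mu mu0 Fmu] := finite_lower_bound (F := F).
  rewrite /F; case: ifPn => [_|/eqP ne]; first exact: ltr01.
  rewrite lt_neqAle normc_ge0 andbT eq_sym.
  apply/eqP => /(@ComplexField.Normc.eq0_normc _) /eqP; rewrite subr_eq0 => /eqP/signed_freq_inj[] /val_inj E1 E2.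
  by apply: ne; rewrite E1 E2.
have [n0 n0P] : exists n0 : nat, 4 / (mu * e) < n0%:R.
  exists (Num.bound (4 / (mu * e))).
  by rewrite (le_lt_trans _ (archi_boundP _))// divr_ge0// mulr_ge0// ltW.
exists n0.+1 => n n0n u.
have nR0 : 0 < n%:R :> R by rewrite ltr0n; lia.
have far p : (p.1 < K)%N -> mu / 2 <= normc (cis (signed_freq p) - cis u) ->
    normc (dirichlet n (signed_freq p - u)) <= e.
  move=> pK sep; have := dirichlet_far (signed_freq p - u) (_ : 0 < n)%N.
  have -> : normc (1 - cis (signed_freq p - u)) = normc (cis (signed_freq p) - cis u).
    rewrite -[cis (signed_freq p) in RHS](_ : cis u * cis (signed_freq p - u) = _); last first.
      by rewrite -cisD (addrC u) subrK.
    by rewrite -{2}[cis u]mulr1 -mulrBr ComplexField.Normc.normcM normc_cis mul1r -normcN opprB.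
  move=> /(_ (leq_ltn_trans (leq0n _) n0n)) H.
  have : normc (dirichlet n (signed_freq p - u)) * (mu / 2) <= 2 / n%:R.
    by apply: le_trans H; rewrite ler_wpM2l ?normc_ge0.
  rewrite -ler_pdivlMr ?divr_gt0// => /le_trans; apply.
  rewrite ler_pdivrMr ?divr_gt0// ler_pdivrMr//.
  have nn : n0%:R <= n%:R :> R by rewrite ler_nat ltnW.
  have : 4 / (mu * e) < n%:R by exact: lt_le_trans nn.
  by rewrite ltr_pdivrMr ?mulr_gt0//; lra.
have [[i imu]|noclose] := pselect (exists i : J, normc (sf i - cis u) < mu / 2).
  exists (val i.1, i.2) => -[k s] /= kK ne; apply: far => //.
  rewrite leNgt; apply/negP => close.
  have := Fmu ((Ordinal kK, s), i); rewrite /F; case: ifPn => [/eqP ii|_].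
    by move: ne; rewrite /= in ii; rewrite -ii /= eqxx.
  rewrite leNgt => /negP; apply.
  rewrite [X in normc X](_ : _ = (sf (Ordinal kK, s) - cis u) + - (sf i - cis u)); last by rewrite /=; ring.
  rewrite (le_lt_trans (le_normcD _ _))// normcN.
  have close' : normc (sf (Ordinal kK, s) - cis u) < mu / 2 := close.
  lra.
exists (0%N, false) => -[k s] /= kK ne; apply: far => //.
rewrite leNgt; apply/negP => close; apply: noclose.
by exists (Ordinal kK, s).
Qed.

Definition amp k : R := Num.sqrt (a k ^+ 2 + b k ^+ 2).
Definition coef (p : nat * bool) : R[i] :=
  if p.2 then Complex (a p.1 / 2) (b p.1 / 2) else Complex (a p.1 / 2) (- (b p.1 / 2)).

Lemma amp_ge0 k : 0 <= amp k. Proof. exact: sqrtr_ge0. Qed.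

Lemma normc_coef p : normc (coef p) = amp p.1 / 2.
Proof.
apply/eqP; rewrite -(eqrXn2 (_ : 0 < 2)%N) ?normc_ge0 ?divr_ge0 ?amp_ge0//.
rewrite sqr_normcE expr_div_n sqr_sqrtr ?addr_ge0 ?sqr_ge0//.
by rewrite /coef; case: p.2 => /=; apply/eqP; field.
Qed.

Definition tone k := wave (a k) (b k) (zeta k).

(** The tones outside [I] represent [y], the sample of size [n] being [y n].  A
    bound for infinitely many truncations suffices, and it is all that the
    maximal inequality provides. *)
Definition approximated (I : pred nat) (y : nat -> nat -> R) :=
  forall e K1, 0 < e -> exists2 K, (K1 <= K)%N & exists n0, forall n, (n0 <= n)%N ->
  mean_square n (fun j => y n j - \sum_(k < K | ~~ I k) tone k j) <= e.

Section single_tone.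
Variables (I : pred nat) (kst : nat) (y : nat -> nat -> R).
Hypothesis kstI : ~~ I kst.
Hypothesis approx : approximated I y.

(** The truncated sum is dominated by the one frequency [p0] close to [u], and
    the truncation error is a mean square.  The last clause serves when
    [u] is close to [zeta kst]: the kernel is then not small at [zeta kst - u],
    and [p0] has to be this frequency. *)
Lemma fourier_single_tone (e : R) : 0 < e -> exists n0, forall n, (n0 <= n)%N ->
  forall u, exists p0 : nat * bool,
   [/\ normc (fourier n (y n) u) <=
         (if ~~ I p0.1 then amp p0.1 / 2 * normc (dirichlet n (signed_freq p0 - u)) else 0) + e,
       p0 = (kst, false) ->
         normc (fourier n (y n) u - coef p0 * dirichlet n (signed_freq p0 - u)) <= e
     & (kst, false) != p0 -> normc (dirichlet n (signed_freq (kst, false) - u)) <= e].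
Proof.
move=> e0.
have e20 : 0 < (e / 2) ^+ 2 by rewrite exprn_gt0// divr_gt0.
have [K Kst [n1 apprK]] := approx kst.+1 e20.
pose S := \sum_(k < K | ~~ I k) amp k.
have S0 : 0 <= S by apply: sumr_ge0 => k _; exact: amp_ge0.
pose e' := Num.min e (e / (2 * (S + 1))).
have e'0 : 0 < e' by rewrite lt_min e0 divr_gt0// mulr_gt0// ltr_wpDl.
have e'S : e' * S <= e / 2.
  have : e' * (S + 1) <= e / 2.
    rewrite -ler_pdivlMr ?ltr_wpDl// ge_min; apply/orP; right.
    by rewrite invfM mulrA.
  lra.
have [n2 sep] := frequencies_separated K e'0.
exists (maxn 1 (maxn n1 n2)) => n; rewrite !geq_max => /and3P[n_gt0 n1n n2n] u.
have {sep}[p0 sep] := sep n n2n u; exists p0.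
pose G := \sum_(k < K | ~~ I k)
  (coef (val k, false) * dirichlet n (signed_freq (val k, false) - u) +
   coef (val k, true) * dirichlet n (signed_freq (val k, true) - u)).
have FG : normc (fourier n (y n) u - G) <= e / 2.
  have -> : G = fourier n (fun j => \sum_(k < K | ~~ I k) tone k j) u.
    by rewrite fourier_sum; apply: eq_bigr => k _; rewrite /tone fourier_wave.
  rewrite -fourierB -(ler_pXn2r (_ : 0 < 2)%N) ?nnegrE ?normc_ge0 ?divr_ge0 ?(ltW e0)//.
  by apply: le_trans (apprK n n1n); exact: fourier_le_mean_square.
pose m p := coef p * dirichlet n (signed_freq p - u).
have small p : (p.1 < K)%N -> p != p0 -> normc (m p) <= amp p.1 / 2 * e'.
  move=> pK pp0; rewrite ComplexField.Normc.normcM normc_coef ler_wpM2l ?sep//.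
  by rewrite divr_ge0// amp_ge0.
(* The main term [m p0] is set apart: in its place [m'] is zero. *)
pose m' p := if p == p0 then 0 else m p.
have restS : normc (\sum_(k < K | ~~ I k) (m' (val k, false) + m' (val k, true))) <= e / 2.
  apply: le_trans (normc_sum _ _ _) _; apply: le_trans e'S.
  rewrite /S mulr_sumr; apply: ler_sum => k _.
  have sm s : normc (m' (val k, s)) <= amp k / 2 * e'.
    rewrite /m'; case: eqP => [_|/eqP ne]; last by apply: (small (val k, s)) => /=.
    by rewrite ComplexField.Normc.normc0 mulr_ge0 ?divr_ge0 ?amp_ge0 ?ltW.
  have := sm false; have := sm true.
  have := le_normcD (m' (val k, false)) (m' (val k, true)); lra.
have Gm : G = (if (p0.1 < K)%N && ~~ I p0.1 then m p0 else 0) +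
    \sum_(k < K | ~~ I k) (m' (val k, false) + m' (val k, true)).
  have mE p : m p = m' p + (if p == p0 then m p0 else 0).
    by rewrite /m'; case: eqP => [->|_]; rewrite ?add0r ?addr0.
  have -> : G = \sum_(k < K | ~~ I k) (m' (val k, false) + m' (val k, true)) +
     \sum_(k < K | ~~ I k) (if val k == p0.1 then m p0 else 0).
    rewrite -big_split; apply: eq_bigr => k _ /=.
    rewrite -/(m (val k, false)) -/(m (val k, true)) (mE (val k, false)) (mE (val k, true)) addrACA; congr (_ + _).
    case: p0 {sep small m' mE restS} => k0 s0 /=; rewrite !xpair_eqE.
    by case: eqP; case: s0; rewrite /= ?addr0 ?add0r.
  rewrite addrC; congr (_ + _); rewrite -big_mkcondr /=.
  have [p0K|p0K] := ltnP p0.1 K; last first.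
    by rewrite big_pred0// => k; apply/negP => /andP[_ /eqP kp]; move: p0K; rewrite -kp leqNgt ltn_ord.
  have [Ip|Ip] := boolP (I p0.1).
    by rewrite big_pred0// => k; apply/negP => /andP[Ik /eqP kp]; rewrite kp Ip in Ik.
  rewrite (big_pred1 (Ordinal p0K))// => k /=.
  by rewrite -val_eqE /=; case: eqP => [->|]; rewrite ?Ip ?andbF.
have Gmain : normc (G - (if (p0.1 < K)%N && ~~ I p0.1 then m p0 else 0)) <= e / 2.
  by rewrite Gm addrAC subrr add0r.
have Fmain : normc (fourier n (y n) u - (if (p0.1 < K)%N && ~~ I p0.1 then m p0 else 0)) <= e.
  have -> : fourier n (y n) u - (if (p0.1 < K)%N && ~~ I p0.1 then m p0 else 0) =
    (fourier n (y n) u - G) + (G - (if (p0.1 < K)%N && ~~ I p0.1 then m p0 else 0)) by ring.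
  by have := le_normcD (fourier n (y n) u - G)
     (G - (if (p0.1 < K)%N && ~~ I p0.1 then m p0 else 0)); lra.
split.
- have := le_normcD (fourier n (y n) u - (if (p0.1 < K)%N && ~~ I p0.1 then m p0 else 0))
    (if (p0.1 < K)%N && ~~ I p0.1 then m p0 else 0).
  rewrite subrK => /le_trans; apply; rewrite addrC lerD//.
  have D0 : 0 <= amp p0.1 / 2 * normc (dirichlet n (signed_freq p0 - u)).
    by rewrite mulr_ge0 ?divr_ge0 ?amp_ge0 ?normc_ge0.
  case: ifP => [/andP[_ ->]|_]; last by rewrite ComplexField.Normc.normc0; case: ifP.
  by rewrite ComplexField.Normc.normcM normc_coef.
- by move=> p0E; move: Fmain; rewrite p0E /= Kst kstI.
- by move=> ne; apply: le_trans (sep _ _ ne) _ => //; rewrite ge_min lexx.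
Qed.

End single_tone.
End resolution.

(** * The largest peak *)

Section aliasing.
Variable R : realType.
Implicit Types (zeta theta : R).

Lemma sin_mulz_pi (l : int) : sin (l%:~R * pi) = 0 :> R.
Proof.
have sinn (k : nat) : sin (k%:R * pi) = 0 :> R.
  elim: k => [|k IH]; first by rewrite mul0r sin0.
  by rewrite -[k.+1]addn1 natrD mulrDl mul1r sinDpi IH oppr0.
by case: l => k; rewrite ?NegzE ?mulrNz ?mulNr ?sinN sinn ?oppr0.
Qed.

(** The aliases of [zeta] are the [zeta + 2 pi q] and the [- zeta + 2 pi q].
    Every band between consecutive multiples of pi contains only one of them,
    and [zeta] is interior to its band because its sine does not vanish. *)
Lemma alias_unique zeta : sin zeta != 0 -> exists2 eta : R, 0 < eta &
  forall theta (s : bool) (q : int), Num.floor (theta / pi) = Num.floor (zeta / pi) ->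
  `|(if s then - zeta else zeta) - theta - 2 * pi * q%:~R| < eta -> s = false /\ q = 0.
Proof.
move=> sz; have pi0 := pi_gt0 R.
set l := Num.floor (zeta / pi).
have lz : l%:~R * pi <= zeta by rewrite -ler_pdivlMr// floor_le.
have zl : zeta < (l%:~R + 1) * pi by rewrite -ltr_pdivrMr// -intrD1 floorD1_gt.
have lz' : l%:~R * pi < zeta.
  by rewrite lt_neqAle lz andbT; apply: contra_neq sz => <-; exact: sin_mulz_pi.
exists (Num.min (zeta - l%:~R * pi) ((l%:~R + 1) * pi - zeta)).
  by rewrite lt_min !subr_gt0 lz' zl.
move=> theta s q fl; rewrite lt_min => /andP[].
have lt : l%:~R * pi <= theta by rewrite -ler_pdivlMr// -fl floor_le.
have tl : theta < (l%:~R + 1) * pi by rewrite -ltr_pdivrMr// -intrD1 -fl floorD1_gt.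
rewrite !ltr_norml; case: s => /=; move=> /andP[h1 h2] /andP[h3 h4].
  exfalso.
  have ql : l%:~R < (- q)%:~R :> R by rewrite -(ltr_pM2r pi0) rmorphN /=; lra.
  have lq : (- q)%:~R < (l + 1)%:~R :> R.
    by rewrite -(ltr_pM2r pi0) rmorphN /= intrD; lra.
  move: ql lq; rewrite !ltr_int; clear; lia.
split=> //; have q1 : q%:~R < 1%:~R :> R by rewrite -(ltr_pM2r pi0); lra.
have q2 : (-1)%:~R < q%:~R :> R by rewrite -(ltr_pM2r pi0); lra.
move: q1 q2; rewrite !ltr_int; clear; lia.
Qed.

End aliasing.

Section peak_step.
Variables (R : realType) (a b zeta : nat -> R).
Hypothesis sin_zeta : forall k, sin (zeta k) != 0.
Hypothesis cos_zeta : forall k l, k != l -> cos (zeta k) != cos (zeta l).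
Local Notation amp := (amp a b).
Local Notation tone := (tone a b zeta).
Local Notation coef := (coef a b).
Local Notation approximated := (approximated a b zeta).

Variables (I : pred nat) (kst : nat) (y : nat -> nat -> R) (theta : nat -> R).
Hypothesis kstI : ~~ I kst.
Hypothesis approx : approximated I y.
Let tone_lemma := fourier_single_tone sin_zeta cos_zeta kstI approx.

Lemma dirichlet0 n : (0 < n)%N -> dirichlet n 0 = 1 :> R[i].
Proof.
move=> n0; have := @dirichlet_near R n 0 n0; rewrite normr0 mulr0 => D0.
have /ComplexField.Normc.eq0_normc/eqP : normc (dirichlet n 0 - 1 : R[i]) = 0.
  by apply/eqP; rewrite eq_le D0 normc_ge0.
by rewrite subr_eq0 => /eqP.
Qed.

(** At the frequency itself the kernel is 1, so that [fourier_single_tone] can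
    only have picked this frequency. *)
Lemma fourier_at_tone (e : R) : 0 < e -> exists n0, forall n, (n0 <= n)%N ->
  normc (fourier n (y n) (zeta kst) - coef (kst, false)) <= e.
Proof.
move=> e0; have e'0 : 0 < Num.min e 2^-1 by rewrite lt_min e0 invr_gt0 ltr0n.
have [n1 H] := tone_lemma e'0; exists n1.+1 => n n1n.
have [p0 [_ H2 H3]] := H n (ltnW n1n) (zeta kst).
have [p0E|ne] := eqVneq (kst, false) p0.
  have := H2 (esym p0E); rewrite -p0E /signed_freq /= subrr dirichlet0 ?mulr1; last exact: leq_ltn_trans n1n.
  by move=> /le_trans; apply; rewrite ge_min lexx.
have := H3 ne; rewrite /signed_freq [_ - _]/= subrr dirichlet0 ?ComplexField.Normc.normc1; last exact: leq_ltn_trans n1n.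
by rewrite le_min => /andP[_]; lra.
Qed.

Hypothesis amp_kst : 0 < amp kst.
Variable g : R.
Hypothesis g0 : 0 < g.
Hypothesis gap : forall k, ~~ I k -> k != kst -> amp k <= amp kst - g.
Hypothesis peak : forall n, (0 < n)%N ->
  periodogram n (y n) (zeta kst) <= periodogram n (y n) (theta n).

(** The periodogram at [theta n] exceeds the one at [zeta kst], which is about
    [(amp kst / 2) ^ 2].  The frequency that resonates with [theta n] then has
    the amplitude [amp kst], all the others being smaller by [g], and the kernel
    has modulus close to 1. *)
Lemma peak_localizes (eta : R) : 0 < eta <= pi / 2 -> exists n0, forall n, (n0 <= n)%N ->
  exists (s : bool) (q : int),
    n%:R * `|(if s then - zeta kst else zeta kst) - theta n - 2 * pi * q%:~R| <= 3 * eta.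
Proof.
move=> eta_b; have /andP[eta0 eta1] := eta_b; have pi0 := pi_gt0 R.
pose kap := 1 - cos eta.
have kap0 : 0 < kap.
  rewrite subr_gt0 -[ltRHS](cos0 R) ltr_cos// in_itv /= ?lexx ?pi_ge0//.
  by apply/andP; split; lra.
have kap2 : kap <= 2 by rewrite /kap; have := cos_geN1 eta; lra.
(* With [e <= g / 8] no other tone can account for the peak, and with
   [e <= amp kst * kap / 64] the kernel is large enough for [dirichlet_peak]. *)
pose e := Num.min (2^-1) (Num.min (amp kst * kap / 64) (g / 8)).
have e0 : 0 < e by rewrite !lt_min invr_gt0 ltr0n !divr_gt0// mulr_gt0.
have [e1 [e2 e3]] : e <= 2^-1 /\ (e <= amp kst * kap / 64 /\ e <= g / 8).
  by split; [|split]; rewrite !ge_min lexx ?orbT.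
have [n1 H] := tone_lemma e0; have [n2 Hz] := fourier_at_tone e0.
exists (maxn 2 (maxn n1 n2)) => n; rewrite !geq_max => /and3P[n_gt1 n1n n2n].
have n_gt0 : (0 < n)%N by exact: ltnW.
have Fle : normc (fourier n (y n) (zeta kst)) <= normc (fourier n (y n) (theta n)).
  by rewrite -(ler_pXn2r (_ : 0 < 2)%N) ?nnegrE ?normc_ge0//; exact: peak.
have Fz : amp kst / 2 - e <= normc (fourier n (y n) (zeta kst)).
  have := Hz n n2n => H1.
  have := le_normcD (fourier n (y n) (zeta kst)) (- (fourier n (y n) (zeta kst) - coef (kst, false))).
  rewrite (_ : _ + - _ = coef (kst, false)); last by ring.
  by rewrite normcN normc_coef; lra.
have [p0 [H1 _ _]] := H n n1n (theta n).
have ak : amp kst * kap <= amp kst * 2 by rewrite ler_wpM2l// ltW.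
case: ifPn H1 => [Ip0|_] H1; last lra.
set D := normc (dirichlet _ _) in H1.
have D1 : D <= 1 by exact: dirichlet_le1.
have D0 : 0 <= D by exact: normc_ge0.
have p0k : p0.1 = kst.
  apply/eqP/negPn/negP => ne; have := gap Ip0 ne => gapp.
  have : amp p0.1 / 2 * D <= amp p0.1 / 2 by rewrite ler_piMr// divr_ge0// amp_ge0.
  by move: H1; lra.
exists p0.2; move: H1; rewrite p0k => H1.
have [q Hq] : exists q : int, n%:R * `|signed_freq zeta p0 - theta n - 2 * pi * q%:~R| <= 3 * eta.
  apply: dirichlet_peak => //; rewrite -/D -/kap.
  rewrite -(ltr_pM2l amp_kst).
  have : amp kst * (1 - D) <= 4 * e by lra.
  have : 1 - D ^+ 2 <= 2 * (1 - D) by nra.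
  move=> h1; have : amp kst * (1 - D ^+ 2) <= amp kst * (2 * (1 - D)) by rewrite ler_wpM2l// ltW.
  have : 0 < amp kst * kap by rewrite mulr_gt0.
  lra.
by exists q; move: Hq; rewrite /signed_freq p0k.
Qed.

Hypothesis band : exists n0, forall n, (n0 <= n)%N ->
  Num.floor (theta n / pi) = Num.floor (zeta kst / pi).

Lemma peak_cvg (e : R) : 0 < e -> exists n0, forall n, (n0 <= n)%N ->
  n%:R * `|zeta kst - theta n| <= e.
Proof.
move=> e0; have pi0 := pi_gt0 R.
have [eta0 eta0_gt0 alias] := alias_unique (sin_zeta kst).
pose eta := Num.min (pi / 2) (Num.min (e / 3) (eta0 / 4)).
have eta_gt0 : 0 < eta by rewrite !lt_min !divr_gt0.
have [h1 [h2 h3]] : eta <= pi / 2 /\ (eta <= e / 3 /\ eta <= eta0 / 4).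
  by split; [|split]; rewrite !ge_min lexx ?orbT.
have [|n1 loc] := @peak_localizes eta; first by rewrite eta_gt0.
have [n2 bandn] := band.
exists (maxn 1 (maxn n1 n2)) => n; rewrite !geq_max => /and3P[n_gt0 n1n n2n].
have [s [q H]] := loc n n1n.
have close : `|(if s then - zeta kst else zeta kst) - theta n - 2 * pi * q%:~R| < eta0.
  rewrite (le_lt_trans (_ : _ <= 3 * eta))//; last lra.
  by apply: le_trans H; rewrite ler_peMl// ler1n.
have [sE qE] := alias _ _ _ (bandn n n2n) close.
by move: H; rewrite sE qE mulr0 subr0; lra.
Qed.

(** By [peak_cvg] the kernel at [zeta kst - theta n] tends to 1. *)
Lemma fourier_at_peak (e : R) : 0 < e -> exists n0, forall n, (n0 <= n)%N ->
  normc (fourier n (y n) (theta n) - coef (kst, false)) <= e.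
Proof.
move=> e0.
pose e1 := Num.min 4^-1 (e / 2).
have e10 : 0 < e1 by rewrite lt_min invr_gt0 ltr0n divr_gt0.
pose e2 := Num.min 4^-1 (e / (amp kst)).
have e20 : 0 < e2 by rewrite lt_min invr_gt0 ltr0n divr_gt0.
have [n1 H] := tone_lemma e10; have [n2 Hz] := peak_cvg e20.
exists (maxn 1 (maxn n1 n2)) => n; rewrite !geq_max => /and3P[n_gt0 n1n n2n].
have [p0 [_ H2 H3]] := H n n1n (theta n).
have D1 := le_trans (dirichlet_near (zeta kst - theta n) n_gt0) (Hz n n2n).
have [p0E|ne] := eqVneq (kst, false) p0; last first.
  exfalso; have := H3 ne; rewrite (_ : signed_freq zeta (kst, false) = zeta kst)//.
  have := le_normcD (dirichlet n (zeta kst - theta n)) (- (dirichlet n (zeta kst - theta n) - 1)).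
  rewrite (_ : _ + - _ = 1); last by ring.
  rewrite normcN ComplexField.Normc.normc1.
  move: D1; rewrite /e1 /e2 !le_min => /andP[+ _] + /andP[+ _]; lra.
have := H2 (esym p0E); rewrite -p0E (_ : signed_freq zeta (kst, false) = zeta kst)// => H4.
have -> : fourier n (y n) (theta n) - coef (kst, false) =
   (fourier n (y n) (theta n) - coef (kst, false) * dirichlet n (zeta kst - theta n)) +
    coef (kst, false) * (dirichlet n (zeta kst - theta n) - 1) by ring.
rewrite (le_trans (le_normcD _ _))// ComplexField.Normc.normcM normc_coef.
have : amp kst / 2 * normc (dirichlet n (zeta kst - theta n) - 1) <= amp kst / 2 * (e / amp kst).
  rewrite ler_wpM2l ?divr_ge0 ?amp_ge0//; apply: le_trans D1 _.
  by rewrite /e2 ge_min lexx orbT.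
have -> : amp kst / 2 * (e / amp kst) = e / 2 by field; rewrite gt_eqF.
have : e1 <= e / 2 by rewrite ge_min lexx orbT.
move: H4; lra.
Qed.

Let ahat n := 2 * complex.Re (fourier n (y n) (theta n)).
Let bhat n := - 2 * complex.Im (fourier n (y n) (theta n)).

Lemma regression_cvg (e : R) : 0 < e -> exists n0, forall n, (n0 <= n)%N ->
  `|a kst - ahat n| <= e /\ `|b kst - bhat n| <= e.
Proof.
move=> e0; have [|n0 H] := @fourier_at_peak (e / 2); first by rewrite divr_gt0.
exists n0 => n /H; rewrite /ahat /bhat; move: (fourier _ _ _) => z Hz.
have := le_trans (Re_le_normc _) Hz; have := le_trans (Im_le_normc _) Hz.
have -> : complex.Im (z - coef (kst, false)) = complex.Im z + b kst / 2.
  by rewrite /coef; case: (z) => u v /=; rewrite opprK.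
have -> : complex.Re (z - coef (kst, false)) = complex.Re z - a kst / 2.
  by rewrite /coef; case: (z).
rewrite !ler_norml => /andP[h1 h2] /andP[h3 h4].
by split; apply/andP; split; lra.
Qed.

(** The fitted wave differs from the tone [kst] by terms of size
    [j |zeta kst - theta n|], at most [n |zeta kst - theta n|], and by the errors
    of the coefficients. *)
Lemma residual_approximated :
  approximated (fun k => (k == kst) || I k)
    (fun n j => y n j - ahat n * cos (j%:R * theta n) - bhat n * sin (j%:R * theta n)).
Proof.
move=> e K1 e0.
pose e1 := Num.min 1 (e / 4).
have e10 : 0 < e1 by rewrite lt_min ltr01 divr_gt0.
have [K KK1 [n1 H1]] := approx (maxn K1 kst.+1) (divr_gt0 e0 (ltr0n R 4)).
move: KK1; rewrite geq_max => /andP[KK1 Kkst]; exists K => //.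
pose M := `|a kst| + `|b kst| + 1.
have M0 : 0 < M by rewrite ltr_wpDl// addr_ge0.
have [n2 H2] := @regression_cvg (e1 / 4) (divr_gt0 e10 (ltr0n R 4)).
have [n3 H3] := @peak_cvg (e1 / (2 * M)) (divr_gt0 e10 (mulr_gt0 (ltr0n R 2) M0)).
exists (maxn 1 (maxn n1 (maxn n2 n3))) => n; rewrite !geq_max => /and4P[n_gt0 n1n n2n n3n].
have [Ha Hb] := H2 n n2n; have Hz := H3 n n3n; have Hm := H1 n n1n.
pose d j := a kst * (cos (j%:R * zeta kst) - cos (j%:R * theta n))
   + b kst * (sin (j%:R * zeta kst) - sin (j%:R * theta n))
   + ((a kst - ahat n) * cos (j%:R * theta n) + (b kst - bhat n) * sin (j%:R * theta n)).
have -> : (fun j => y n j - ahat n * cos (j%:R * theta n) - bhat n * sin (j%:R * theta n) -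
     \sum_(k < K | ~~ ((k == kst :> nat) || I k)) tone k j) =
   (fun j => (y n j - \sum_(k < K | ~~ I k) tone k j) + d j).
  apply/funext => j; rewrite [in RHS](bigD1 (Ordinal Kkst))//=.
  rewrite (eq_bigl (fun k : 'I_K => ~~ I k && (k != Ordinal Kkst))); last first.
    by move=> k; rewrite negb_or andbC -val_eqE.
  by rewrite /d /tone /wave; ring.
apply: le_trans (mean_squareD _ _ _) _.
have Hd : mean_square n d <= e1 ^+ 2.
  apply: mean_square_le_bound; first exact: ltW.
  move=> j /andP[_ jn].
  have jz : `|j%:R * zeta kst - j%:R * theta n| <= e1 / (2 * M).
    rewrite -mulrBr normrM ger0_norm//; apply: le_trans Hz.
    by rewrite ler_wpM2r// ler_nat.
  have h1 : `|a kst * (cos (j%:R * zeta kst) - cos (j%:R * theta n))| <= `|a kst| * (e1 / (2 * M)).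
    by rewrite normrM ler_wpM2l//; exact: le_trans (cos_lip _ _) jz.
  have h2 : `|b kst * (sin (j%:R * zeta kst) - sin (j%:R * theta n))| <= `|b kst| * (e1 / (2 * M)).
    by rewrite normrM ler_wpM2l//; exact: le_trans (sin_lip _ _) jz.
  have h3 : `|(a kst - ahat n) * cos (j%:R * theta n)| <= e1 / 4.
    by rewrite normrM (le_trans _ Ha)// ler_piMr// cos_max.
  have h4 : `|(b kst - bhat n) * sin (j%:R * theta n)| <= e1 / 4.
    by rewrite normrM (le_trans _ Hb)// ler_piMr// sin_max.
  have h5 : (`|a kst| + `|b kst|) * (e1 / (2 * M)) <= e1 / 2.
    have -> : e1 / 2 = M * (e1 / (2 * M)) by field; rewrite gt_eqF.
    rewrite ler_wpM2r// ?divr_ge0 ?mulr_ge0 ?(ltW e10) ?(ltW M0)//.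
    by rewrite /M lerDl.
  rewrite /d; apply: (le_trans (ler_normD _ _)).
  have := ler_normD (a kst * (cos (j%:R * zeta kst) - cos (j%:R * theta n)))
    (b kst * (sin (j%:R * zeta kst) - sin (j%:R * theta n))).
  have := ler_normD ((a kst - ahat n) * cos (j%:R * theta n))
    ((b kst - bhat n) * sin (j%:R * theta n)).
  lra.
have e1e : e1 ^+ 2 <= e / 4.
  have [h1 h2] : e1 <= 1 /\ e1 <= e / 4 by split; rewrite ge_min lexx ?orbT.
  by have := ltW e10; nra.
by move: Hm Hd; lra.
Qed.

End peak_step.

(** * Ordering by amplitude and the iteration *)

(** A sequence of distinct positive numbers with limit zero can be listed in
    decreasing order, and [kth_largest] is this enumeration. *)
Section ordering.
Variables (R : realType) (r : nat -> R).
Hypothesis r_gt0 : forall k, 0 < r k.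
Hypothesis r_inj : forall k l, k != l -> r k != r l.
Hypothesis r_vanish : forall e, 0 < e -> exists K, forall k, (K <= k)%N -> r k <= e.

Lemma next_largest (s : seq nat) : exists i, i \notin s /\ forall j, j \notin s -> r j <= r i.
Proof.
have [k ks] : exists k, k \notin s.
  exists (\max_(i <- s) i).+1; apply/negP => ks.
  by have := @leq_bigmax_seq _ s xpredT id _ ks isT; rewrite ltnn.
have [K HK] := r_vanish (r_gt0 k).
pose m := maxn K k.+1.
have km : (k < m)%N by rewrite leq_max leqnn orbT.
have [i /= is_ imax] := @arg_maxP _ R 'I_m (Ordinal km) (fun i => val i \notin s) (fun i => r (val i)) ks.
exists (val i); split => // j js.
have [jm|jm] := ltnP j m; first exact: (imax (Ordinal jm)).
have kj : r j <= r k by apply: HK; rewrite (leq_trans _ jm)// leq_maxl.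
by apply: le_trans kj _; exact: (imax (Ordinal km)).
Qed.

Let nxt s : nat := projT1 (cid (next_largest s)).
Let nxtP s : nxt s \notin s /\ forall j, j \notin s -> r j <= r (nxt s).
Proof. exact: projT2 (cid (next_largest s)). Qed.
Let tops := fix tops k := if k is k'.+1 then rcons (tops k') (nxt (tops k')) else [::].

Let tops_uniq k : uniq (tops k).
Proof. by elim: k => //= k IH; rewrite rcons_uniq IH (nxtP _).1. Qed.

Let size_tops k : size (tops k) = k.
Proof. by elim: k => //= k IH; rewrite size_rcons IH. Qed.

Let above_nxt k : [set j | r (nxt (tops k)) < r j] = [set` tops k].
Proof.
apply/seteqP; split => j /=.
  by move=> rj; apply/negPn/negP => jn; move: rj; rewrite ltNge (nxtP _).2.
elim: k => //= k IH; rewrite mem_rcons inE.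
have ni := (nxtP (tops k.+1)).1.
have le_next : r (nxt (tops k.+1)) < r (nxt (tops k)).
  rewrite lt_neqAle (nxtP (tops k)).2 ?andbT.
    by apply: r_inj; apply: contraNneq ni => ->; rewrite /= mem_rcons inE eqxx.
  by apply: contra ni => h; rewrite /= mem_rcons inE h orbT.
by case/orP => [/eqP -> //|/IH]; exact: lt_trans.
Qed.

Lemma card_uniq_seq (s : seq nat) : uniq s -> ([set` s] #= `I_(size s))%card.
Proof.
move=> us; have -> : [set` s] = nth 0%N s @` `I_(size s).
  apply/seteqP; split => [j /= js|_ /= [i /= si <-]]; last exact: mem_nth.
  by exists (index j s); rewrite /= ?index_mem ?nth_index.
by apply: inj_card_eq => i j; rewrite !inE /= => si sj /eqP; rewrite nth_uniq// => /eqP.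
Qed.

Let kth_largest_nxt k : kth_largest r k = nxt (tops k).
Proof.
have ck l : ([set j | (r (nxt (tops l)) < r j)%R] #= `I_l)%card.
  by rewrite above_nxt -[X in `I_X](size_tops l); exact: card_uniq_seq.
apply: xget_subset1; first exact: ck.
have below i l : r i < r (nxt (tops l)) -> ~ ([set j | (r i < r j)%R] #= `I_l)%card.
  move=> il /card_eqPle[h _]; have : (`I_l.+1 #<= `I_l)%card.
    apply: card_le_trans h; have /card_eqPle[_ h] := ck l.+1.
    apply: card_le_trans h _; rewrite above_nxt; apply: subset_card_le => j /=.
    rewrite mem_rcons inE => /orP[/eqP ->//|jl].
    apply: lt_trans il _; have : [set` tops l] j by [].
    by rewrite -above_nxt.
  by rewrite card_le_II ltnn.
have above i l : r (nxt (tops l)) < r i -> ~ ([set j | (r i < r j)%R] #= `I_l)%card.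
  move=> li /card_eqPle[_ h].
  have il : i \in tops l by have : [set` tops l] i by rewrite -above_nxt.
  have : (`I_l #<= `I_(size (rem i (tops l))))%card.
    apply: card_le_trans h _; have /card_eqPle[h _] := card_uniq_seq (rem_uniq i (tops_uniq l)).
    apply: card_le_trans h; apply: subset_card_le => j /= ij.
    rewrite mem_rem_uniq// inE; apply/andP; split.
      by apply: contraTneq ij => ->; rewrite ltxx.
    by have : [set` tops l] j by rewrite -above_nxt; exact: lt_trans ij.
  rewrite card_le_II size_rem// size_tops; case: l il {li h} => //= l _.
  by rewrite ltnn.
have uniq i l : ([set j | (r i < r j)%R] #= `I_l)%card -> i = nxt (tops l).
  by move=> ci; apply/eqP/negPn/negP => /r_inj; rewrite neq_lt => /orP[/below|/above].
by move=> i j /uniq -> /uniq ->.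
Qed.

Lemma kth_largestP k j : j \notin [seq kth_largest r i | i <- iota 0 k] ->
  j != kth_largest r k -> r j < r (kth_largest r k).
Proof.
have -> : [seq kth_largest r i | i <- iota 0 k] = tops k.
  elim: k => // k IH.
  by rewrite -[X in iota 0 X]addn1 iotaD map_cat IH /= add0n cats1 kth_largest_nxt.
rewrite kth_largest_nxt => jk jne.
by rewrite lt_neqAle r_inj// (nxtP _).2.
Qed.

Lemma kth_largest_notin k : kth_largest r k \notin [seq kth_largest r i | i <- iota 0 k].
Proof.
have -> : [seq kth_largest r i | i <- iota 0 k] = tops k.
  elim: k => // k IH.
  by rewrite -[X in iota 0 X]addn1 iotaD map_cat IH /= add0n cats1 kth_largest_nxt.
by rewrite kth_largest_nxt (nxtP _).1.
Qed.

(** Only finitely many terms exceed half of the [k]-th largest. *)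
Lemma kth_largest_gap k : exists2 g, 0 < g & forall j,
  j \notin [seq kth_largest r i | i <- iota 0 k] -> j != kth_largest r k ->
  r j <= r (kth_largest r k) - g.
Proof.
set ks := kth_largest r k.
have [K HK] := r_vanish (divr_gt0 (r_gt0 ks) (ltr0n R 2)).
pose F (i : 'I_K) := if r i < r ks then r ks - r i else 1.
have [i|mu mu0 Fmu] := finite_lower_bound (F := F).
  by rewrite /F; case: ifP => // ?; rewrite subr_gt0.
exists (Num.min mu (r ks / 2)); first by rewrite lt_min mu0 divr_gt0.
move=> j jI jne; have jlt := kth_largestP jI jne.
have [jK|Kj] := ltnP j K.
  have := Fmu (Ordinal jK); rewrite /F /= jlt => H.
  have : Num.min mu (r ks / 2) <= mu by rewrite ge_min lexx.
  lra.
have : Num.min mu (r ks / 2) <= r ks / 2 by rewrite ge_min lexx orbT.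
have := HK j Kj; lra.
Qed.

End ordering.

Section iteration.
Variables (R : realType) (a b zeta : nat -> R) (x : nat -> R).
Hypothesis sin_zeta : forall k, sin (zeta k) != 0.
Hypothesis cos_zeta : forall k l, k != l -> cos (zeta k) != cos (zeta l).
Hypothesis approx : approximated a b zeta pred0 (fun=> x).

(** Amplitudes can be read off from the sample: half of the [k]-th amplitude is
    the limit of the transforms at the [k]-th frequency, whereas the sample
    without the first [K] tones has a small mean square. *)
Lemma amp_vanish (e : R) : 0 < e -> exists K, forall k, (K <= k)%N -> amp a b k <= e.
Proof.
move=> e0; have e20 : 0 < (e / 8) ^+ 2 by rewrite exprn_gt0// divr_gt0.
have [K _ [n0 H0]] := approx 0 e20; exists K => k Kk.
pose y := fun j => x j - \sum_(l < K) tone a b zeta l j.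
have kI : ~~ (k < K)%N by rewrite -leqNgt.
have appr : approximated a b zeta (fun l => (l < K)%N) (fun=> y).
  move=> eps K1 eps0; have [K' K'1 [n1 H1]] := approx (maxn K1 K) eps0.
  move: K'1; rewrite geq_max => /andP[K1K' KK'].
  exists K' => //; exists n1 => n /H1.
  rewrite (_ : (fun j => y j - _) = (fun j => x j - \sum_(l < K' | ~~ pred0 l) tone a b zeta l j))//.
  apply/funext => j; rewrite /y [in RHS](bigID (fun l : 'I_K' => (l < K)%N)) /= opprD addrA.
  by rewrite (big_ord_widen _ (fun l => tone a b zeta l j) KK').
have e80 : 0 < e / 8 by rewrite divr_gt0.
have [n1 H1] := @fourier_at_tone R a b zeta sin_zeta cos_zeta (fun l => (l < K)%N) k (fun=> y) kI appr _ e80.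
pose n := maxn 1 (maxn n0 n1).
have n_gt0 : (0 < n)%N by rewrite leq_max.
have n0n : (n0 <= n)%N by rewrite !leq_max leqnn !orbT.
have n1n : (n1 <= n)%N by rewrite !leq_max leqnn !orbT.
have Fy : normc (fourier n y (zeta k)) <= e / 8.
  rewrite -(ler_pXn2r (_ : 0 < 2)%N) ?nnegrE ?normc_ge0 ?(ltW e80)//.
  by apply: le_trans (H0 n n0n); exact: fourier_le_mean_square.
have := H1 n n1n => Hc.
have := le_normcD (fourier n y (zeta k)) (- (fourier n y (zeta k) - coef a b (k, false))).
rewrite (_ : _ + - _ = coef a b (k, false)); last by ring.
rewrite normcN normc_coef; lra.
Qed.

Hypothesis amp_gt0 : forall k, 0 < amp a b k.
Hypothesis amp_inj : forall k l, k != l -> amp a b k != amp a b l.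
Let ks := kth_largest (amp a b).
Let used k := fun j => j \in [seq ks i | i <- iota 0 k].
Variables (delta : R) (N : nat) (Zhat : nat -> nat -> R).
Let res k n := residual delta n x (fun i => Zhat i n) k.
Let theta k n := delta * Zhat k n.
Hypothesis peak : forall k n, (k < N)%N -> (0 < n)%N ->
  periodogram n (res k n) (zeta (ks k)) <= periodogram n (res k n) (theta k n).
Hypothesis band : forall k, (k < N)%N -> exists n0, forall n, (n0 <= n)%N ->
  Num.floor (theta k n / pi) = Num.floor (zeta (ks k) / pi).

Let gapP k : exists2 g, 0 < g & forall j, ~~ used k j -> j != ks k -> amp a b j <= amp a b (ks k) - g.
Proof. exact (kth_largest_gap amp_gt0 amp_inj amp_vanish k). Qed.

Let ks_notin k : ~~ used k (ks k).
Proof. exact: kth_largest_notin amp_gt0 amp_inj amp_vanish k. Qed.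

(** Each step removes the next largest tone, so that step [k] deals with a sample
    of the tones outside [used k]. *)
Lemma residuals_approximated k : (k <= N)%N -> approximated a b zeta (used k) (res k).
Proof.
elim: k => [_|k IH kN] //.
have [g g0 gap] := gapP k.
have := residual_approximated sin_zeta cos_zeta (ks_notin k) (IH (ltnW kN)) (amp_gt0 _) g0 gap
  (fun n => @peak k n kN) (band kN).
move=> H e K1 e0; have [K K1K [n0 Hn]] := H e K1 e0; exists K => //; exists n0 => n /Hn.
congr (mean_square n _ <= e); apply/funext => j.
congr (_ - _).
  by rewrite /res /= cos_regressionE sin_regressionE -/(theta k n) !mulrA.
apply: eq_bigl => l; congr (~~ _); rewrite /used.
have -> : iota 0 k.+1 = iota 0 k ++ [:: k] by rewrite -addn1 iotaD.
by rewrite map_cat mem_cat /= inE orbC.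
Qed.

Lemma iteration_cvg k : (k < N)%N -> forall e, 0 < e -> exists n0, forall n, (n0 <= n)%N ->
  [/\ n%:R * `|zeta (ks k) - theta k n| <= e,
   `|a (ks k) - cos_regression delta n (res k n) (Zhat k n)| <= e &
   `|b (ks k) - sin_regression delta n (res k n) (Zhat k n)| <= e].
Proof.
move=> kN e e0; have [g g0 gap] := gapP k.
have appr := residuals_approximated (ltnW kN).
have [n1 H1] := peak_cvg sin_zeta cos_zeta (ks_notin k) appr (amp_gt0 _) g0 gap
  (fun n => @peak k n kN) (band kN) e0.
have [n2 H2] := regression_cvg sin_zeta cos_zeta (ks_notin k) appr (amp_gt0 _) g0 gap
  (fun n => @peak k n kN) (band kN) e0.
exists (maxn n1 n2) => n; rewrite geq_max => /andP[n1n n2n].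
by rewrite cos_regressionE sin_regressionE -/(theta k n); have [] := H2 n n2n; split => //; exact: H1.
Qed.

End iteration.

(** The periodogram only sees a nonnegative frequency: the tone of frequency
    [Z] and coefficients [a], [b] is the tone of frequency [|Z|] and coefficients
    [a], [sg Z * b]. *)
Lemma periodogram_iteration_consistent (R : realType) (a b Z x : nat -> R) (delta : R)
  (N : nat) (Zhat : nat -> nat -> R)
  (ks := kth_largest (fun k => Num.sqrt (a k ^+ 2 + b k ^+ 2)))
  (res := fun k n => residual delta n x (fun i => Zhat i n) k) :
  0 < delta ->
  (forall k, sin (delta * Z k) != 0) ->
  (forall k l, k != l -> cos (delta * Z k) != cos (delta * Z l)) ->
  (forall k, 0 < amp a b k) -> (forall k l, k != l -> amp a b k != amp a b l) ->
  approximated a b (fun k => delta * Z k) pred0 (fun=> x) ->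
  (forall k n, (k < N)%N -> (0 < n)%N -> is_largest_peak delta n (res k n) (Zhat k n)) ->
  (forall k, (k < N)%N -> \forall n \near \oo, same_Nyquist_band delta (Zhat k n) `|Z (ks k)|) ->
  forall k, (k < N)%N ->
  [/\ (n%:R * (`|Z (ks k)| - Zhat k n)) @[n --> \oo] --> (0 : R),
      cos_regression delta n (res k n) (Zhat k n) @[n --> \oo] --> a (ks k) &
      sin_regression delta n (res k n) (Zhat k n) @[n --> \oo]
        --> Num.sg (Z (ks k)) * b (ks k)].
Proof.
move=> d0 sinZ cosZ amp0 ampI appr peak band k kN.
pose zeta i := delta * `|Z i|.
pose b' i := Num.sg (Z i) * b i.
have Z0 i : Z i != 0 by apply: contraNneq (sinZ i) => ->; rewrite mulr0 sin0.
have sg2 i : Num.sg (Z i) ^+ 2 = 1 by rewrite sqr_sg Z0.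
have zetaE i : zeta i = Num.sg (Z i) * (delta * Z i).
  by rewrite /zeta normrEsg mulrCA.
have sin_zeta i : sin (zeta i) != 0.
  by rewrite zetaE sin_sg mulf_neq0// sgr_eq0.
have cosE i : cos (zeta i) = cos (delta * Z i).
  by rewrite zetaE cos_sg.
have cos_zeta i l : i != l -> cos (zeta i) != cos (zeta l) by rewrite !cosE; exact: cosZ.
have ampE i : amp a b' i = amp a b i.
  by rewrite /amp /b' exprMn sg2 mul1r.
have ampfE : amp a b' = (fun k => Num.sqrt (a k ^+ 2 + b k ^+ 2)) by apply/funext => i; exact: ampE.
have toneE : tone a b' zeta = tone a b (fun k => delta * Z k).
  apply/funext => i; apply/funext => j; rewrite /tone /wave /b' zetaE mulrCA sin_sg cos_sg//.
  by rewrite mulrACA -expr2 sg2 mul1r.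
have appr' : approximated a b' zeta pred0 (fun=> x).
  by move=> e K1 /(appr e K1); rewrite toneE.
have ksE : kth_largest (amp a b') = ks by rewrite ampfE.
have cvg_it := @iteration_cvg R a b' zeta x sin_zeta cos_zeta appr' _ _ delta N Zhat.
rewrite ksE in cvg_it.
have {cvg_it} H : forall e, 0 < e -> exists n0, forall n, (n0 <= n)%N ->
  [/\ n%:R * `|zeta (ks k) - delta * Zhat k n| <= e,
   `|a (ks k) - cos_regression delta n (res k n) (Zhat k n)| <= e &
   `|b' (ks k) - sin_regression delta n (res k n) (Zhat k n)| <= e].
  apply: cvg_it => //.
  - by move=> i; rewrite ampE.
  - by move=> i l; rewrite !ampE; exact: ampI.
  - move=> l n lN n0; have [_] := peak l n lN n0; apply.
    by rewrite normr_gt0.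
  - move=> l lN; have [n0 _ Hn] := band l lN; exists n0 => n /Hn.
    by rewrite /same_Nyquist_band /zeta.
split; apply/cvgrPdist_le => e e0.
- have [n0 Hn] := H _ (mulr_gt0 e0 d0); exists n0 => // n /= /Hn[h _ _].
  rewrite sub0r normrN normrM ger0_norm// -(ler_pM2r d0); apply: le_trans h.
  by rewrite /zeta -mulrBr normrM (gtr0_norm d0) mulrCA mulrC mulrA.
- by have [n0 Hn] := H _ e0; exists n0 => // n /= /Hn[_ h _].
- by have [n0 Hn] := H _ e0; exists n0 => // n /= /Hn[_ _ h].
Qed.

(** * Independence of groups of variables *)

Definition mfun_of d d' (T : measurableType d) (S : measurableType d') (f : T -> S)
    (mf : measurable_fun setT f) : {mfun T >-> S} :=
  HB.pack f (@isMeasurableFun.Build _ _ _ _ f mf).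

Section grouping.
Context d (T : measurableType d) (R : realType) (P : probability T R).
Context d' (S : measurableType d') (I : eqType) (X : I -> T -> S).
Hypothesis mX : forall i, measurable_fun setT (X i).
Hypothesis indX : mutually_independent P X.
Implicit Types (J : pred I) (s : seq I).

(** Finite intersections generate the sigma-algebra of a subfamily and are
    stable by intersection, which is what the uniqueness of measures needs. *)
Definition cylinder s (B : I -> set S) : set T := \bigcap_(i in [set` s]) (X i @^-1` B i).

Definition cylinders J : set (set T) := [set A | exists s B,
  [/\ uniq s, {subset s <= J}, forall i, measurable (B i) & A = cylinder s B]].

(** The same set of outcomes with the sigma-algebra of the [X i], [J i]: a
    function on it is measurable when it only depends on these variables, so
    that conditioning on them amounts to integrating over the product with an
    independent variable. *)
Definition generated J : measurableType _ := g_sigma_algebraType (cylinders J).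

Lemma measurable_preimageX i (B : set S) : measurable B -> measurable (X i @^-1` B).
Proof. by move=> mB; rewrite -[X in measurable X]setTI; exact: mX. Qed.

Lemma cylinders_measurable J : cylinders J `<=` measurable.
Proof.
move=> _ [s [B [_ _ mB ->]]]; apply: fin_bigcap_measurable => [|i _].
  exact: finite_seq.
exact: measurable_preimageX.
Qed.

Lemma cylinders_setT J : cylinders J setT.
Proof.
exists [::], (fun=> setT); split => //.
by apply/seteqP; split => // w _ i; rewrite /= in_nil.
Qed.

Lemma setI_closed_cylinders J : setI_closed (cylinders J).
Proof.
move=> _ _ [s [B [us sJ mB ->]]] [s' [B' [us' s'J mB' ->]]].
exists (undup (s ++ s')), (fun i => (if i \in s then B i else setT) `&` (if i \in s' then B' i else setT)).
split; first exact: undup_uniq.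
- by move=> i; rewrite mem_undup mem_cat => /orP[/sJ|/s'J].
- by move=> i; apply: measurableI; case: ifP.
apply/seteqP; split => w.
- by move=> [ws ws'] i /= _; split; case: ifP => // h; [exact: ws|exact: ws'].
- move=> h; split => i /= ii.
    by have /= [] := h i; rewrite /= ?mem_undup ?mem_cat ?ii// ii.
  by have /= [] := h i; rewrite /= ?mem_undup ?mem_cat ?ii ?orbT// ii.
Qed.

Lemma sub_generated J (A : set T) : measurable (A : set (generated J)) -> measurable A.
Proof. by apply: smallest_sub; [exact: sigma_algebra_measurable|exact: cylinders_measurable]. Qed.

Lemma generated_measurableX J i : J i -> measurable_fun setT (X i : generated J -> S).
Proof.
move=> Ji _ B mB; rewrite setTI; apply: sub_sigma_algebra.
exists [:: i], (fun=> B); split => //; first by move=> j; rewrite inE => /eqP ->.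
apply/seteqP; split => [w wB j /=|w /(_ i)]; first by rewrite inE => /eqP ->.
by apply; rewrite /= mem_head.
Qed.

Lemma indep_gen (A : set T) (G : set (set T)) : measurable A ->
  G `<=` measurable -> setI_closed G -> G setT ->
  (forall B, G B -> P (A `&` B) = (P A * P B)%E) ->
  forall B, <<s G >> B -> P (A `&` B) = (P A * P B)%E.
Proof.
move=> mA Gm GI GT GP B sB.
have PA0 : 0 <= fine (P A) by rewrite fine_ge0.
have mscaleE C : mscale (NngNum PA0) P C = (P A * P C)%E.
  by rewrite /mscale /= fineK ?fin_num_measure.
rewrite -mscaleE [LHS](_ : _ = mrestr P mA B); last by rewrite /mrestr setIC.
apply: (g_sigma_algebra_measure_unique G _ (fun=> setT)) => //.
- by rewrite bigcup_const//; exists 0%N.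
- by move=> C GC; apply: etrans (esym (mscaleE C)); rewrite -GP// setIC.
- by move=> _; rewrite /= /mrestr setTI ltey_eq fin_num_measure.
Qed.

(** By the uniqueness of measures, applied to each of the two sigma-algebras
    in turn, independence extends from cylinders. *)
Lemma grouping J J' (A B : set T) : (forall i, J i -> J' i -> False) ->
  measurable (A : set (generated J)) -> measurable (B : set (generated J')) ->
  P (A `&` B) = (P A * P B)%E.
Proof.
move=> disj mA mB.
apply: (indep_gen (G := cylinders J')) => //; first exact: sub_generated mA.
- exact: cylinders_measurable.
- exact: setI_closed_cylinders.
- exact: cylinders_setT.
move=> C cC; rewrite setIC muleC.
apply: (indep_gen (G := cylinders J)) => //; first exact: cylinders_measurable cC.
- exact: cylinders_measurable.
- exact: setI_closed_cylinders.
- exact: cylinders_setT.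
move=> {A mA B mB} A [s [B [us sJ mB ->]]].
case: cC => s' [B' [us' s'J mB' ->]].
pose B'' i := if i \in s then B i else B' i.
have us'' : uniq (s ++ s').
  rewrite cat_uniq us us' andbT /=; apply/hasPn => i /s'J J'i; apply/negP => /sJ Ji.
  exact: disj Ji J'i.
have mB'' i : measurable (B'' i) by rewrite /B''; case: ifP.
have -> : cylinder s' B' `&` cylinder s B = cylinder (s ++ s') B''.
  apply/seteqP; split => w.
    move=> [ws' ws] i /=; rewrite mem_cat /B''; case: ifP => [is_ _|_ /= is']; [exact: ws|exact: ws'].
  move=> h; split => i /= ii.
    have := h i; rewrite /= mem_cat ii orbT /B'' => /(_ isT); case: ifP => // is_.
    by exfalso; apply: (disj i); [exact: sJ|exact: s'J].
  by have := h i; rewrite /= mem_cat ii /= /B'' ii; exact.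
have E s0 B0 : uniq s0 -> (forall i, measurable (B0 i)) -> P (cylinder s0 B0) = (\prod_(i <- s0) P (X i @^-1` B0 i))%E.
  by move=> us0 mB0; exact: indX.
rewrite !E// big_cat /= muleC; congr (_ * _)%E.
- rewrite !big_seq; apply: eq_bigr => i is'; rewrite /B''; case: ifP => // is_.
  by exfalso; apply: (disj i); [exact: sJ|exact: s'J].
- by rewrite !big_seq; apply: eq_bigr => i is_; rewrite /B'' is_.
Qed.

End grouping.

Section tonelli.
Context d (T : measurableType d) (R : realType) (P : probability T R).
Context d1 d2 (S1 : measurableType d1) (S2 : measurableType d2).
Variables (X : {mfun T >-> S1}) (Y : {mfun T >-> S2}).
Hypothesis indXY : forall A B, measurable A -> measurable B ->
  P (X @^-1` A `&` Y @^-1` B) = (P (X @^-1` A) * P (Y @^-1` B))%E.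

Lemma tonelli_indep (H : S1 * S2 -> \bar R) : measurable_fun [set: S1 * S2] H -> (forall z, (0 <= H z)%E) ->
  (\int[P]_w H (X w, Y w) = \int[P]_w \int[distribution P Y]_y H (X w, y))%E.
Proof.
move=> mH H0.
have mXY : measurable_fun setT (fun w => (X w, Y w)) by exact/measurable_fun_pair.
pose XY := mfun_of mXY.
rewrite -[LHS](@ge0_integral_distribution _ _ _ _ _ P XY H)//.
rewrite (@eq_measure_integral _ _ _ _ (distribution P X \x distribution P Y)%E); last first.
  move=> C mC _; apply/esym/product_measure_unique => // A B mA mB; exact: indXY.
rewrite fubini_tonelli1//.
rewrite (@ge0_integral_distribution _ _ _ _ _ P X (fun x => \int[distribution P Y]_y H (x, y))%E)//.
  exact: measurable_fun_fubini_tonelli_F.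
by move=> y; apply: integral_ge0.
Qed.

End tonelli.

(** * Rotation invariance of Gaussian pairs *)

Section density.
Context d (T : measurableType d) (R : realType).
Variables (mu nu : {measure set T -> \bar R}) (g : T -> R).
Hypothesis mg : measurable_fun setT g.
Hypothesis g0 : forall x, 0 <= g x.
Hypothesis nuE : forall A, measurable A -> nu A = (\int[mu]_(x in A) (g x)%:E)%E.

Import HBNNSimple.

Let mgE : measurable_fun setT (EFin \o g).
Proof. exact/measurable_EFinP. Qed.

Let density_indic (A : set T) : measurable A ->
  (\int[nu]_x (\1_A x)%:E = \int[mu]_x ((\1_A x)%:E * (g x)%:E))%E.
Proof.
move=> mA; rewrite integral_indic// setIT nuE// integral_mkcond.
apply: eq_integral => x _; rewrite patchE indicE; case: ifPn => xA.
  by rewrite mul1e.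
by rewrite mul0e.
Qed.

Let density_nnsfun (f : {nnsfun T >-> R}) :
  (\int[nu]_x (f x)%:E = \int[mu]_x ((f x)%:E * (g x)%:E))%E.
Proof.
under [LHS]eq_integral do rewrite fimfunE -fsumEFin//.
rewrite [LHS]ge0_integral_fsum//; last 2 first.
  - by move=> r; exact/measurable_EFinP/measurableT_comp.
  - by move=> n x _; rewrite EFinM nnfun_muleindic_ge0.
under [RHS]eq_integral.
  move=> x xD; rewrite fimfunE -fsumEFin// muleC ge0_mule_fsumr; last first.
    by move=> r; rewrite EFinM nnfun_muleindic_ge0.
  over.
rewrite [RHS]ge0_integral_fsum//; last 2 first.
  - move=> r; apply: emeasurable_funM => //.
    by apply/measurable_EFinP; apply: measurable_funM.
  - by move=> n x _; apply: mule_ge0; [rewrite lee_fin|rewrite EFinM nnfun_muleindic_ge0].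
apply: eq_fsbigr => r; rewrite inE => -[x _ fxr].
have r0 : 0 <= r by rewrite -fxr.
have mfr : measurable (f @^-1` [set r]) by [].
under eq_integral do rewrite EFinM.
rewrite ge0_integralZl//; last exact/measurable_EFinP/measurable_indic.
rewrite density_indic// -ge0_integralZl//.
- by apply: eq_integral => y _; rewrite muleA muleC -EFinM.
- by apply: emeasurable_funM => //; exact/measurable_EFinP/measurable_indic.
- by move=> y _; rewrite mule_ge0// lee_fin.
Qed.

(** The change of density is proved on indicators, then on simple functions, and
    then by monotone convergence. *)
Lemma ge0_integral_density (f : T -> \bar R) : measurable_fun setT f ->
  (forall x, 0 <= f x)%E -> (\int[nu]_x f x = \int[mu]_x (f x * (g x)%:E))%E.
Proof.
move=> mf f0; pose f_ := nnsfun_approx measurableT mf.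
transitivity (limn (fun n => \int[nu]_x (f_ n x)%:E)%E).
  rewrite -monotone_convergence//=.
  - by apply: eq_integral => ? _; apply/esym/cvg_lim => //=; exact: cvg_nnsfun_approx.
  - by move=> n; exact/measurable_EFinP.
  - by move=> n ? _; rewrite lee_fin.
  - by move=> ? _ ? ? mn; rewrite lee_fin; exact/lefP/nd_nnsfun_approx.
under eq_fun do rewrite density_nnsfun.
rewrite -monotone_convergence//=.
- apply: eq_integral => x _; apply/cvg_lim => //=.
  by apply: cvgeZr => //; exact: cvg_nnsfun_approx.
- by move=> n; apply: emeasurable_funM => //; exact/measurable_EFinP.
- by move=> n x _; rewrite mule_ge0// lee_fin.
- move=> x _ m n mn; rewrite lee_wpmul2r ?lee_fin//.
  exact/lefP/nd_nnsfun_approx.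
Qed.

End density.

Section lebesgue_shears.
Variable R : realType.
Local Notation mu := (@lebesgue_measure R).

Lemma lebesgue_measure_translation (t : R) (A : set R) : measurable A ->
  pushforward mu (fun x : R => x + t : measurableTypeR R) A = mu A.
Proof.
move=> mA.
have mt : measurable_fun [set: measurableTypeR R] (fun x : measurableTypeR R => x + t : measurableTypeR R).
  exact: measurable_funD.
apply/esym/lebesgue_measure_unique => //= _ [[a b]] _ <-.
rewrite /pushforward (_ : _ @^-1` _ = `]a - t, b - t]%classic); last first.
  by apply/seteqP; split => x; rewrite /= !in_itv /= ltrBlDr lerBrDr.
by rewrite !lebesgue_measure_itv/= !lte_fin ltrD2r -!EFinD opprB addrA subrK.
Qed.

Lemma ge0_integral_translation (t : R) (f : R -> \bar R) :
  measurable_fun setT f -> (forall x, 0 <= f x)%E ->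
  (\int[mu]_x f (x + t)%R = \int[mu]_x f x)%E.
Proof.
move=> mf f0.
pose phi : measurableTypeR R -> measurableTypeR R := fun x => x + t.
have mphi : measurable_fun setT phi by exact: measurable_funD.
transitivity (\int[pushforward mu phi]_x f x)%E; last first.
  by apply: eq_measure_integral => //= A mA _; exact: lebesgue_measure_translation.
by rewrite ge0_integral_pushforward.
Qed.

Let plane (H : R * R -> \bar R) := (\int[mu]_x \int[mu]_y H (x, y))%E.

(** A shear translates every line parallel to an axis. *)
Lemma plane_shear2 (t : R) (H : R * R -> \bar R) :
  measurable_fun setT H -> (forall z, 0 <= H z)%E ->
  plane (fun z => H (z.1, z.2 + t * z.1)) = plane H.
Proof.
move=> mH H0; apply: eq_integral => x _ /=.
apply: (ge0_integral_translation (t * x) (f := fun y => H (x, y))) => //.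
exact: measurableT_comp.
Qed.

Lemma plane_shear1 (t : R) (H : R * R -> \bar R) :
  measurable_fun setT H -> (forall z, 0 <= H z)%E ->
  plane (fun z => H (z.1 + t * z.2, z.2)) = plane H.
Proof.
move=> mH H0; rewrite /plane.
have mHs : measurable_fun setT (fun z : R * R => H (z.1 + t * z.2, z.2)).
  apply: measurableT_comp => //; apply/measurable_fun_pair => //=.
  by apply: measurable_funD => //; exact: measurable_funM.
apply: etrans (@fubini_tonelli _ _ _ _ R mu mu _ mHs (fun z => H0 _)) _.
apply: etrans (esym (@fubini_tonelli _ _ _ _ R mu mu _ mH H0)).
apply: eq_integral => y _ /=.
apply: (ge0_integral_translation (t * y) (f := fun x => H (x, y))) => //.
exact: measurableT_comp.
Qed.

Definition rotation (c s : R) (z : R * R) : R * R := (c * z.1 + s * z.2, - s * z.1 + c * z.2).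

Lemma measurable_rotation c s : measurable_fun setT (rotation c s).
Proof.
by apply/measurable_fun_pair => /=; apply: measurable_funD; exact: measurable_funM.
Qed.

(** A rotation other than the half-turn is a product of three shears; [t] is
    the tangent of half of the angle. *)
Lemma plane_rot_shears (c s : R) (H : R * R -> \bar R) : c ^+ 2 + s ^+ 2 = 1 -> c != -1 ->
  measurable_fun setT H -> (forall z, 0 <= H z)%E ->
  plane (H \o rotation c s) = plane H.
Proof.
move=> cs c1 mH H0; pose t := s / (1 + c).
have c1' : 1 + c != 0 by rewrite addrC addr_eq0.
have t1 : 1 - t * s = c.
  rewrite /t mulrAC (_ : s * s = (1 - c) * (1 + c)) ?mulfK//; last lra.
  by rewrite subKr.
have t2 : t * (1 + c) = s by rewrite /t divfK.
pose S1 z : R * R := (z.1 + t * z.2, z.2).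
pose S2 z : R * R := (z.1, z.2 + (- s) * z.1).
have mS1 : measurable_fun setT S1.
  by apply/measurable_fun_pair => //=; apply: measurable_funD => //; exact: measurable_funM.
have mS2 : measurable_fun setT S2.
  by apply/measurable_fun_pair => //=; apply: measurable_funD => //; exact: measurable_funM.
have -> : H \o rotation c s = (H \o S1) \o S2 \o S1.
  apply/funext => -[x y] /=; congr (H (_, _)); rewrite /S1 /S2 /rotation /=.
    have -> : x + t * y + t * (y + - s * (x + t * y)) = (1 - t * s) * x + t * (1 + (1 - t * s)) * y by ring.
    by rewrite t1 t2.
  have -> : y + - s * (x + t * y) = - s * x + (1 - t * s) * y by ring.
  by rewrite t1.
have mH1 : measurable_fun setT (H \o S1) by exact: measurableT_comp mH mS1.
have mH2 : measurable_fun setT ((H \o S1) \o S2) by exact: measurableT_comp mH1 mS2.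
apply: etrans (plane_shear1 t mH2 (fun z => H0 _)) _.
apply: etrans (plane_shear2 (- s) mH1 (fun z => H0 _)) _.
exact: plane_shear1.
Qed.

(** The half-turn is the square of a quarter-turn. *)
Lemma plane_rot (c s : R) (H : R * R -> \bar R) : c ^+ 2 + s ^+ 2 = 1 ->
  measurable_fun setT H -> (forall z, 0 <= H z)%E ->
  plane (H \o rotation c s) = plane H.
Proof.
move=> cs mH H0; have [c1|] := eqVneq c (-1); last by move=> c1; exact: plane_rot_shears.
have s0 : s = 0 by apply/eqP; rewrite -sqrf_eq0; apply/eqP; rewrite c1 in cs; lra.
have -> : H \o rotation c s = (H \o rotation 0 1) \o rotation 0 1.
  by apply/funext => -[x y] /=; congr (H (_, _)); rewrite /= c1 s0; ring.
have c01 : (0 : R) ^+ 2 + 1 ^+ 2 = 1 by rewrite expr0n expr1n add0r.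
have n01 : 0 != -1 :> R by rewrite eq_sym oppr_eq0 oner_eq0.
have mH1 : measurable_fun setT (H \o rotation 0 1) by exact: measurableT_comp mH (measurable_rotation 0 1).
apply: etrans (plane_rot_shears c01 n01 mH1 (fun z => H0 _)) _.
exact: plane_rot_shears.
Qed.

Local Notation N01 := (@normal_prob R 0 1).

Lemma gauss_integral (f : R -> \bar R) : measurable_fun setT f -> (forall x, 0 <= f x)%E ->
  (\int[N01]_x f x = \int[mu]_x (f x * (normal_pdf 0 1 x)%:E))%E.
Proof.
move=> mf f0; apply: ge0_integral_density => //.
- exact: measurable_normal_pdf.
- by move=> x; exact: normal_pdf_ge0.
Qed.

(** The density of the pair only depends on its distance to the origin. *)
Lemma gauss_rot (c s : R) (H : R * R -> \bar R) : c ^+ 2 + s ^+ 2 = 1 ->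
  measurable_fun setT H -> (forall z, 0 <= H z)%E ->
  (\int[N01]_x \int[N01]_y H (rotation c s (x, y)) = \int[N01]_x \int[N01]_y H (x, y))%E.
Proof.
move=> cs mH H0.
pose phi := @normal_pdf R 0 1.
have phi0 x : 0 <= phi x by exact: normal_pdf_ge0.
have mphi : measurable_fun setT phi by exact: measurable_normal_pdf.
pose G z := (H z * (phi z.2)%:E * (phi z.1)%:E)%E.
have toplane (K : R * R -> \bar R) : measurable_fun setT K -> (forall z, 0 <= K z)%E ->
  (\int[N01]_x \int[N01]_y K (x, y) = plane (fun z => K z * (phi z.2)%:E * (phi z.1)%:E))%E.
  move=> mK K0.
  have mKx x : measurable_fun setT (fun y => K (x, y)) by exact: measurableT_comp.
  rewrite gauss_integral//; last first.
  - by move=> x; exact: integral_ge0.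
  - exact: (measurable_fun_fubini_tonelli_F (m2 := N01)).
  apply: eq_integral => x _; rewrite gauss_integral// -ge0_integralZr//.
  - by apply: emeasurable_funM; [exact: mKx|exact/measurable_EFinP].
  - by move=> y _; rewrite mule_ge0// lee_fin.
  - by rewrite lee_fin.
have mG : measurable_fun setT G.
  by apply: emeasurable_funM; [apply: emeasurable_funM => //|]; apply/measurable_EFinP; exact: measurableT_comp.
have mHr : measurable_fun setT (H \o rotation c s) by apply: measurableT_comp => //; exact: measurable_rotation.
apply: etrans (toplane (H \o rotation c s) mHr (fun z => H0 _)) _.
apply: etrans (esym (toplane H mH H0)).
have G0 z : (0 <= G z)%E by rewrite !mule_ge0// lee_fin.
apply: etrans (plane_rot cs mG G0).
congr plane; apply/funext => -[x y]; rewrite /G /= -!muleA; congr (_ * _)%E.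
rewrite -!EFinM; congr EFin.
rewrite /phi /normal_pdf oner_eq0 /normal_fun !subr0 expr1n.
rewrite mulrACA [RHS]mulrACA -!expRD; congr (_ * expR _).
have -> : (- s * x + c * y) ^+ 2 = (s ^+ 2) * x ^+ 2 + c ^+ 2 * y ^+ 2 - 2 * s * c * x * y by ring.
have -> : (c * x + s * y) ^+ 2 = (c ^+ 2) * x ^+ 2 + s ^+ 2 * y ^+ 2 + 2 * s * c * x * y by ring.
have -> : s ^+ 2 = 1 - c ^+ 2 by lra.
by field.
Qed.

End lebesgue_shears.

(** * Moments of the Gaussian law *)

Section gauss_moments.
Variable R : realType.
Local Notation mu := (@lebesgue_measure R).
Local Notation N01 := (@normal_prob R 0 1).

Lemma gauss_opp (h : R -> \bar R) : measurable_fun setT h -> (forall y, 0 <= h y)%E ->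
  (\int[N01]_y h (- y)%R = \int[N01]_y h y)%E.
Proof.
move=> mh h0; have c1 : (-1 : R) ^+ 2 + 0 ^+ 2 = 1 by rewrite expr0n sqrrN expr1n addr0.
have mH : measurable_fun setT (fun z : R * R => h z.2) by exact: measurableT_comp.
have cstE (c : \bar R) : (\int[N01]_x c = c)%E.
  by rewrite integral_cst//= probability_setT mule1.
rewrite -[LHS]cstE -[RHS]cstE.
apply: etrans (gauss_rot c1 mH (fun z => h0 _)).
apply: eq_integral => x _; apply: eq_integral => y _ /=.
by rewrite oppr0 mul0r add0r mulN1r.
Qed.

Definition gauss_moment2 : \bar R := \int[N01]_y (y ^+ 2)%:E.

Lemma gauss_moment2_ge0 : (0 <= gauss_moment2)%E.
Proof. by apply: integral_ge0 => y _; rewrite lee_fin sqr_ge0. Qed.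

(** The square is absorbed by half of the exponent: the integrand is bounded by
    a multiple of the density of variance 2. *)
Lemma gauss_moment2_fin : gauss_moment2 \is a fin_num.
Proof.
rewrite ge0_fin_numE ?gauss_moment2_ge0// /gauss_moment2.
have m2 : measurable_fun setT (fun y : R => (y ^+ 2)%:E) by exact/measurable_EFinP/measurable_funX.
rewrite gauss_integral//; last by move=> y; rewrite lee_fin sqr_ge0.
have s2 : Num.sqrt 2 != 0 :> R by rewrite gt_eqF// sqrtr_gt0.
pose C := 4 * normal_peak 1 / normal_peak (Num.sqrt 2) : R.
have C0 : 0 <= C by rewrite divr_ge0 ?mulr_ge0 ?normal_peak_ge0.
apply: (@le_lt_trans _ _ (\int[mu]_y (C%:E * (normal_pdf 0 (Num.sqrt 2) y)%:E))%E).
  apply: ge0_le_integral => //.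
  - by move=> y _; rewrite mule_ge0// lee_fin ?sqr_ge0// normal_pdf_ge0.
  - apply: emeasurable_funM => //; apply/measurable_EFinP; exact: measurable_normal_pdf.
  - apply: emeasurable_funM => //; apply/measurable_EFinP; exact: measurable_normal_pdf.
  move=> y _; rewrite -!EFinM lee_fin /normal_pdf oner_eq0 (negPf s2).
  have pk : normal_peak (Num.sqrt 2) != 0 :> R by rewrite gt_eqF// normal_peak_gt0.
  have -> (t : R) : C * (normal_peak (Num.sqrt 2) * t) = normal_peak 1 * (4 * t) by rewrite /C; field.
  rewrite mulrCA ler_wpM2l ?normal_peak_ge0// /normal_fun !subr0 expr1n sqr_sqrtr//.
  have -> : - y ^+ 2 / (1 *+ 2) = - (y ^+ 2 / 4) - (y ^+ 2 / 4) by rewrite mulr2n; field.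
  have -> : - y ^+ 2 / (2 *+ 2) = - (y ^+ 2 / 4) by rewrite mulr2n; field.
  rewrite expRD mulrA ler_wpM2r ?expR_ge0//.
  have := expR_ge1Dx (y ^+ 2 / 4) => h1.
  rewrite expRN ler_pdivrMr ?expR_gt0//; lra.
rewrite ge0_integralZl//.
- by rewrite integral_normal_pdf mule1 ltry.
- by apply/measurable_EFinP; exact: measurable_normal_pdf.
- by move=> y _; rewrite lee_fin normal_pdf_ge0.
Qed.

(** By symmetry of the law the cross term has the same integral with either sign;
    adding the integrals for [beta] and [- beta] removes it without any
    integrability condition. *)
Lemma gauss_affine_moment (u beta : R) :
  (\int[N01]_y ((u + beta * y) ^+ 2)%:E = (u ^+ 2)%:E + (beta ^+ 2)%:E * gauss_moment2)%E.
Proof.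
have msq (c : R) : measurable_fun setT (fun y : R => ((u + c * y) ^+ 2)%:E).
  by apply/measurable_EFinP/measurable_funX; apply: measurable_funD => //; exact: measurable_funM.
have sq0 (c y : R) : (0 <= ((u + c * y) ^+ 2)%:E)%E by rewrite lee_fin sqr_ge0.
have sym : (\int[N01]_y ((u + (- beta) * y) ^+ 2)%:E = \int[N01]_y ((u + beta * y) ^+ 2)%:E)%E.
  rewrite -(gauss_opp (msq beta))//; apply: eq_integral => y _.
  by rewrite mulrN mulNr.
have m2 : measurable_fun setT (fun y : R => (y ^+ 2)%:E) by exact/measurable_EFinP/measurable_funX.
have sum2 : (\int[N01]_y ((u + beta * y) ^+ 2)%:E + \int[N01]_y ((u + beta * y) ^+ 2)%:E =
   (2 * u ^+ 2)%:E + (2 * beta ^+ 2)%:E * gauss_moment2)%E.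
  have E := ge0_integralD N01 measurableT (fun y _ => sq0 beta y) (msq beta)
    (fun y _ => sq0 (- beta) y) (msq (- beta)).
  rewrite -{2}sym; apply: etrans (esym E) _.
  have b0 : (0 <= (2 * beta ^+ 2)%:E)%E by rewrite lee_fin mulr_ge0// sqr_ge0.
  under eq_integral => y _.
    rewrite -EFinD (_ : _ + _ = 2 * u ^+ 2 + 2 * beta ^+ 2 * y ^+ 2); last by ring.
    rewrite EFinD (EFinM (2 * beta ^+ 2)); over.
  rewrite ge0_integralD//.
  - by rewrite integral_cst//= probability_setT mule1 ge0_integralZl// => y _; rewrite lee_fin sqr_ge0.
  - by move=> y _; rewrite lee_fin mulr_ge0// sqr_ge0.
  - by move=> y _; rewrite mule_ge0// lee_fin sqr_ge0.
  - exact: emeasurable_funM.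
move: sum2; rewrite -(fineK gauss_moment2_fin) -!EFinM -!EFinD.
case: (\int[N01]_y _)%E => //= r [] E; congr EFin; lra.
Qed.

Lemma gauss_null (A : set R) : countable A -> N01 A = 0%E.
Proof.
move=> cA; have /null_content_dominatesP := @normal_prob_dominates R 0 1; apply.
  by apply: countable_measurable => // t; exact: measurable_set1.
exact: countable_lebesgue_measure0.
Qed.

End gauss_moments.

(** * Conditioning on all the other variables *)

Section steps.
Context d (T : measurableType d) (R : realType) (P : probability T R).
Context (I : eqType) (X : I -> T -> R).
Hypothesis mX : forall i, measurable_fun setT (X i).
Hypothesis indX : mutually_independent P X.
Local Notation N01 := (@normal_prob R 0 1).
Variable J : pred I.
Local Notation TJ := (generated X J).

Lemma measurable_to_generated : measurable_fun setT (idfun : T -> TJ).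
Proof. by move=> _ B mB; rewrite setTI; exact: (sub_generated mX mB). Qed.

Let idJ : {mfun T >-> TJ} := mfun_of measurable_to_generated.

Section one.
Variable i : I.
Hypothesis Ji : ~~ J i.
Let Xi : {mfun T >-> measurableTypeR R} :=
  mfun_of (mX i : measurable_fun setT (X i : T -> measurableTypeR R)).

Lemma indep_one (A : set TJ) (B : set (measurableTypeR R)) : measurable A -> measurable B ->
  P (idJ @^-1` A `&` Xi @^-1` B) = (P (idJ @^-1` A) * P (Xi @^-1` B))%E.
Proof.
move=> mA mB; apply: (grouping mX indX (J := J) (J' := pred1 i)) => //.
  by move=> j Jj /eqP ji; move: Ji; rewrite -ji Jj.
have := @generated_measurableX _ T _ _ I X (pred1 i) i (eqxx i) measurableT B mB.
by rewrite setTI.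
Qed.

Lemma tonelli_one (H : TJ * measurableTypeR R -> \bar R) : measurable_fun setT H -> (forall z, 0 <= H z)%E ->
  (\int[P]_w H (w, X i w) = \int[P]_w \int[distribution P Xi]_y H (w, y))%E.
Proof. exact: (@tonelli_indep _ _ _ P _ _ _ _ idJ Xi indep_one H). Qed.

(** To show that a relation between [X i] and other variables almost surely fails,
    the other variables may be fixed. *)
Lemma null_one (B : set (TJ * measurableTypeR R)) : measurable B ->
  (forall w, P (X i @^-1` [set y | B (w, y)]) = 0)%E ->
  P [set w | B (w, X i w)] = 0%E.
Proof.
move=> mB B0; have mH : measurable_fun setT (fun z => (\1_B z : R)%:E) by exact/measurable_EFinP/measurable_indic.
have H0 z : (0 <= (\1_B z : R)%:E)%E by rewrite lee_fin.
have mBX : measurable [set w | B (w, X i w)].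
  have mXJ : measurable_fun setT (fun w => (idJ w, Xi w)) by exact/measurable_fun_pair.
  by have := mXJ measurableT B mB; rewrite setTI.
have := tonelli_one mH H0.
rewrite (_ : \int[P]_w (\1_B (w, X i w))%:E = P [set w | B (w, X i w)])%E.
  move=> ->; apply: integral0_eq => w _.
  rewrite [LHS](_ : _ = \int[distribution P Xi]_y (\1_[set y | B (w, y)] y : R)%:E)%E//.
  rewrite integral_indic//; first by rewrite setIT; exact: B0.
  by have := measurable_xsection (w : TJ) mB; rewrite xsectionE.
rewrite -[RHS](_ : \int[P]_w (\1_[set w | B (w, X i w)] w : R)%:E = _)%E//.
by rewrite integral_indic// setIT.
Qed.

Hypothesis Xi_gauss : forall A, measurable A -> P (X i @^-1` A) = N01 A.

(** A centred Gaussian variable that is independent of [U] and [beta] contributes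
    to the second moment without a cross term. *)
Lemma moment_one (U beta : TJ -> R) : measurable_fun setT U -> measurable_fun setT beta ->
  (\int[P]_w ((U w + beta w * X i w) ^+ 2)%:E =
   \int[P]_w (U w ^+ 2)%:E + \int[P]_w (beta w ^+ 2)%:E * gauss_moment2 R)%E.
Proof.
move=> mU mb.
pose H (z : TJ * measurableTypeR R) := ((U z.1 + beta z.1 * z.2) ^+ 2)%:E.
have mH : measurable_fun setT H.
  apply/measurable_EFinP/measurable_funX/measurable_funD; first exact: measurableT_comp.
  by apply: measurable_funM => //; exact: measurableT_comp.
have := tonelli_one mH (fun z => _); rewrite /H /= => -> ; last by move=> z; rewrite lee_fin sqr_ge0.
have m2 := gauss_moment2_ge0 R.
have mU' : measurable_fun setT (fun w => U (idJ w)) by exact: measurableT_comp.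
have mb' : measurable_fun setT (fun w => beta (idJ w)) by exact: measurableT_comp.
have mU2 : measurable_fun setT (fun w : T => (U w ^+ 2)%:E) by exact/measurable_EFinP/measurable_funX.
have mb2 : measurable_fun setT (fun w : T => (beta w ^+ 2)%:E) by exact/measurable_EFinP/measurable_funX.
transitivity (\int[P]_w ((U w ^+ 2)%:E + (beta w ^+ 2)%:E * gauss_moment2 R))%E.
  apply: eq_integral => w _; rewrite -gauss_affine_moment.
  by apply: eq_measure_integral => A mA _; exact: Xi_gauss.
rewrite ge0_integralD//.
- by rewrite ge0_integralZr// => w _; rewrite lee_fin sqr_ge0.
- by move=> w _; rewrite lee_fin sqr_ge0.
- by move=> w _; rewrite mule_ge0// lee_fin sqr_ge0.
- exact: emeasurable_funM.
Qed.

End one.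

Section two.
Variables i1 i2 : I.
Hypotheses (Ji1 : ~~ J i1) (Ji2 : ~~ J i2) (i12 : i1 != i2).
Local Notation RR := (measurableTypeR R).
Hypothesis X1_gauss : forall A : set RR, measurable A -> P (X i1 @^-1` A) = N01 A.
Hypothesis X2_gauss : forall A : set RR, measurable A -> P (X i2 @^-1` A) = N01 A.

Let mX12 : measurable_fun setT (fun w => (X i1 w, X i2 w) : RR * RR).
Proof. by apply/measurable_fun_pair; exact: mX. Qed.

Let X12 : {mfun T >-> (RR * RR)%type} := mfun_of mX12.

Let indep_two (A : set TJ) (B : set (RR * RR)) : measurable A -> measurable B ->
  P (idJ @^-1` A `&` X12 @^-1` B) = (P (idJ @^-1` A) * P (X12 @^-1` B))%E.
Proof.
move=> mA mB; apply: (grouping mX indX (J := J) (J' := pred2 i1 i2)) => //.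
  by move=> j Jj /orP[]/eqP ji; [move: Ji1|move: Ji2]; rewrite -ji Jj.
have m12 : measurable_fun setT (fun w : generated X (pred2 i1 i2) => (X i1 w, X i2 w) : RR * RR).
  apply/measurable_fun_pair.
    by apply: (@generated_measurableX _ T _ _ I X (pred2 i1 i2) i1); rewrite /= eqxx.
  by apply: (@generated_measurableX _ T _ _ I X (pred2 i1 i2) i2); rewrite /= eqxx orbT.
by have := m12 measurableT B mB; rewrite setTI.
Qed.

Let law_two (h : RR * RR -> \bar R) : measurable_fun setT h -> (forall z, 0 <= h z)%E ->
  (\int[distribution P X12]_z h z = \int[N01]_x \int[N01]_y h (x, y))%E.
Proof.
move=> mh h0; rewrite -(@fubini_tonelli1 _ _ _ _ _ N01 N01 h)//.
apply: eq_measure_integral => C mC _; apply/esym/product_measure_unique => // A B mA mB.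
have := indX (s := [:: i1; i2]) (B := fun i => if i == i1 then A else B).
rewrite !big_cons big_nil eqxx eq_sym (negPf i12) mule1 X1_gauss// X2_gauss//.
move=> <-; last 2 first.
- by rewrite /= inE i12.
- by move=> i; case: ifP.
congr (P _); apply/seteqP; split => w.
  move=> [/= Aw Bw] i; rewrite /= !inE => /orP[]/eqP ->; first by rewrite eqxx.
  by rewrite eq_sym (negPf i12).
move=> h12; split; first by have := h12 i1; rewrite /= eqxx inE eqxx; exact.
by have := h12 i2; rewrite /= !inE eqxx orbT eq_sym (negPf i12); exact.
Qed.

(** Conditionally on the variables in [J], the pair [(X i1, X i2)] is rotated by
    a fixed angle, which does not change its law. *)
Lemma rotate_pair (B : set (TJ * (RR * RR))) (phi : TJ -> R) : measurable B ->
  measurable_fun setT phi ->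
  P [set w | B (w, rotation (cos (phi w)) (sin (phi w)) (X i1 w, X i2 w))] =
  P [set w | B (w, (X i1 w, X i2 w))].
Proof.
move=> mB mphi.
pose r (z : TJ * (RR * RR)) : TJ * (RR * RR) := (z.1, rotation (cos (phi z.1)) (sin (phi z.1)) z.2).
have mphi1 : measurable_fun setT (fun z : TJ * (RR * RR) => phi z.1) by exact: measurableT_comp.
have mc : measurable_fun setT (fun z : TJ * (RR * RR) => cos (phi z.1)).
  by apply: measurableT_comp => //; exact: continuous_measurable_fun (@continuous_cos R).
have ms : measurable_fun setT (fun z : TJ * (RR * RR) => sin (phi z.1)).
  by apply: measurableT_comp => //; exact: continuous_measurable_fun (@continuous_sin R).
have m21 : measurable_fun setT (fun z : TJ * (RR * RR) => z.2.1 : R).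
  by apply: (measurableT_comp (f := fst)) => //; exact: measurable_snd.
have m22 : measurable_fun setT (fun z : TJ * (RR * RR) => z.2.2 : R).
  by apply: (measurableT_comp (f := snd)) => //; exact: measurable_snd.
have mr : measurable_fun setT r.
  apply/measurable_fun_pair => //=; apply/measurable_fun_pair => /=.
    by apply: measurable_funD; exact: measurable_funM.
  by apply: measurable_funD; apply: measurable_funM => //; exact: measurableT_comp.
have mBr : measurable (r @^-1` B) by rewrite -[X in measurable X]setTI; exact: mr.
have key (C : set (TJ * (RR * RR))) : measurable C ->
    P [set w | C (w, (X i1 w, X i2 w))] =
    (\int[P]_w \int[N01]_x \int[N01]_y (\1_C (w : TJ, (x, y)) : R)%:E)%E.
  move=> mC.
  have mH : measurable_fun setT (fun z => (\1_C z : R)%:E) by exact/measurable_EFinP/measurable_indic.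
  have H0 z : (0 <= (\1_C z : R)%:E)%E by rewrite lee_fin.
  have mCX : measurable [set w | C (w, (X i1 w, X i2 w))].
    have mXJ : measurable_fun setT (fun w => (idJ w, X12 w)) by exact/measurable_fun_pair.
    by have := mXJ measurableT C mC; rewrite setTI.
  have := @tonelli_indep _ _ _ P _ _ _ _ idJ X12 indep_two _ mH H0.
  rewrite (_ : \int[P]_w (\1_C (idJ w, X12 w))%:E = P [set w | C (w, (X i1 w, X i2 w))])%E.
    move=> ->; apply: eq_integral => w _; apply: law_two => //.
    by apply: (measurableT_comp mH).
  rewrite -[RHS](_ : \int[P]_w (\1_[set w | C (w, (X i1 w, X i2 w))] w : R)%:E = _)%E//.
  by rewrite integral_indic// setIT.
transitivity (P [set w | (r @^-1` B) (w, (X i1 w, X i2 w))]); first by [].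
apply: etrans (key _ mBr) _; apply: etrans (esym (key _ mB)).
apply: eq_integral => w _.
have mH : measurable_fun setT (fun z : R * R => (\1_B (w : TJ, z) : R)%:E).
  apply/measurable_EFinP.
  apply: (measurableT_comp (f := \1_B : TJ * (RR * RR) -> R)); first exact: measurable_indic.
  exact: (pair1_measurable (w : TJ)).
have := gauss_rot (cos2Dsin2 (phi w)) mH (fun z => _) => <-; last by move=> z; rewrite lee_fin.
by apply: eq_integral => x _; apply: eq_integral => y _; rewrite !indicE.
Qed.

End two.
End steps.

(** * Linear growth of the arrival times *)

Section p_series.
Variable R : realType.

Lemma p_series_step (q : R) (k : nat) : 0 < q -> (0 < k)%N ->
  q * k.+1%:R `^ (- (1 + q)) <= k%:R `^ (- q) - k.+1%:R `^ (- q).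
Proof.
move=> q0 k0; have kR0 : 0 < k%:R :> R by rewrite ltr0n.
have [|||c] := @MVT_segment R (fun x => x `^ (- q)) (fun x => - q * x `^ (- q - 1)) k%:R k.+1%:R.
- by rewrite ler_nat.
- move=> x; rewrite in_itv /= => /andP[kx _].
  by apply: is_derive1_powR; exact: lt_trans kx.
- apply: derivable_within_continuous => x; rewrite in_itv /= => /andP[kx _].
  by apply: derivable_powR; rewrite in_itv /= andbT (lt_le_trans kR0).
rewrite in_itv /= => /andP[kc ck]; rewrite -[in X in _ = _ * X](natr1 k) addrAC subrr add0r mulr1 => E.
rewrite -opprB E mulNr opprK ler_wpM2l ?(ltW q0)//.
have -> : - q - 1 = - (1 + q) by rewrite opprD addrC.
have c0 : 0 < c by exact: lt_le_trans kc.
by rewrite !powRN lef_pV2 ?posrE ?powR_gt0// ge0_ler_powR// ?nnegrE ?(ltW c0)// addr_ge0// ltW.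
Qed.

(** Comparison with the primitive [- k ^ (- q) / q], by the mean value
    theorem. *)
Lemma p_series_tail (q : R) (K L : nat) : 0 < q -> (0 < K)%N ->
  \sum_(K <= k < L) k.+1%:R `^ (- (1 + q)) <= K%:R `^ (- q) / q.
Proof.
move=> q0 K0; rewrite ler_pdivlMr// mulrC mulr_sumr.
suff H : forall m, \sum_(K <= k < K + m) q * k.+1%:R `^ (- (1 + q)) <= K%:R `^ (- q) - (K + m)%:R `^ (- q).
  have [KL|LK] := leqP K L; last by rewrite big_geq ?powR_ge0// ltnW.
  by have := H (L - K)%N; rewrite subnKC// => /le_trans; apply; rewrite gerBl powR_ge0.
elim=> [|m IH]; first by rewrite addn0 big_geq// subrr.
rewrite addnS big_nat_recr ?leq_addr//=.
have := p_series_step q0 (leq_trans K0 (leq_addr m K)); lra.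
Qed.

Lemma powR_vanish (q e : R) : 0 < q -> 0 < e -> exists K, forall k, (K < k)%N -> k%:R `^ (- q) <= e.
Proof.
move=> q0 e0; exists (Num.bound (e^-1 `^ q^-1)) => k Kk.
have kR0 : 0 < k%:R :> R by rewrite ltr0n; exact: leq_ltn_trans Kk.
have : e^-1 `^ q^-1 <= k%:R.
  apply: ltW; apply: lt_le_trans (archi_boundP (powR_ge0 _ _)) _.
  by rewrite ler_nat ltnW.
move=> le_k; have : (e^-1 `^ q^-1) `^ q <= k%:R `^ q.
  by apply: ge0_ler_powR => //; rewrite ?nnegrE ?powR_ge0 ?(ltW q0).
rewrite -powRrM mulVf ?gt_eqF// powRr1 ?invr_ge0 ?(ltW e0)// powRN => H.
by rewrite -[leRHS]invrK lef_pV2 ?posrE ?invr_gt0 ?powR_gt0.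
Qed.

End p_series.

Section exponential.
Variable R : realType.

(** The density is at most 1. *)
Lemma exponential_prob_small (t : R) : 0 <= t ->
  (exponential_prob 1 [set x : R | (x <= t)%R] <= t%:E)%E.
Proof.
move=> t0; rewrite /exponential_prob.
have m1 : measurable [set x : R | (x <= t)%R] by rewrite -set_itvNyc; exact: measurable_itv.
apply: (@le_trans _ _ (\int[lebesgue_measure]_(x in [set x : R | (x <= t)%R]) (\1_(`[0%R, t]) x : R)%:E)%E).
  apply: ge0_le_integral => //.
  - by move=> x _; rewrite lee_fin exponential_pdf_ge0.
  - by apply: measurable_funTS; apply/measurable_EFinP; exact: measurable_exponential_pdf.
  - by apply: measurable_funTS; apply/measurable_EFinP; exact: measurable_indic.
  move=> x /= xt; rewrite lee_fin indicE.
  have [x0|x0] := ltP x 0; first by rewrite lt0_exponential_pdf.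
  rewrite exponential_pdfE// mem_set ?mulr1n/=; last by rewrite in_itv /= x0.
  by rewrite mul1r -[leRHS]expR0 ler_expR mulN1r oppr_le0.
rewrite integral_indic//.
apply: (@le_trans _ _ (lebesgue_measure `[0%R, t]%classic)).
  by apply: le_measure => //; rewrite ?inE//; exact: measurableI.
by rewrite lebesgue_measure_itv /= lte_fin; case: ifP => //; rewrite ?oppr0 ?adde0 ?lee_fin.
Qed.

End exponential.

Lemma measure_bigsetU_le d (T : measurableType d) (R : realType)
    (mu : {measure set T -> \bar R}) (I : Type) (r : seq I) (p : pred I) (F : I -> set T) :
  (forall i, measurable (F i)) ->
  (mu (\big[setU/set0]_(i <- r | p i) F i) <= \sum_(i <- r | p i) mu (F i))%E.
Proof.
move=> mF; elim: r => [|i r IH]; first by rewrite !big_nil measure0.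
rewrite !big_cons; case: ifP => // _.
apply: le_trans (measureU2 mu (mF i) _) _; first by apply: bigsetU_measurable.
exact: leeD2l.
Qed.

Section growth.
Context d (T : measurableType d) (R : realType) (P : probability T R).
Variable E : nat -> T -> R.
Hypothesis mE : forall k, measurable_fun setT (E k).
Hypothesis indE : mutually_independent P E.
Hypothesis lawE : forall k, has_distribution P (E k) (exponential_prob 1).

Definition arrival k w : R := \sum_(j < k.+1) E j w.

Lemma ae_interarrival_gt0 : {ae P, forall w, forall k, 0 < E k w}.
Proof.
apply/ae_foralln => k.
have mEk : measurable (E k @^-1` [set x | x <= 0]).
  by rewrite -[X in measurable X]setTI; apply: mE => //; rewrite -set_itvNyc; exact: measurable_itv.
exists (E k @^-1` [set x | x <= 0]); split => //.
  apply/eqP; rewrite eq_le measure_ge0 andbT.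
  have m0 : measurable [set x : R | (x <= 0)%R] by rewrite -set_itvNyc; exact: measurable_itv.
  by have H := exponential_prob_small (lexx (0 : R)); rewrite -(lawE k m0) in H.
by move=> w /= /negP; rewrite -leNgt.
Qed.

(* With [t = 1/64], a given set of at least half of the first [k + 1] variables
   is below [t] with probability at most [8 ^ - (k + 1)], and there are
   [2 ^ (k + 1)] sets to consider. *)
Let t : R := 64^-1.
Let small k : set T := E k @^-1` [set x | x <= t].

Let msmall k : measurable (small k).
Proof.
by rewrite -[X in measurable X]setTI; apply: mE => //; rewrite -set_itvNyc; exact: measurable_itv.
Qed.

Let many k : set T := \bigcup_(S in [set S : {set 'I_k.+1} | (k < #|S|.*2)%N])
   \bigcap_(i in [set` [seq val j | j <- enum S]]) small i.

Let mmany k : measurable (many k).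
Proof.
apply: fin_bigcup_measurable => [|S _]; first exact: finite_finset.
by apply: fin_bigcap_measurable => // ; exact: finite_seq.
Qed.

Let P_small k : (P (small k) <= t%:E)%E.
Proof.
have mt : measurable [set x : R | (x <= t)%R] by rewrite -set_itvNyc; exact: measurable_itv.
rewrite /small (lawE k mt); apply: exponential_prob_small.
by rewrite invr_ge0.
Qed.

Let P_many k : (P (many k) <= (4^-1 ^+ k.+1)%:E)%E.
Proof.
pose cap (S : {set 'I_k.+1}) := \bigcap_(i in [set` [seq val j | j <- enum S]]) small i.
have mcap S : measurable (cap S) by apply: fin_bigcap_measurable => //; exact: finite_seq.
have Pcap (S : {set 'I_k.+1}) : (k < #|S|.*2)%N -> (P (cap S) <= (8^-1 ^+ k.+1)%:E)%E.
  move=> kS; rewrite /cap (indE (s := [seq val j | j <- enum S]) (B := fun=> [set x : R | (x <= t)%R])).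
  - rewrite big_map.
    apply: (@le_trans _ _ (\prod_(j <- enum S) t%:E)%E).
      elim: (enum S) => [|j s IH]; first by rewrite !big_nil.
      by rewrite !big_cons; apply: lee_pmul => //; [exact: prode_ge0|exact: P_small].
    rewrite prodEFin lee_fin big_const_seq count_predT iter_mulr_1 -cardE.
    rewrite (_ : t = 8^-1 ^+ 2); last by rewrite /t; field.
    by rewrite -exprM mul2n ler_wiXn2l// invf_le1// ler1n.
  - by rewrite map_inj_uniq ?enum_uniq//; exact: val_inj.
  - by move=> _; rewrite -set_itvNyc; exact: measurable_itv.
apply: (@le_trans _ _ (\sum_(S : {set 'I_k.+1}) (8^-1 ^+ k.+1)%:E)%E).
  apply: (@le_trans _ _ (P (\big[setU/set0]_(S : {set 'I_k.+1} | (k < #|S|.*2)%N) cap S))).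
    apply: le_measure; rewrite ?inE//.
      by apply: bigsetU_measurable.
    by move=> w [S /= kS wS]; rewrite -bigcup_seq_cond; exists S => //=; rewrite mem_index_enum.
  apply: (@le_trans _ _ (\sum_(S : {set 'I_k.+1} | (k < #|S|.*2)%N) P (cap S))%E).
    by apply: measure_bigsetU_le.
  rewrite [leRHS](bigID (fun S : {set 'I_k.+1} => (k < #|S|.*2)%N))/= -[leLHS]adde0.
  apply: leeD; first by apply: lee_sum => S; exact: Pcap.
  by apply: sume_ge0 => S _; rewrite lee_fin exprn_ge0// invr_ge0.
rewrite sumEFin lee_fin sumr_const -cardsT -powersetT card_powerset cardsT card_ord.
rewrite -[leLHS]mulr_natl natrX -exprMn (_ : 2 * 8^-1 = 4^-1 :> R)//.
by field.
Qed.

Let few_small k w : ~ many k w -> (forall j, 0 < E j w) ->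
  k.+1%:R / 128 <= \sum_(j < k.+1) E j w.
Proof.
move=> nmany E0; pose S := finset (fun j : 'I_k.+1 => E j w <= t).
have kS : (#|S|.*2 <= k)%N.
  rewrite leqNgt; apply/negP => kS; apply: nmany; exists S => //= i /= /mapP[j].
  by rewrite mem_enum inE => Ej ->.
apply: (@le_trans _ _ (\sum_(j < k.+1) (if j \in ~: S then t else 0))).
  rewrite -big_mkcond /= sumr_const -mulr_natl.
  have := cardsC S; rewrite card_ord => cS.
  have h : (k.+1 <= 2 * #|~: S|)%N by lia.
  have : k.+1%:R <= 2 * #|~: S|%:R :> R by rewrite -natrM ler_nat.
  by rewrite /t; lra.
apply: ler_sum => j _; rewrite !inE; case: ifP => h; last exact: ltW.
by apply: ltW; rewrite ltNge h.
Qed.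

(** By the Borel-Cantelli lemma, for large [k] at least half of the first [k + 1]
    interarrival times exceed [1 / 64]. *)
Lemma ae_arrival_growth : {ae P, forall w, exists K, forall k, (K <= k)%N ->
  k.+1%:R / 128 <= arrival k w}.
Proof.
have bc : P (lim_sup_set many) = 0%E.
  apply: lim_sup_set_cvg0 => //.
  apply: (@le_lt_trans _ _ (\sum_(0 <= k <oo) (4^-1 ^+ k.+1)%:E)%E).
    by apply: lee_nneseries => // k _; exact: P_many.
  apply: (@le_lt_trans _ _ 1%E); last exact: ltry.
  apply: lime_le.
    by apply: is_cvg_nneseries => k _ _; rewrite lee_fin exprn_ge0// invr_ge0.
  apply: nearW => n; rewrite sumEFin lee_fin.
  suff -> : \sum_(0 <= i < n) (4^-1 ^+ i.+1 : R) = (1 - 4^-1 ^+ n) / 3.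
    have : (0 : R) <= 4^-1 ^+ n by rewrite exprn_ge0// invr_ge0.
    lra.
  elim: n => [|n IH]; first by rewrite big_geq// expr0 subrr mul0r.
  by rewrite big_nat_recr//= IH exprS; field.
have nolim : {ae P, forall w, ~ lim_sup_set many w}.
  exists (lim_sup_set many); split => //; last by move=> w /= /contrapT.
  by apply: bigcapT_measurable => k; exact: bigcup_measurable.
apply: filterS2 ae_interarrival_gt0 nolim => w E0 nw.
have [K HK] : exists K, forall k, (K <= k)%N -> ~ many k w.
  apply: contrapT => H; apply: nw => K _; apply: contrapT => H'; apply: H.
  by exists K => k Kk mk; apply: H'; exists k.
by exists K => k /HK nk; exact: few_small.
Qed.

End growth.

(** * Stationarity and the maximal inequality *)

Lemma measurable_sum_in d (T : measurableType d) (R : realType) (I : eqType) (s : seq I)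
    (h : I -> T -> R) : (forall i, i \in s -> measurable_fun setT (h i)) ->
  measurable_fun setT (fun x => \sum_(i <- s) h i x).
Proof.
elim: s => [|i s IH] mh.
  rewrite (_ : (fun _ => _) = cst 0); first exact: measurable_cst.
  by apply/funext => x; rewrite big_nil.
rewrite (_ : (fun _ => _) = (fun x => h i x + \sum_(i <- s) h i x)); last first.
  by apply/funext => x; rewrite big_cons.
apply: measurable_funD; first by apply: mh; rewrite mem_head.
by apply: IH => j js; apply: mh; rewrite in_cons js orbT.
Qed.

Section maximal.
Variable R : realType.
Implicit Types (y : nat -> R) (lam : R).

Definition exceeds N lam y := [exists n : 'I_N, lam * n.+1%:R < \sum_(1 <= j < n.+2) y j].

(** Cover the bad starting points from left to right: a bad starting point [a]
    comes with a block after [a] of mean larger than [lam], and the search for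
    the next bad starting point resumes at the end of this block.  The blocks
    are disjoint, the sum over each is larger than [lam] times its length, and
    they stay within [L + N]. *)
Lemma maximal_count N lam y L : 0 <= lam -> (forall j, 0 <= y j) ->
  \sum_(s < L) lam * (exceeds N lam (fun j => y (s + j)%N))%:R <= \sum_(1 <= j < (L + N).+1) y j.
Proof.
move=> lam0 y0.
pose bad s : R := lam * (exceeds N lam (fun j => y (s + j)%N))%:R.
have bad0 s : 0 <= bad s by rewrite mulr_ge0.
have bad_le s : bad s <= lam by rewrite ler_piMr//; case: (exceeds _ _ _).
have tail_ge0 m n : 0 <= \sum_(m <= j < n) y j by apply: sumr_ge0.
suff H : forall m a, (L - a <= m)%N ->
    \sum_(a <= s < L) bad s <= \sum_(a.+1 <= j < (L + N).+1) y j.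
  by rewrite -(big_mkord xpredT bad); apply: (H L); rewrite subn0.
elim=> [|m IH] a Lam; first by rewrite big_geq// -subn_eq0 -leqn0.
have [La|aL] := leqP L a; first by rewrite big_geq.
have [/existsP[n]|nex] := boolP (exceeds N lam (fun j => y (a + j)%N)).
  move=> lam_n.
  have split_y : \sum_(a.+1 <= j < (L + N).+1) y j =
      \sum_(a.+1 <= j < (a + n.+1).+1) y j + \sum_((a + n.+1).+1 <= j < (L + N).+1) y j.
    by rewrite -big_cat_nat//; have := ltn_ord n; lia.
  have block : lam * n.+1%:R <= \sum_(a.+1 <= j < (a + n.+1).+1) y j.
    apply: ltW; apply: lt_le_trans lam_n _.
    rewrite -[a.+1]add1n -[(a + n.+1).+1]/((a + n.+1).+1) big_addn.
    have -> : ((a + n.+1).+1 - a)%N = n.+2 by lia.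
    by apply: ler_sum => j _; rewrite addnC.
  rewrite split_y.
  have [Lan|anL] := leqP L (a + n.+1).
    have : \sum_(a <= s < L) bad s <= lam * n.+1%:R.
      apply: (@le_trans _ _ (\sum_(a <= s < L) lam)); first exact: ler_sum.
      rewrite sumr_const_nat -[leLHS]mulr_natr ler_wpM2l// ler_nat; lia.
    have := tail_ge0 (a + n.+1).+1 (L + N).+1; lra.
  have : \sum_(a <= s < L) bad s = \sum_(a <= s < a + n.+1) bad s + \sum_(a + n.+1 <= s < L) bad s.
    by rewrite -big_cat_nat//; lia.
  have : \sum_(a <= s < a + n.+1) bad s <= lam * n.+1%:R.
    apply: (@le_trans _ _ (\sum_(a <= s < a + n.+1) lam)); first exact: ler_sum.
    rewrite sumr_const_nat -[leLHS]mulr_natr ler_wpM2l// ler_nat; lia.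
  have := IH (a + n.+1)%N (_ : (L - (a + n.+1) <= m)%N).
  have Lm : (L - (a + n.+1) <= m)%N by lia.
  move=> /(_ Lm); lra.
rewrite big_ltn// /bad (negPf nex) mulr0 add0r.
apply: le_trans (IH a.+1 _) _; first by lia.
by rewrite [leRHS]big_ltn ?lerDr//; lia.
Qed.

End maximal.

Lemma measurable_exceeds d (T : measurableType d) (R : realType) N (lam : R) (W : nat -> T -> R) :
  (forall j, measurable_fun setT (W j)) ->
  measurable [set z | exceeds N lam (fun j => W j z)].
Proof.
move=> mW.
have -> : [set z | exceeds N lam (fun j => W j z)] =
  \bigcup_(n in [set: 'I_N]) ((fun z => \sum_(1 <= j < n.+2) W j z) @^-1` `]lam * n.+1%:R, +oo[).
  apply/seteqP; split => z /=.
    by move=> /existsP[n Hn]; exists n => //=; rewrite in_itv /= andbT.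
  by move=> [n _ /=]; rewrite in_itv /= andbT => Hn; apply/existsP; exists n.
apply: fin_bigcup_measurable => [|n _]; first exact: finite_finset.
rewrite -[X in measurable X]setTI; apply: measurable_sum => //; exact: measurable_itv.
Qed.

Section lepage.
Context d (T : measurableType d) (R : realType) (P : probability T R).
Variables (E G1 G2 Z : nat -> T -> R) (alpha kap delta : R).
Local Notation idx := ((nat + nat) + (nat + nat))%type.
Let V : idx -> T -> R := merge4 E G1 G2 Z.
Hypothesis mV : forall i, measurable_fun setT (V i).
Hypothesis indV : mutually_independent P V.
Hypothesis G1_gauss : forall k (A : set (measurableTypeR R)), measurable A ->
  P (G1 k @^-1` A) = normal_prob 0 1 A.
Hypothesis G2_gauss : forall k (A : set (measurableTypeR R)), measurable A ->
  P (G2 k @^-1` A) = normal_prob 0 1 A.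
Hypothesis alpha0 : 0 < alpha.

Local Notation arrival := (arrival E).

(** The LePage coefficients of scale [kap]. *)
Definition scaled_gauss (G : nat -> T -> R) k w : R := kap * arrival k w `^ (- alpha^-1) * G k w.

(** Flooring the arrival time by the linear bound makes the variances finite; by
    [ae_arrival_growth] it changes finitely many terms. *)
Definition trunc_amp k w : R :=
  kap * (Num.max (arrival k w) (k.+1%:R / 128)) `^ (- alpha^-1).

Definition trunc_term k (u : R) w : R :=
  trunc_amp k w * (G1 k w * cos (Z k w * u) + G2 k w * sin (Z k w * u)).

Definition amp_bound k : R := kap ^+ 2 * (k.+1%:R / 128) `^ (- (2 / alpha)).

Lemma trunc_amp_bound k w : trunc_amp k w ^+ 2 <= amp_bound k.
Proof.
rewrite /trunc_amp exprMn /amp_bound ler_wpM2l ?sqr_ge0//.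
have k0 : 0 < k.+1%:R / 128 :> R by rewrite divr_gt0.
rewrite -powR_mulrn ?powR_ge0// -powRrM (_ : - alpha^-1 * 2%:R = - (2 / alpha)); last by rewrite mulNr mulrC.
have a2 : 0 <= 2 / alpha by rewrite divr_ge0// ltW.
have m0 : 0 < Num.max (arrival k w) (k.+1%:R / 128) by rewrite lt_max k0 orbT.
rewrite !powRN lef_pV2 ?posrE ?powR_gt0// ge0_ler_powR ?nnegrE ?(ltW k0) ?(ltW m0)//.
by rewrite le_max lexx orbT.
Qed.

(** A term only depends on the interarrival times and on its own Gaussian pair
    and frequency: [J] may leave out the Gaussian variables of other terms, and
    these stay available for conditioning. *)
Section measurability.
Variable J : pred idx.
Local Notation TJ := (generated V J).
Hypothesis JE : forall k, J (inl (inl k)).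

Lemma measurable_arrival k : measurable_fun setT (arrival k : TJ -> R).
Proof.
apply: measurable_sum => j.
exact: (@generated_measurableX _ T _ _ _ V J (inl (inl (val j))) (JE _)).
Qed.

Lemma measurable_trunc_amp k : measurable_fun setT (trunc_amp k : TJ -> R).
Proof.
apply: measurable_funM => //.
apply: (measurableT_comp (measurable_powR _)).
by apply: measurable_maxr => //; exact: measurable_arrival.
Qed.

Lemma measurable_freq k (g : R -> R) u : J (inr (inr k)) -> continuous g ->
  measurable_fun setT ((fun w => g (Z k w * u)) : TJ -> R).
Proof.
move=> JZ cg; apply: measurableT_comp; first exact: continuous_measurable_fun.
apply: measurable_funM => //.
exact: (@generated_measurableX _ T _ _ _ V J (inr (inr k))).
Qed.

Lemma measurable_trunc_term k u : J (inl (inr k)) -> J (inr (inl k)) -> J (inr (inr k)) ->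
  measurable_fun setT (trunc_term k u : TJ -> R).
Proof.
move=> J1 J2 JZ; apply: measurable_funM; first exact: measurable_trunc_amp.
apply: measurable_funD; apply: measurable_funM.
- exact: (@generated_measurableX _ T _ _ _ V J (inl (inr k))).
- by apply: measurable_freq => //; exact: continuous_cos.
- exact: (@generated_measurableX _ T _ _ _ V J (inr (inl k))).
- by apply: measurable_freq => //; exact: continuous_sin.
Qed.

End measurability.

(** The times [u k] may depend on [k], so that a shift of the time can be done one
    term after the other. *)
Definition psum K L (u : nat -> R) w : R := \sum_(K <= k < L) trunc_term k (u k) w.

Lemma measurable_psum_in (J : pred idx) K L u :
  (forall k, J (inl (inl k))) -> (forall k, (K <= k < L)%N -> J (inl (inr k)) && J (inr (inl k))) ->
  (forall k, J (inr (inr k))) ->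
  measurable_fun setT (psum K L u : generated V J -> R).
Proof.
move=> JE JG JZ; apply: measurable_sum_in => k; rewrite mem_index_iota => kKL.
by have /andP[? ?] := JG k kKL; apply: measurable_trunc_term.
Qed.

Let m2 : R := fine (gauss_moment2 R).

(** The Gaussian variables are added one at a time, each of them independent of
    the sum so far. *)
Lemma psum_moment K L u :
  (\int[P]_w (psum K L u w ^+ 2)%:E <= (\sum_(K <= k < L) 2 * m2 * amp_bound k)%:E)%E.
Proof.
have m20 : 0 <= m2 by rewrite fine_ge0// gauss_moment2_ge0.
have m2E : gauss_moment2 R = m2%:E by rewrite fineK// gauss_moment2_fin.
elim: L => [|L IH].
  rewrite big_geq//; under eq_integral do rewrite /psum big_geq// expr0n.
  by rewrite integral0.
have [KL|LK] := leqP K L; last first.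
  rewrite big_geq//; under eq_integral do rewrite /psum big_geq// expr0n.
  by rewrite integral0.
rewrite big_nat_recr//= EFinD.
pose i2 : idx := inr (inl L); pose i1 : idx := inl (inr L).
pose C w := trunc_amp L w * cos (Z L w * u L).
pose D w := trunc_amp L w * sin (Z L w * u L).
have mJ (J : pred idx) : (forall k, J (inl (inl k))) -> (forall k, J (inr (inr k))) ->
   measurable_fun setT (C : generated V J -> R) /\ measurable_fun setT (D : generated V J -> R).
  move=> JE JZ; split; apply: measurable_funM.
  - exact: measurable_trunc_amp.
  - by apply: measurable_freq => //; exact: continuous_cos.
  - exact: measurable_trunc_amp.
  - by apply: measurable_freq => //; exact: continuous_sin.
have int_le (D' : T -> R) : measurable_fun setT D' -> (forall w, D' w ^+ 2 <= amp_bound L) ->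
   (\int[P]_w (D' w ^+ 2)%:E * gauss_moment2 R <= (m2 * amp_bound L)%:E)%E.
  move=> mD' D'le; rewrite m2E EFinM [leRHS]muleC; apply: lee_wpmul2r; first by rewrite lee_fin.
  apply: (@le_trans _ _ (\int[P]_w (amp_bound L)%:E)%E).
    apply: ge0_le_integral => //.
    - by move=> w _; rewrite lee_fin sqr_ge0.
    - exact/measurable_EFinP/measurable_funX.
    - by move=> w _; rewrite lee_fin.
  by rewrite integral_cst//= probability_setT mule1.
have trig_le (c : R) w : `|c| <= 1 -> (trunc_amp L w * c) ^+ 2 <= amp_bound L.
  move=> c1; rewrite exprMn; apply: le_trans (trunc_amp_bound L w).
  rewrite ler_piMr ?sqr_ge0// -real_normK ?num_real//.
  by rewrite exprn_ile1.
pose U w := psum K L u w + C w * G1 L w.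
have [mC1 mD1] := mJ (predC1 i1) (fun=> isT) (fun=> isT).
have [mC2 mD2] := mJ (predC1 i2) (fun=> isT) (fun=> isT).
have neL k : (K <= k < L)%N -> k != L by move=> /andP[_]; rewrite ltn_neqAle => /andP[].
have mS1 : measurable_fun setT (psum K L u : generated V (predC1 i1) -> R).
  apply: measurable_psum_in => // k /neL kL.
  by apply/andP; split => //; apply: contra kL => /eqP[->].
have mS2 : measurable_fun setT (psum K L u : generated V (predC1 i2) -> R).
  exact: measurable_psum_in.
have mU : measurable_fun setT (U : generated V (predC1 i2) -> R).
  apply: measurable_funD => //; apply: measurable_funM => //.
  exact: (@generated_measurableX _ T _ _ _ V (predC1 i2) i1).
have Ji (i : idx) : ~~ (predC1 i) i by rewrite /= eqxx.
have step2 := moment_one mV indV (Ji i2) (@G2_gauss L) mU mD2.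
have step1 := moment_one mV indV (Ji i1) (@G1_gauss L) mS1 mC1.
have psumS w : psum K L.+1 u w = U w + D w * V i2 w.
  by rewrite /psum big_nat_recr//= /U /C /D /trunc_term /psum; ring.
under eq_integral do rewrite psumS.
rewrite step2 [X in (X + _ <= _)%E]step1 -addeA; apply: leeD => //.
have -> : 2 * m2 * amp_bound L = m2 * amp_bound L + m2 * amp_bound L by ring.
rewrite EFinD; apply: leeD; apply: int_le.
- have [+ _] := mJ predT (fun=> isT) (fun=> isT); move=> mC _ B mB.
  by rewrite setTI; apply: (sub_generated mV (J := predT)); rewrite -[X in measurable X]setTI; exact: mC.
- by move=> w; apply: trig_le; exact: cos_max.
- have [_ +] := mJ predT (fun=> isT) (fun=> isT); move=> mD _ B mB.
  by rewrite setTI; apply: (sub_generated mV (J := predT)); rewrite -[X in measurable X]setTI; exact: mD.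
- by move=> w; apply: trig_le; exact: sin_max.
Qed.

Definition excess N lam K L (u : nat -> nat -> R) : set T :=
  [set w | exceeds N lam (fun j => psum K L (fun k => u k j) w ^+ 2)].

(** Increasing the time by [phi] in the term [r] rotates the pair [(G1 r, G2 r)] by
    the angle [Z r * phi], a function of the variables that are kept fixed. *)
Lemma rotate_phase N lam K L (u : nat -> nat -> R) r phi :
  P (excess N lam K L (fun k j => if k == r then u r j + phi else u k j)) =
  P (excess N lam K L u).
Proof.
have [rKL|rKL] := boolP ((K <= r < L)%N); last first.
  congr (P _); apply/seteqP; split => w; rewrite /excess /=;
  congr (is_true (exceeds _ _ _)); apply/funext => j; congr (_ ^+ 2);
  apply: eq_big_nat => k kKL; case: eqP => // kr; rewrite -kr kKL in rKL => //.
pose i1 : idx := inl (inr r); pose i2 : idx := inr (inl r).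
pose J : pred idx := fun i => (i != i1) && (i != i2).
pose U j w := \sum_(k <- index_iota K L | k != r) trunc_term k (u k j) w.
have mA : measurable_fun setT (trunc_amp r : generated V J -> R) by exact: measurable_trunc_amp.
have mU j : measurable_fun setT (U j : generated V J -> R).
  rewrite /U (_ : (fun _ => _) = (fun w => \sum_(k <- index_iota K L) if k != r then trunc_term k (u k j) w else 0)); last first.
    by apply/funext => w; rewrite big_mkcond.
  apply: measurable_sum_in => k _; case: eqP => [_|/eqP kr] /=; first exact: measurable_cst.
  apply: measurable_trunc_term => //; rewrite /J /=; apply/andP; split => //.
pose RR := measurableTypeR R.
pose W j (z : generated V J * (RR * RR)) : R :=
  U j z.1 + trunc_amp r z.1 * (z.2.1 * cos (Z r z.1 * u r j) + z.2.2 * sin (Z r z.1 * u r j)).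
have m21 : measurable_fun setT (fun z : generated V J * (RR * RR) => z.2.1 : R).
  by apply: (measurableT_comp (f := fst)) => //; exact: measurable_snd.
have m22 : measurable_fun setT (fun z : generated V J * (RR * RR) => z.2.2 : R).
  by apply: (measurableT_comp (f := snd)) => //; exact: measurable_snd.
have mW j : measurable_fun setT (W j).
  apply: measurable_funD; first exact: (measurableT_comp (mU j)).
  apply: measurable_funM; first exact: (measurableT_comp mA).
  apply: measurable_funD; apply: measurable_funM => //.
    apply: (measurableT_comp (f := fun w : generated V J => cos (Z r w * u r j))) => //.
    by apply: measurable_freq => //; exact: continuous_cos.
  apply: (measurableT_comp (f := fun w : generated V J => sin (Z r w * u r j))) => //.
  by apply: measurable_freq => //; exact: continuous_sin.
pose B : set (generated V J * (RR * RR)) := [set z | exceeds N lam (fun j => W j z ^+ 2)].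
have mB : measurable B by apply: measurable_exceeds => j; exact: measurable_funX.
have mphi : measurable_fun setT ((fun w => Z r w * phi) : generated V J -> R).
  by apply: (measurable_freq (g := id)) => // x; exact: cvg_id.
have psumE w : (fun j => psum K L (fun k => u k j) w ^+ 2) = (fun j => W j (w, (V i1 w, V i2 w)) ^+ 2).
  apply/funext => j; congr (_ ^+ 2); rewrite /psum (bigD1_seq r) ?iota_uniq ?mem_index_iota//=.
  by rewrite addrC.
have psumE' w : (fun j => psum K L (fun k => if k == r then u r j + phi else u k j) w ^+ 2) =
   (fun j => W j (w, rotation (cos (Z r w * phi)) (sin (Z r w * phi)) (V i1 w, V i2 w)) ^+ 2).
  apply/funext => j; congr (_ ^+ 2); rewrite /psum (bigD1_seq r) ?iota_uniq ?mem_index_iota//=.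
  rewrite eqxx addrC; congr (_ + _).
    by apply: eq_bigr => k /negPf ->.
  rewrite /trunc_term [Z r w * (_ + _)]mulrDr cosD sinD /rotation /=; ring.
have <- : P [set w | B (w, (V i1 w, V i2 w))] = P (excess N lam K L u).
  by congr (P _); apply/seteqP; split => w; rewrite /excess /B /= psumE.
have Ji1 : ~~ J i1 by rewrite /J eqxx.
have Ji2 : ~~ J i2 by rewrite /J eqxx andbF.
rewrite -(rotate_pair mV indV Ji1 Ji2 _ (@G1_gauss r) (@G2_gauss r) mB mphi)//.
by congr (P _); apply/seteqP; split => w; rewrite /excess /B /= psumE'.
Qed.

Definition grid (s k j : nat) : R := (s + j)%:R * delta.

(** Stationarity of the partial sums, in the form in which it is used. *)
Lemma excess_shift N lam K L s : P (excess N lam K L (grid s)) = P (excess N lam K L (grid 0)).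
Proof.
pose u r k j := if (k < r)%N then grid s k j else grid 0 k j.
have H r : P (excess N lam K L (u r)) = P (excess N lam K L (grid 0)).
  elim: r => [//|r <-]; rewrite -(rotate_phase N lam K L (u r) r (s%:R * delta)).
  congr (P (excess _ _ _ _ _)); apply/funext => k; apply/funext => j.
  rewrite /u /grid; case: eqP => [->|/eqP kr]; last by rewrite ltnS leq_eqVlt (negPf kr).
  by rewrite ltnSn ltnn add0n natrD; ring.
rewrite -(H L); congr (P _); apply/seteqP; split => w; rewrite /excess /=;
congr (is_true (exceeds _ _ _)); apply/funext => j; congr (_ ^+ 2);
by apply: eq_big_nat => k /andP[_ kL]; rewrite /u kL.
Qed.

(** Integrating [maximal_count] over a window of [M] starting points gives, by
    stationarity, [M * lam * p <= (M + N) * v]; then [M] tends to infinity. *)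
Lemma excess_prob N lam K L : 0 < lam ->
  (P (excess N lam K L (grid 0)) <= ((\sum_(K <= k < L) 2 * m2 * amp_bound k) / lam)%:E)%E.
Proof.
move=> lam0; set v := \sum_(K <= k < L) _.
have mS u : measurable_fun setT (psum K L u).
  move=> _ B mB; rewrite setTI; apply: (sub_generated mV (J := predT)).
  by rewrite -[X in measurable X]setTI; apply: measurable_psum_in.
have mX s : measurable (excess N lam K L (grid s)).
  apply: (@measurable_exceeds _ T R N lam (fun j w => psum K L (fun k => grid s k j) w ^+ 2)) => j.
  exact: measurable_funX.
have m1 s : measurable_fun setT (\1_(excess N lam K L (grid s)) : T -> R) by exact/measurable_indic/mX.
set p := P _; have pfin : p \is a fin_num by exact: fin_num_measure.
have v0 : 0 <= v.
  apply: sumr_ge0 => k _; apply: mulr_ge0; first by rewrite mulr_ge0 ?fine_ge0 ?gauss_moment2_ge0.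
  by apply: mulr_ge0; [exact: sqr_ge0|exact: powR_ge0].
have step M : M%:R * (lam * fine p) <= (M + N)%:R * v.
  have : (\int[P]_w (\sum_(s < M) lam * (\1_(excess N lam K L (grid s)) w : R))%:E <=
          \int[P]_w (\sum_(1 <= j < (M + N).+1) psum K L (fun k => grid 0 k j) w ^+ 2)%:E)%E.
    apply: ge0_le_integral => //.
    - by move=> w _; rewrite lee_fin; apply: sumr_ge0 => s _; rewrite mulr_ge0// ltW.
    - by apply/measurable_EFinP; apply: measurable_sum => s; exact: measurable_funM.
    - by apply/measurable_EFinP; apply: measurable_sum => j; exact: measurable_funX.
    move=> w _; rewrite lee_fin.
    have := @maximal_count R N lam (fun j => psum K L (fun k => grid 0 k j) w ^+ 2) M (ltW lam0) (fun j => sqr_ge0 _).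
    apply: le_trans; apply: ler_sum => s _; rewrite ler_wpM2l ?(ltW lam0)//.
    rewrite indicE ler_nat leq_eqVlt; apply/orP; left; apply/eqP; congr (nat_of_bool _).
    by apply/idP/idP; rewrite inE.
  under eq_integral do rewrite -sumEFin.
  rewrite ge0_integral_sum//; last 2 first.
  - by move=> s; apply/measurable_EFinP; exact: measurable_funM.
  - by move=> s w _; rewrite lee_fin mulr_ge0// ltW.
  under [X in (_ <= X)%E -> _]eq_integral do rewrite -sumEFin.
  rewrite ge0_integral_sum//; last 2 first.
  - by move=> s; apply/measurable_EFinP; exact: measurable_funX.
  - by move=> s w _; rewrite lee_fin sqr_ge0.
  move=> H.
  have L1 : (\sum_(s < M) \int[P]_w (lam * (\1_(excess N lam K L (grid s)) w : R))%:E)%E = (M%:R * (lam * fine p))%:E.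
    rewrite (eq_bigr (fun=> (lam * fine p)%:E)).
      by rewrite sumEFin sumr_const card_ord mulr_natl.
    move=> s _; under eq_integral do rewrite EFinM.
    rewrite ge0_integralZl//.
    - by rewrite integral_indic// setIT [X in (_ * X)%E]excess_shift EFinM fineK.
    - exact/measurable_EFinP.
    - by rewrite lee_fin ltW.
  have L2 : (\sum_(1 <= j < (M + N).+1) \int[P]_w (psum K L (fun k => grid 0 k j) w ^+ 2)%:E <= ((M + N)%:R * v)%:E)%E.
    apply: (@le_trans _ _ (\sum_(1 <= j < (M + N).+1) v%:E)%E).
      by apply: lee_sum => j _; exact: psum_moment.
    by rewrite sumEFin sumr_const_nat subn1 /= -[X in (X%:E <= _)%E]mulr_natl.
  by have := le_trans H L2; rewrite L1 lee_fin.
rewrite -(fineK pfin) lee_fin ler_pdivlMr// mulrC leNgt; apply/negP => vp.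
have gap0 : 0 < lam * fine p - v by rewrite subr_gt0.
have := step (Num.bound (N%:R * v / (lam * fine p - v))).
have : N%:R * v / (lam * fine p - v) < (Num.bound (N%:R * v / (lam * fine p - v)))%:R.
  by apply: archi_boundP; rewrite divr_ge0 ?mulr_ge0// ltW.
rewrite ltr_pdivrMr//; move: (Num.bound _) => M; rewrite natrD; lra.
Qed.

End lepage.

(** * Almost surely vanishing tails *)

Section tail.
Context d (T : measurableType d) (R : realType) (P : probability T R).
Variables (E G1 G2 Z : nat -> T -> R) (alpha kap delta : R).
Let V := merge4 E G1 G2 Z.
Hypothesis mV : forall i, measurable_fun setT (V i).
Hypothesis indV : mutually_independent P V.
Hypothesis G1_gauss : forall k (A : set (measurableTypeR R)), measurable A ->
  P (G1 k @^-1` A) = normal_prob 0 1 A.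
Hypothesis G2_gauss : forall k (A : set (measurableTypeR R)), measurable A ->
  P (G2 k @^-1` A) = normal_prob 0 1 A.
Hypothesis alpha02 : 0 < alpha < 2.

Let alpha0 : 0 < alpha. Proof. by case/andP: alpha02. Qed.
Let q : R := 2 / alpha - 1.
Let q0 : 0 < q.
Proof. by rewrite /q subr_gt0 ltr_pdivlMr// mul1r; case/andP: alpha02. Qed.

Local Notation amp_bound := (@amp_bound R alpha kap).
Let m2 : R := fine (gauss_moment2 R).
Let m20 : 0 <= m2. Proof. by rewrite fine_ge0// gauss_moment2_ge0. Qed.

Lemma amp_bound_tail : exists2 C : R, 0 < C & forall K L, (0 < K)%N ->
  \sum_(K <= k < L) 2 * m2 * amp_bound k <= C * K%:R `^ (- q).
Proof.
pose C0 := 2 * m2 * (kap ^+ 2 * 128^-1 `^ (- (1 + q))) / q.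
have c0 : 0 <= 2 * m2 * (kap ^+ 2 * 128^-1 `^ (- (1 + q))).
  apply: mulr_ge0; first by rewrite mulr_ge0.
  by apply: mulr_ge0; [exact: sqr_ge0|exact: powR_ge0].
have C00 : 0 <= C0 by rewrite divr_ge0// ltW.
exists (C0 + 1); first by rewrite ltr_wpDl.
move=> K L K0.
apply: (@le_trans _ _ (C0 * K%:R `^ (- q))); last first.
  by rewrite ler_wpM2r ?powR_ge0// lerDl.
rewrite (eq_bigr (fun k => (2 * m2 * (kap ^+ 2 * 128^-1 `^ (- (1 + q)))) * k.+1%:R `^ (- (1 + q)))); last first.
  move=> k _; rewrite /amp_bound (_ : 2 / alpha = 1 + q); last by rewrite /q addrC subrK.
  by rewrite powRM ?invr_ge0 ?ler0n//; ring.
rewrite -mulr_sumr /C0 [leRHS]mulrAC -[leRHS]mulrA ler_wpM2l//.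
exact: p_series_tail.
Qed.

Let Exc lam K M L := excess E G1 G2 Z alpha kap M lam K L (grid delta 0).

Let mExc lam K M L : measurable (Exc lam K M L).
Proof.
apply: (@measurable_exceeds _ T R M lam (fun j w => psum E G1 G2 Z alpha kap K L (fun k => grid delta 0 k j) w ^+ 2)) => j.
apply: measurable_funX => _ B mB; rewrite setTI; apply: (sub_generated mV (J := predT)).
by rewrite -[X in measurable X]setTI; apply: measurable_psum_in.
Qed.

(* From some horizon on, the sums from [K] to [L] all have a running mean square
   that exceeds [lam]. *)
Let stays lam K := \bigcup_M \bigcap_(L in [set L | (M <= L)%N]) Exc lam K M L.

Let mstays lam K : measurable (stays lam K).
Proof. by apply: bigcup_measurable => M _; apply: bigcap_measurable => [|L _]; [exists M => /=|]. Qed.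

Lemma exceeds_mono M M' lam (y : nat -> R) : (M <= M')%N -> exceeds M lam y -> exceeds M' lam y.
Proof.
by move=> MM /existsP[n Hn]; apply/existsP; exists (widen_ord MM n).
Qed.

Lemma stays_prob (C lam : R) K : 0 < lam -> (forall L, \sum_(K <= k < L) 2 * m2 * amp_bound k <= C) ->
  (P (stays lam K) <= (C / lam)%:E)%E.
Proof.
move=> lam0 HC.
pose F M := \bigcap_(L in [set L | (M <= L)%N]) Exc lam K M L.
have mF M : measurable (F M) by apply: bigcap_measurable => [|L _]; [exists M => /=|].
have ndF : nondecreasing_seq F.
  move=> M M' MM; apply/subsetPset => w Fw L /= ML.
  by apply: (exceeds_mono MM); apply: Fw; rewrite /= (leq_trans MM).
have cv := @nondecreasing_cvg_mu _ _ _ P F mF (bigcup_measurable (fun k _ => mF k)) ndF.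
have <- : limn (P \o F) = P (stays lam K) by apply/cvg_lim => //; exact: cv.
apply: lime_le; first by apply/cvg_ex; exists (P (stays lam K)); exact: cv.
apply: nearW => M /=.
apply: (@le_trans _ _ (P (Exc lam K M M))).
  by apply: le_measure; rewrite ?inE// => w; apply; rewrite /=.
apply: le_trans (excess_prob kap delta mV indV G1_gauss G2_gauss alpha0 M K M lam0) _.
by rewrite lee_fin ler_wpM2r ?invr_ge0 ?(ltW lam0).
Qed.

(** The probability of [stays lam K] tends to zero along [K]. *)
Lemma ae_leaves (lam : R) : 0 < lam ->
  {ae P, forall w, forall K1, exists2 K, (K1 <= K)%N & ~ stays lam K w}.
Proof.
move=> lam0; apply/ae_foralln => K1.
have [C C0 HC] := amp_bound_tail.
exists (\bigcap_(K in [set K | (K1 <= K)%N]) stays lam K); split.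
- by apply: bigcap_measurable => // ; exists K1 => /=.
- apply/eqP; rewrite eq_le measure_ge0 andbT; apply/lee_addgt0Pr => e e0; rewrite add0e.
  have [K' HK'] := powR_vanish q0 (divr_gt0 (mulr_gt0 e0 lam0) C0).
  pose K := maxn K1 K'.+1.
  have K'K : (K' < K)%N by rewrite leq_max leqnn orbT.
  apply: (@le_trans _ _ (P (stays lam K))).
    apply: le_measure; rewrite ?inE//; first by apply: bigcap_measurable => //; exists K1 => /=.
    by move=> w; apply; rewrite /= leq_maxl.
  apply: le_trans (@stays_prob (C * K%:R `^ (- q)) lam K lam0 _) _.
    by move=> L; apply: HC; exact: leq_ltn_trans K'K.
  rewrite lee_fin ler_pdivrMr// mulrC -ler_pdivlMr//; exact: HK'.
- move=> w /= H K /= K1K; apply: contrapT => nst; apply: H; by exists K.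
Qed.

Local Notation arrival := (arrival E).
Local Notation scaled_gauss := (scaled_gauss E alpha kap).

(** Should the tail from [K] on have a running mean square larger than [lam], the
    finitely many values involved would be limits of those of partial sums, and
    [stays lam K] would hold. *)
Lemma tail_mean_square (x : nat -> T -> R) :
  (forall j, {ae P, forall w, series (fun k =>
     scaled_gauss G1 k w * cos (Z k w * (j%:R * delta))
   + scaled_gauss G2 k w * sin (Z k w * (j%:R * delta))) @ \oo --> x j w}) ->
  {ae P, forall w, exists K, forall k, (K <= k)%N -> k.+1%:R / 128 <= arrival k w} ->
  {ae P, forall w, forall e K1, 0 < e -> exists2 K, (K1 <= K)%N & forall n,
    mean_square n (fun j => x j w - \sum_(k < K)
      (scaled_gauss G1 k w * cos (Z k w * (j%:R * delta))
     + scaled_gauss G2 k w * sin (Z k w * (j%:R * delta)))) <= e}.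
Proof.
move=> /ae_foralln Hx Hgrow.
have /ae_foralln Hleave : forall m : nat, {ae P, forall w, forall K1, exists2 K, (K1 <= K)%N & ~ stays m.+1%:R^-1 K w}.
  by move=> m; apply: ae_leaves; rewrite invr_gt0.
apply: filterS3 Hx Hgrow Hleave => w xw [K0 growth] leave e K1 e0.
have [m me] : exists m : nat, m.+1%:R^-1 <= e.
  exists (Num.bound e^-1); rewrite -[leRHS]invrK lef_pV2 ?posrE ?invr_gt0//.
  apply: ltW; apply: lt_le_trans (archi_boundP _) _; first by rewrite invr_ge0 ltW.
  by rewrite ler_nat.
have [K] := leave m (maxn K0 K1); rewrite geq_max => /andP[K0K K1K] nst.
exists K => // n.
pose tt k j := scaled_gauss G1 k w * cos (Z k w * (j%:R * delta))
     + scaled_gauss G2 k w * sin (Z k w * (j%:R * delta)).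
rewrite -/(tt _ _).
pose y j := x j w - \sum_(k < K) tt k j.
have psum_cvg j : psum E G1 G2 Z alpha kap K L (fun k => grid delta 0 k j) w @[L --> \oo] --> y j.
  apply: (@cvg_trans _ ((series (tt^~ j) L - \sum_(k < K) tt k j) @[L --> \oo])).
    apply: near_eq_cvg; near=> L.
    have KL : (K <= L)%N by near: L; exact: nbhs_infty_ge.
    rewrite /series /= (big_cat_nat _ KL)//= -(big_mkord xpredT (tt^~ j)) addrAC subrr add0r.
    rewrite /psum !big_nat; apply: eq_bigr => k /andP[Kk _].
    rewrite /trunc_term /trunc_amp /tt /scaled_gauss max_l; last by apply: growth; exact: leq_trans Kk.
    by rewrite /grid add0n; ring.
  by apply: cvgB; [exact: xw|exact: cvg_cst].
apply: le_trans me; case: n => [|n]; first by rewrite /mean_square invr0 mul0r invr_ge0.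
rewrite /mean_square ler_pdivrMl// leNgt; apply/negP => big.
apply: nst.
have sum_cvg : (\sum_(1 <= j < n.+2) psum E G1 G2 Z alpha kap K L (fun k => grid delta 0 k j) w ^+ 2) @[L --> \oo]
    --> \sum_(1 <= j < n.+2) y j ^+ 2.
  apply: cvg_big => [z|j _]; first exact: add_continuous.
  by rewrite expr2; under eq_fun do rewrite expr2; apply: cvgM; exact: psum_cvg.
have [L0 _ HL0] := cvgr_gt _ sum_cvg _ big.
exists (maxn n.+1 L0) => // L /=; rewrite geq_max => /andP[nL L0L].
have nM : (n < maxn n.+1 L0)%N by rewrite leq_max ltnSn.
apply/existsP; exists (Ordinal nM) => /=.
by rewrite mulrC; exact: HL0.
Unshelve. all: by end_near.
Qed.

End tail.

(** * Positivity of the constants *)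

Section sine_integral.
Variables (R : realType) (alpha : R).
Hypothesis alpha02 : 0 < alpha < 2.
Local Notation mu := (@lebesgue_measure R).

Let alpha0 : 0 < alpha. Proof. by case/andP: alpha02. Qed.
Let alpha2 : 0 < 2 - alpha. Proof. by rewrite subr_gt0; case/andP: alpha02. Qed.
Let g (x : R) : R := x `^ (- alpha) * sin x.

Let sin_le (x : R) : `|sin x| <= `|x|.
Proof.
have := cis_sub1_le x; apply: le_trans.
by have := Im_le_normc (cis x - 1); rewrite /= subr0.
Qed.

Let one_sub_cos (x : R) : 1 - cos x <= x ^+ 2 / 2.
Proof.
have h := cis_sub1_le x.
have : ComplexField.Normc.normc (cis x - 1) ^+ 2 <= `|x| ^+ 2.
  by rewrite ler_pXn2r ?nnegrE ?normc_ge0.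
rewrite sqr_normcE real_normK ?num_real//= subr0.
have := cos2Dsin2 x; lra.
Qed.

Let is_derive_pow (p x : R) : 0 < x -> is_derive x 1 (fun x => x `^ p) (p * x `^ (p - 1)).
Proof. by move=> x0; exact: is_derive1_powR. Qed.

(** The integrand is singular at zero if [1 < alpha]; the integral is the limit
    of those over [[1 / n, c]], with an explicit primitive. *)
Lemma integral_pow_le (c : R) : 0 < c ->
  (\int[mu]_(x in `]0%R, c]) (x `^ (1 - alpha))%:E < +oo)%E.
Proof.
move=> c0.
pose F n : set R := `[n.+1%:R^-1, c]%classic.
have FE : `]0%R, c]%classic = \bigcup_n F n.
  apply/seteqP; split => x /=.
    rewrite in_itv /= => /andP[x0 xc]; exists (Num.bound x^-1) => //=.
    rewrite /F /= in_itv /= xc andbT -[leRHS]invrK lef_pV2 ?posrE ?invr_gt0//.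
    apply: ltW; apply: lt_le_trans (archi_boundP _) _; first by rewrite invr_ge0 ltW.
    by rewrite ler_nat.
  move=> [n _]; rewrite /F /= !in_itv /= => /andP[nx ->]; rewrite andbT.
  by apply: lt_le_trans nx; rewrite invr_gt0.
have mpow D : measurable_fun D (fun x : R => (x `^ (1 - alpha))%:E).
  by apply: measurable_funTS; apply/measurable_EFinP; exact: measurable_powR.
have nd : nondecreasing_seq F.
  move=> n m nm; apply/subsetPset => x; rewrite /F /= !in_itv /= => /andP[nx ->]; rewrite andbT.
  by apply: le_trans nx; rewrite lef_pV2 ?posrE// ler_nat.
have mF n : measurable (F n : set (measurableTypeR R)) by exact: measurable_itv.
have pow0 (x : R) : (0 <= (x `^ (1 - alpha))%:E)%E by rewrite lee_fin powR_ge0.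
have cv := @ge0_nondecreasing_set_cvg_integral _ (measurableTypeR R) R F
  (fun x => (x `^ (1 - alpha))%:E) mu nd mF (fun i => mpow _) (fun i x _ => pow0 x).
rewrite FE; apply: (@le_lt_trans _ _ ((c `^ (2 - alpha) / (2 - alpha))%:E)); last exact: ltry.
move/cvg_lim : (cv) => <- //; apply: lime_le; first by apply/cvg_ex; eexists; exact: cv.
apply: nearW => n.
have [nc|cn] := ltP (n.+1%:R^-1 : R) c; last first.
  have [cE|cn'] := eqVneq c n.+1%:R^-1.
    by rewrite /F -cE set_itv1 integral_set1 lee_fin divr_ge0 ?powR_ge0// ltW.
  rewrite /F set_itv_ge; last by rewrite bnd_simp leNgt negbK lt_neqAle cn' cn.
  by rewrite integral_set0 lee_fin divr_ge0 ?powR_ge0// ltW.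
have n0 : 0 < n.+1%:R^-1 :> R by rewrite invr_gt0.
rewrite /F (@continuous_FTC2 _ _ (fun x => x `^ (2 - alpha) / (2 - alpha)))//.
- by rewrite -EFinD lee_fin gerBl divr_ge0 ?powR_ge0// ltW.
- apply: derivable_within_continuous => x; rewrite in_itv /= => /andP[nx _].
  by apply: derivable_powR; rewrite in_itv /= andbT (lt_le_trans n0).
- have dF (x : R) : 0 < x -> derivable (fun x => x `^ (2 - alpha) / (2 - alpha)) x 1.
    move=> x0; apply: derivableM => //.
    by apply: derivable_powR; rewrite in_itv /= andbT.
  have cF (x : R) : 0 < x -> {for x, continuous (fun x => x `^ (2 - alpha) / (2 - alpha))}.
    by move=> x0; apply/differentiable_continuous; apply/derivable1_diffP; exact: dF.
  split.
  + by move=> x; rewrite in_itv /= => /andP[nx _]; apply: dF; exact: lt_trans nx.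
  + by apply: cvg_at_right_filter; exact: cF.
  + by apply: cvg_at_left_filter; exact: cF.
- move=> x; rewrite in_itv /= => /andP[nx _]; have x0 := lt_trans n0 nx.
  have -> : (fun x => x `^ (2 - alpha) / (2 - alpha)) = (fun x => (2 - alpha)^-1 * x `^ (2 - alpha)).
    by apply/funext => y; rewrite mulrC.
  have D := is_derive_pow (2 - alpha) x0.
  rewrite derive1E deriveM//= !derive_val.
  rewrite scaler0 addr0 /GRing.scale /= mulrA mulVf ?mul1r ?gt_eqF//.
  by congr (_ `^ _); lra.
Qed.

Lemma sine_integrable (c : R) : mu.-integrable `]0%R, c] (EFin \o g).
Proof.
have [c0|c0] := ltP 0 c; last by rewrite set_itv_ge ?bnd_simp -?leNgt//; exact: integrable_set0.
have mg : measurable_fun `]0%R, c] (EFin \o g).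
  apply: measurable_funTS; apply/measurable_EFinP; apply: measurable_funM.
    exact: measurable_powR.
  exact: continuous_measurable_fun (@continuous_sin R).
have mpow : measurable_fun `]0%R, c] (fun x : R => (x `^ (1 - alpha))%:E).
  by apply: measurable_funTS; apply/measurable_EFinP; exact: measurable_powR.
apply: (@le_integrable _ _ _ mu `]0%R, c] _ _ (fun x => (x `^ (1 - alpha))%:E)) => //.
  move=> x /=; rewrite in_itv /= => /andP[x0 _].
  rewrite lee_fin /g normrM (ger0_norm (powR_ge0 _ _)) (ger0_norm (powR_ge0 _ _)).
  rewrite addrC powRD; last by apply/implyP => _; rewrite gt_eqF.
  rewrite (powRr1 (ltW x0)) ler_wpM2l ?powR_ge0//.
  by rewrite -[leRHS](gtr0_norm x0); exact: sin_le.
apply/integrableP; split => //.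
apply: le_lt_trans (integral_pow_le c0); rewrite le_eqVlt; apply/orP; left; apply/eqP.
by apply: eq_integral => x _; rewrite gee0_abs// lee_fin powR_ge0.
Qed.

Let I (c : R) : R := \int[mu]_(x in `]0%R, c]) g x.

Let is_derive_I (c : R) : 0 < c -> is_derive c 1 I (g c).
Proof.
move=> c0.
have cg : {for c, continuous g}.
  apply: continuousM; last exact: continuous_sin.
  apply/differentiable_continuous; apply/derivable1_diffP.
  by apply: derivable_powR; rewrite in_itv /= andbT.
have c1 : c < c + 1 by rewrite ltrDl.
have [|dI I'] := @continuous_FTC1 R g (BRight 0) c (c + 1) c1 (sine_integrable _) _ cg.
  by rewrite /Order.lt /=.
by apply: DeriveDef; [exact: dI|rewrite -derive1E; exact: I'].
Qed.

(* Integration by parts with the primitive [1 - cos] of [sin]: [H] has the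
   nonnegative derivative [alpha * c ^ (- alpha - 1) * (1 - cos c)]. *)
Let H (c : R) : R := I c - c `^ (- alpha) * (1 - cos c).

Let is_derive_H (c : R) : 0 < c -> is_derive c 1 H (alpha * c `^ (- alpha - 1) * (1 - cos c)).
Proof.
move=> c0; have DI := is_derive_I c0; have DP := is_derive_pow (- alpha) c0.
have Dc : is_derive c 1 (fun x : R => 1 - cos x) (0 - (- sin c)).
  by apply: is_deriveB.
have DM : is_derive c 1 (fun x : R => x `^ (- alpha) * (1 - cos x))
  (c `^ (- alpha) *: (0 - (- sin c)) + (1 - cos c) *: (- alpha * c `^ (- alpha - 1))).
  exact: is_deriveM.
have D := is_deriveB DI DM.
apply: is_derive_eq D _.
by rewrite /g /GRing.scale /=; ring.
Qed.

Let continuous_H (x y : R) : 0 < x -> {within `[x, y], continuous H}.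
Proof.
move=> x0; apply: derivable_within_continuous => z; rewrite in_itv /= => /andP[xz _].
by have [] := is_derive_H (lt_le_trans x0 xz).
Qed.

Let H_incr (x y : R) : 0 < x -> x <= y -> H x <= H y.
Proof.
move=> x0 xy; have [||c] := @MVT_segment R H (fun c => alpha * c `^ (- alpha - 1) * (1 - cos c)) x y xy.
- by move=> z; rewrite in_itv /= => /andP[xz _]; apply: is_derive_H; exact: lt_trans xz.
- exact: continuous_H.
move=> _ E; rewrite -subr_ge0 E !mulr_ge0 ?powR_ge0 ?subr_ge0 ?cos_le1 ?(ltW alpha0)//.
Qed.

Let H_gt (x y : R) : 1 <= x -> x < y -> y <= 2 -> H x < H y.
Proof.
move=> x1 xy y2; have x0 : 0 < x by exact: lt_le_trans x1.
have [||c] := @MVT R H (fun c => alpha * c `^ (- alpha - 1) * (1 - cos c)) x y xy.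
- by move=> z; rewrite in_itv /= => /andP[xz _]; apply: is_derive_H; exact: lt_trans xz.
- exact: continuous_H.
rewrite in_itv /= => /andP[xc cy] E; rewrite -subr_gt0 E.
have c0 : 0 < c by exact: lt_trans xc.
rewrite mulr_gt0 ?subr_gt0// !mulr_gt0 ?powR_gt0// ?subr_gt0//.
rewrite -[ltRHS](cos0 R) ltr_cos// in_itv /= ?lexx ?pi_ge0//.
by rewrite ltW//=; have := pi_ge2 R; lra.
Qed.

Let H_ge0 (c : R) : 0 < c -> 0 <= H c.
Proof.
move=> c0; apply/ler_addgt0Pr => e e0; rewrite -lerBlDr sub0r.
have [K HK] := powR_vanish alpha2 e0.
pose k := maxn K (Num.bound c^-1).
have k0 : 0 < k.+1%:R^-1 :> R by rewrite invr_gt0.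
have kc : k.+1%:R^-1 <= c.
  rewrite -[leRHS]invrK lef_pV2 ?posrE ?invr_gt0//.
  apply: ltW; apply: lt_le_trans (archi_boundP _) _; first by rewrite invr_ge0 ltW.
  by rewrite ler_nat /k; lia.
apply: le_trans (H_incr k0 kc).
set x := _^-1 in k0 *.
have x1 : x <= 1 by rewrite /x invf_le1// ler1n.
have I0 : 0 <= I x.
  apply: Rintegral_ge0 => y /=; rewrite in_itv /= => /andP[y0 yx].
  rewrite mulr_ge0 ?powR_ge0// sin_ge0_pi// ltW//=; have := pi_ge2 R; lra.
have Kk : k.+1%:R `^ (- (2 - alpha)) <= e by apply: HK; rewrite /k; lia.
have : x `^ (- alpha) * (1 - cos x) <= e.
  apply: le_trans Kk; apply: (@le_trans _ _ (x `^ (- alpha) * x ^+ 2)).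
    rewrite ler_wpM2l ?powR_ge0//; apply: le_trans (one_sub_cos x) _.
    by have := sqr_ge0 x; lra.
  rewrite -powR_mulrn ?(ltW k0)// -powRD; last by apply/implyP => _; rewrite gt_eqF.
  rewrite powRN -[leRHS]powR_inv1 ?powR_ge0// -powRrM mulrN1 -mulN1r powRrM powR_inv1//.
  by rewrite (addrC _ 2) lexx.
rewrite /H; lra.
Qed.

(* The derivative of [H] is at most the one of [- 2 * c ^ (- alpha)]. *)
Let H_ub (c : R) : 1 <= c -> H c <= H 1 + 2.
Proof.
move=> c1.
pose K (x : R) : R := H x + 2 * x `^ (- alpha).
have dK (x : R) : 0 < x -> is_derive x 1 K (alpha * x `^ (- alpha - 1) * (1 - cos x) + 2 * (- alpha * x `^ (- alpha - 1))).
  move=> x0; have D1 := is_derive_H x0; have D2 := is_derive_pow (- alpha) x0.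
  exact: is_deriveD.
have [||z] := @MVT_segment R K (fun x => alpha * x `^ (- alpha - 1) * (1 - cos x) +
    2 * (- alpha * x `^ (- alpha - 1))) 1 c c1.
- by move=> x; rewrite in_itv /= => /andP[+ _] => x1; apply: dK; exact: lt_trans x1.
- apply: derivable_within_continuous => z; rewrite in_itv /= => /andP[xz _].
  by have [] := dK z (lt_le_trans ltr01 xz).
rewrite in_itv /= => /andP[z1 _] E.
have : K c <= K 1.
  rewrite -subr_le0 E mulr_le0_ge0 ?subr_ge0//.
  have : 0 <= alpha * z `^ (- alpha - 1) * (1 + cos z).
    by rewrite !mulr_ge0 ?powR_ge0 ?(ltW alpha0)//; have := cos_geN1 z; lra.
  lra.
rewrite /K powR1 mulr1; have := powR_ge0 c (- alpha); lra.
Qed.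

Let powR_cvgy0 : x `^ (- alpha) @[x --> +oo] --> (0 : R).
Proof.
apply/cvgrPdist_le => e e0; have [K HK] := powR_vanish alpha0 e0.
near=> x.
have Kx : K.+1%:R <= x by near: x; exact: nbhs_pinfty_ge.
rewrite sub0r normrN ger0_norm ?powR_ge0//.
apply: le_trans (HK K.+1 (ltnSn _)).
have x0 : 0 < x by exact: lt_le_trans Kx.
rewrite !powRN lef_pV2 ?posrE ?powR_gt0//.
by rewrite ge0_ler_powR ?nnegrE ?(ltW alpha0) ?(ltW x0).
Unshelve. all: by end_near.
Qed.

(** [H] is nondecreasing and bounded, and the boundary term vanishes at
    infinity. *)
Lemma sine_integral_cvg : exists2 l : R, 0 < l & I c @[c --> +oo] --> l.
Proof.
pose h (x : R) : R := H (Num.max 1 x).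
have h1 (x : R) : 1 <= Num.max 1 x by rewrite le_max lexx.
have ndh : nondecreasing_fun h.
  move=> x y xy; apply: H_incr; first exact: lt_le_trans (h1 x).
  by rewrite ge_max; apply/andP; split; [exact: h1|rewrite le_max xy orbT].
have ubh : has_ubound (range h).
  by exists (H 1 + 2) => _ [x _ <-]; exact: H_ub.
have cvh := nondecreasing_cvgr ndh ubh.
exists (sup (range h)).
  apply: (@lt_le_trans _ _ (H 2)).
    by apply: le_lt_trans (H_ge0 ltr01) _; apply: H_gt; rewrite ?ltr1n.
  have h2 : h 2 = H 2 by rewrite /h max_r// ler1n.
  by rewrite -h2; apply: (ub_le_sup ubh); exists 2.
have cvH : H x @[x --> +oo] --> sup (range h).
  apply: cvg_trans cvh; apply: near_eq_cvg; near=> x.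
  by rewrite /h max_r//; near: x; exact: nbhs_pinfty_ge.
have cvP : x `^ (- alpha) * (1 - cos x) @[x --> +oo] --> (0 : R).
  apply: (@squeeze_cvgr _ _ _ _ (fun=> 0) (fun x => 2 * x `^ (- alpha))).
  - near=> x; rewrite mulr_ge0 ?powR_ge0 ?subr_ge0 ?cos_le1//= mulrC ler_wpM2r ?powR_ge0//.
    by have := cos_geN1 x; lra.
  - exact: cvg_cst.
  - by rewrite -[X in _ --> X](mulr0 2); apply: cvgMr.
have -> : I = (fun x => H x + x `^ (- alpha) * (1 - cos x)).
  by apply/funext => x; rewrite /H subrK.
by rewrite -[sup _]addr0; exact: cvgD.
Unshelve. all: by end_near.
Qed.

Lemma C_stable_gt0 : 0 < C_stable alpha.
Proof.
have [l l0 cv] := sine_integral_cvg.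
by rewrite /C_stable invr_gt0 (cvg_lim _ cv).
Qed.

End sine_integral.

Section euler_gamma.
Variables (R : realType).
Local Notation mu := (@lebesgue_measure R).

(** Finiteness matters as much as positivity, an infinite integral having the
    real value zero; the integrand is at most four times the exponential density
    of rate [1 / 2]. *)
Lemma Euler_Gamma_gt0 (p : R) : 0 <= p <= 1 -> 0 < Euler_Gamma (1 + p).
Proof.
move=> /andP[p0 p1]; rewrite /Euler_Gamma (_ : 1 + p - 1 = p); last by rewrite addrC addKr.
have one_p : (1 : R) `^ p = 1 by rewrite powR1.
have mpe D : measurable_fun D (fun x : R => (x `^ p * expR (- x))%:E).
  apply: measurable_funTS; apply/measurable_EFinP; apply: measurable_funM.
    exact: measurable_powR.
  by apply: measurableT_comp => //.
have mexp D : measurable_fun D (fun x : R => (exponential_pdf 2^-1 x)%:E).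
  by apply: measurable_funTS; apply/measurable_EFinP; exact: measurable_exponential_pdf.
apply: fine_gt0; apply/andP; split.
  apply: (@lt_le_trans _ _ (\int[mu]_(x in `[1%R, 2%R]) (expR (- 2))%:E)%E).
    rewrite integral_cst//= lebesgue_measure_itv /= lte_fin ltr1n /= -EFinB -EFinM lte_fin.
    by rewrite mulr_gt0 ?expR_gt0//; lra.
  apply: (@le_trans _ _ (\int[mu]_(x in `[1%R, 2%R]) (x `^ p * expR (- x))%:E)%E).
    apply: ge0_le_integral => //.
    exact: mpe.
    move=> x /=; rewrite in_itv /= => /andP[x1 x2]; rewrite lee_fin.
    rewrite -[leLHS]mul1r ler_pM ?expR_ge0//.
      by rewrite -[leLHS]one_p ge0_ler_powR// ?nnegrE; lra.
    by rewrite ler_expR lerN2.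
  apply: ge0_subset_integral => //.
  - exact: mpe.
  - by move=> x _; rewrite lee_fin mulr_ge0 ?powR_ge0 ?expR_ge0.
  - by move=> x /=; rewrite !in_itv /= andbT => /andP[x1 _]; exact: lt_le_trans x1.
apply: (@le_lt_trans _ _ (\int[mu]_(x in `]0%R, +oo[) (4%:E * (exponential_pdf 2^-1 x)%:E))%E).
  apply: ge0_le_integral => //.
  - by move=> x _; rewrite lee_fin mulr_ge0 ?powR_ge0 ?expR_ge0.
  - exact: mpe.
  - by apply: emeasurable_funM => //; exact: mexp.
  move=> x /=; rewrite in_itv /= andbT => x0; rewrite -EFinM lee_fin exponential_pdfE ?(ltW x0)//.
  have -> : expR (- x) = expR (- 2^-1 * x) * expR (- 2^-1 * x) by rewrite -expRD; congr expR; lra.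
  have xp : x `^ p <= 1 + x.
    have [x1|x1] := leP x 1.
      apply: (@le_trans _ _ 1); last by rewrite lerDl ltW.
      by rewrite -[leRHS]one_p ge0_ler_powR// ?nnegrE// ltW.
    by apply: (@le_trans _ _ x); [exact: (ler1_powR (ltW x1) p1)|rewrite lerDr].
  have e1 : 1 + x <= 2 * expR (2^-1 * x) by have := expR_ge1Dx (2^-1 * x); lra.
  have e2 : expR (2^-1 * x) * expR (- 2^-1 * x) = 1 by rewrite mulNr expRxMexpNx_1.
  have e3 := expR_ge0 (- 2^-1 * x).
  have : x `^ p * expR (- 2^-1 * x) <= 2 * expR (2^-1 * x) * expR (- 2^-1 * x).
    by rewrite ler_wpM2r//; exact: le_trans e1.
  rewrite -[X in _ <= X]mulrA e2 mulr1 => e4.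
  have -> : 4 * (2^-1 * expR (- 2^-1 * x)) = 2 * expR (- 2^-1 * x) by field.
  by rewrite mulrA ler_wpM2r.
have pdf0 (x : R) : (0 <= (exponential_pdf 2^-1 x)%:E)%E by rewrite lee_fin exponential_pdf_ge0 ?invr_ge0.
rewrite ge0_integralZl//; last exact: mexp.
apply: (@le_lt_trans _ _ (4%:E * 1)%E); last by rewrite mule1 ltry.
apply: lee_wpmul2l => //; rewrite -(@integral_exponential_pdf _ 2^-1) ?invr_gt0//.
by apply: ge0_subset_integral => //; exact: mexp.
Qed.

Lemma b_stable_gt0 (alpha : R) : 0 < alpha < 2 -> 0 < b_stable alpha.
Proof.
move=> /andP[a0 a2]; rewrite /b_stable mulr_gt0 ?powR_gt0//.
by apply: Euler_Gamma_gt0; apply/andP; split; lra.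
Qed.

End euler_gamma.

(** * General position *)

Lemma countable_cos_fiber (R : realType) (t c : R) : t != 0 -> countable [set z | cos (t * z) = c].
Proof.
move=> t0.
pose h (p : int * bool) : R := (2 * pi * p.1%:~R + (if p.2 then acos c else - acos c)) / t.
apply: (@sub_countable _ _ _ (range h)); last first.
  by apply: card_le_trans (card_image_le _ _) _; exact: countableP.
apply: subset_card_le => z /= zc.
have [q hq] := reduce_angle (t * z).
set v := t * z - 2 * pi * q%:~R in hq.
have cv : cos `|v| = c.
  rewrite cos_norm -zc -[t * z](subrK (2 * pi * q%:~R)) -/v.
  by rewrite cos_Dperiod.
have av : `|v| = acos c by rewrite -cv cosK// in_itv /= normr_ge0.
exists (q, 0 <= v) => //=; rewrite /h /= -av.
have -> : (if 0 <= v then `|v| else - `|v|) = v.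
  by case: ifPn => [/ger0_norm//|]; rewrite -ltNge => /ltr0_norm ->; rewrite opprK.
by rewrite /v addrC subrK mulrC mulKf.
Qed.

Lemma countable_sin_zero (R : realType) (t : R) : t != 0 -> countable [set z | sin (t * z) = 0].
Proof.
move=> t0; have t20 : t *+ 2 != 0 by rewrite mulrn_eq0 negb_or.
apply: (@sub_countable _ _ _ [set z | cos (t *+ 2 * z) = 1]); last exact: countable_cos_fiber.
apply: subset_card_le => z /= sz; rewrite mulrnAl cos_mulr2n.
by have := cos2Dsin2 (t * z); rewrite sz expr0n addr0 => ->; rewrite mulr2n addrK.
Qed.

Lemma countable_square_fiber (R : realType) (c D : R) : c != 0 -> countable [set y | (c * y) ^+ 2 = D].
Proof.
move=> c0.
apply: (@sub_countable _ _ _ [set Num.sqrt (D / c ^+ 2); - Num.sqrt (D / c ^+ 2)]); last first.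
  exact/finite_set_countable/finite_set2.
apply: subset_card_le => y /= yD.
have -> : Num.sqrt (D / c ^+ 2) = `|y|.
  by rewrite -yD exprMn mulrAC divff ?mul1r ?sqrtr_sqr// sqrf_eq0.
by have [y0|y0] := leP 0 y; [left; rewrite ger0_norm|right; rewrite ltr0_norm// opprK].
Qed.

(** The product rule for a subfamily is the one for its image. *)
Lemma sub_mutually_independent d (T : measurableType d) (R : realType) (P : probability T R)
    d' (S : measurableType d') (I I' : eqType) (X : I -> T -> S) (h : I' -> I) :
  injective h -> mutually_independent P X -> mutually_independent P (X \o h).
Proof.
move=> hI indX s B us mB.
pose B' i := \bigcap_(j in [set j | h j = i]) B j.
have B'h j : B' (h j) = B j.
  apply/seteqP; split => x; first by move=> /(_ j); exact.
  by move=> Bx k /= /hI ->.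
have mB' i : measurable (B' i).
  have [[j <-]|nj] := pselect (exists j, h j = i); first by rewrite B'h.
  rewrite (_ : B' i = setT)//; apply/seteqP; split => // x _ j /= hj.
  by exfalso; apply: nj; exists j.
have := indX (map h s) B' (_ : uniq (map h s)) mB'.
rewrite map_inj_uniq// => /(_ us); rewrite big_map.
under eq_bigr do rewrite B'h.
move=> <-; congr (P _); apply/seteqP; split => w H i /=.
  by move=> /mapP[j js ->]; rewrite /= B'h; exact: H.
by move=> is_; have := H (h i); rewrite /= map_f// B'h; exact.
Qed.

Section generic_position.
Context d (T : measurableType d) (R : realType) (P : probability T R).
Variables (E G1 G2 Z : nat -> T -> R) (alpha kap delta : R) (f : R -> R).
Local Notation idx := ((nat + nat) + (nat + nat))%type.
Let V : idx -> T -> R := merge4 E G1 G2 Z.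
Hypothesis mV : forall i, measurable_fun setT (V i).
Hypothesis indV : mutually_independent P V.
Hypothesis G1_gauss : forall k (A : set (measurableTypeR R)), measurable A ->
  P (G1 k @^-1` A) = normal_prob 0 1 A.
Hypothesis mf : measurable_fun setT f.
Hypothesis Z_law : forall k, has_distribution P (Z k)
  (fun A => \int[lebesgue_measure]_(x in A) (f x)%:E)%E.
Hypothesis delta0 : delta != 0.

Let measurable_countable (A : set R) : countable A -> measurable A.
Proof. by move=> cA; apply: countable_measurable => // t; exact: measurable_set1. Qed.

Lemma Z_null k (A : set R) : countable A -> P (Z k @^-1` A) = 0%E.
Proof.
move=> cA; have mA := measurable_countable cA.
rewrite (Z_law k mA); apply: null_set_integral => //.
- by apply: measurable_funTS; exact/measurable_EFinP.
- exact: countable_lebesgue_measure0.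
Qed.

Lemma G1_null k (A : set R) : countable A -> P (G1 k @^-1` A) = 0%E.
Proof. by move=> cA; rewrite G1_gauss ?gauss_null//; exact: measurable_countable. Qed.

Lemma ae_of_null (A : set T) : measurable A -> P A = 0%E -> {ae P, forall w, ~ A w}.
Proof. by move=> mA PA; exists A; split => // w /= /contrapT. Qed.

Lemma ae_sin_neq0 : {ae P, forall w, forall k, sin (delta * Z k w) != 0}.
Proof.
apply/ae_foralln => k; have cS := countable_sin_zero delta0.
have := ae_of_null _ (Z_null k cS).
rewrite -[X in measurable X]setTI => /(_ (mV (inr (inr k)) measurableT (measurable_countable cS))).
by apply: filterS => w /= /eqP.
Qed.

Lemma ae_G1_neq0 : {ae P, forall w, forall k, G1 k w != 0}.
Proof.
apply/ae_foralln => k; have cS : countable [set (0 : R)] by exact/finite_set_countable.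
have := ae_of_null _ (G1_null k cS).
rewrite -[X in measurable X]setTI => /(_ (mV (inl (inr k)) measurableT (measurable_countable cS))).
by apply: filterS => w /= /eqP.
Qed.

(** If [V i] has a law without atoms, it almost surely avoids a countable set
    that depends on the other variables. *)
Lemma ae_avoid i (J : pred idx) (B : set (generated V J * measurableTypeR R)) : ~~ J i ->
  (forall A : set R, countable A -> P (V i @^-1` A) = 0%E) -> measurable B ->
  (forall w, countable [set y | B (w, y)]) -> {ae P, forall w, ~ B (w, V i w)}.
Proof.
move=> Ji V0 mB cB; apply: (ae_of_null (A := [set w | B (w, V i w)])); last first.
  by apply: (null_one mV indV Ji mB) => w; exact/V0/cB.
have mid : measurable_fun setT (fun w : T => (w : generated V J, V i w : measurableTypeR R)).
  by apply/measurable_fun_pair; [exact: (measurable_to_generated mV)|exact: mV].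
by have := mid measurableT B mB; rewrite setTI.
Qed.

Lemma ae_cos_neq : {ae P, forall w, forall k l, k != l -> cos (delta * Z k w) != cos (delta * Z l w)}.
Proof.
apply/ae_foralln => k; apply/ae_foralln => l.
have [->|kl] := eqVneq k l; first by apply: nearW => w; rewrite ?eqxx.
pose J := predC1 (inr (inr k) : idx).
pose h (z : generated V J * measurableTypeR R) : R := cos (delta * z.2) - cos (delta * Z l z.1).
have mc : measurable_fun setT (cos : R -> R) := continuous_measurable_fun (@continuous_cos R).
have mh : measurable_fun setT h.
  apply: measurable_funB.
    by apply: (measurableT_comp mc); apply: measurable_funM => //; exact: measurable_snd.
  apply: (measurableT_comp mc); apply: measurable_funM => //.
  apply: (measurableT_comp (f := Z l : generated V J -> R)) => //.
  apply: (@generated_measurableX _ T _ _ _ V J (inr (inr l))).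
  by rewrite /J /=; apply: contra kl => /eqP[->].
apply: filterS (ae_avoid (i := inr (inr k)) (J := J) (B := h @^-1` [set 0]) _ (@Z_null k) _ _) => [w H _|||w].
- by rewrite -subr_eq0; apply/eqP.
- by rewrite /J /= eqxx.
- by rewrite -[X in measurable X]setTI; apply: mh => //; exact: measurable_set1.
- rewrite (_ : mkset _ = [set z | cos (delta * z) = cos (delta * Z l w)]); first exact: countable_cos_fiber.
  apply/seteqP; split => z; first by move/eqP; rewrite /h /= subr_eq0 => /eqP.
  by rewrite /h /= => ->; rewrite subrr.
Qed.

Let c k w := kap * arrival E k w `^ (- alpha^-1).
Let amp2 k w := scaled_gauss E alpha kap G1 k w ^+ 2 + scaled_gauss E alpha kap G2 k w ^+ 2.

(** Given all the other variables, equality of the amplitudes [k] and [l] is a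
    quadratic equation for [G1 k]. *)
Lemma ae_amp_neq : {ae P, forall w, forall k l, k != l -> c k w != 0 -> amp2 k w != amp2 l w}.
Proof.
apply/ae_foralln => k; apply/ae_foralln => l.
have [->|kl] := eqVneq k l; first by apply: nearW => w; rewrite ?eqxx.
pose J := predC1 (inl (inr k) : idx).
have mG j : J j -> measurable_fun setT (V j : generated V J -> R).
  exact: (@generated_measurableX _ T _ _ _ V J j).
have mc j : measurable_fun setT (c j : generated V J -> R).
  apply: measurable_funM => //; apply: (measurableT_comp (measurable_powR _)).
  by apply: measurable_arrival => i; rewrite /J /=.
pose D (w : generated V J) : R := amp2 l w - (c k w * G2 k w) ^+ 2.
have mD : measurable_fun setT D.
  apply: measurable_funB; first apply: measurable_funD; apply: measurable_funX; apply: (measurable_funM (mc _)).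
  - by apply: (mG (inl (inr l))); rewrite /J /=; apply: contra kl => /eqP[->].
  - exact: (mG (inr (inl l))).
  - exact: (mG (inr (inl k))).
pose h (z : generated V J * measurableTypeR R) : R := (c k z.1 * z.2) ^+ 2 - D z.1.
have mh : measurable_fun setT h.
  apply: measurable_funB.
    apply: measurable_funX; apply: measurable_funM; last exact: measurable_snd.
    exact: (measurableT_comp (mc k) measurable_fst).
  exact: (measurableT_comp mD measurable_fst).
pose g (z : generated V J * measurableTypeR R) : R := c k z.1.
have mg : measurable_fun setT g by exact: (measurableT_comp (mc k) measurable_fst).
apply: filterS (ae_avoid (i := inl (inr k)) (J := J) (B := h @^-1` [set 0] `&` g @^-1` ~` [set 0]) _ (@G1_null k) _ _) => [w H _ ck|||w].
- apply/eqP => kl2; apply: H; split; last exact/eqP.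
  by rewrite /= /h /D /= -kl2 /amp2 addrK subrr.
- by rewrite /J /= eqxx.
- apply: measurableI.
    by rewrite -[X in measurable X]setTI; apply: mh => //; exact: measurable_set1.
  by rewrite -[X in measurable X]setTI; apply: mg => //; apply: measurableC; exact: measurable_set1.
- have [c0|c0] := eqVneq (c k w) 0.
    rewrite (_ : mkset _ = set0); first exact: countable0.
    by apply/seteqP; split => // z [_]; apply.
  apply: (@sub_countable _ _ _ [set y | (c k w * y) ^+ 2 = D w]); last exact: countable_square_fiber.
  by apply: subset_card_le => y [/eqP]; rewrite /h /= subr_eq0 => /eqP.
Qed.

Lemma ae_generic : 0 < kap -> (forall k, has_distribution P (E k) (exponential_prob 1)) ->
  {ae P, forall w, [/\ forall k, sin (delta * Z k w) != 0,
    forall k l, k != l -> cos (delta * Z k w) != cos (delta * Z l w),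
    forall k, 0 < Num.sqrt (amp2 k w) &
    forall k l, k != l -> Num.sqrt (amp2 k w) != Num.sqrt (amp2 l w)]}.
Proof.
move=> kap0 lawE.
have := @ae_interarrival_gt0 _ T R P E (fun k => mV (inl (inl k))) lawE.
apply: filterS3 ae_G1_neq0 (filterI ae_sin_neq0 (filterI ae_cos_neq ae_amp_neq)) => w G10 [? [? Hamp]] E0.
have c0 k : c k w != 0.
  rewrite mulf_neq0 ?gt_eqF// powR_gt0//; rewrite /arrival big_ord_recr /=.
  by rewrite ltr_wpDl// sumr_ge0// => i _; exact: ltW.
have a0 k : 0 < amp2 k w.
  by rewrite ltr_pwDl ?sqr_ge0// exprn_even_gt0//= mulf_neq0//; exact: c0.
split => // [k|k l kl]; first by rewrite sqrtr_gt0.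
by rewrite eqr_sqrt ?ltW//; exact: Hamp.
Qed.

End generic_position.

(** * The estimators of the LePage representation *)

Lemma arrival_interarrival d (T : measurableType d) (R : realType) (Gam : nat -> T -> R) k w :
  arrival (interarrival Gam) k w = Gam k w.
Proof.
rewrite /arrival; elim: k => [|k IH]; first by rewrite big_ord_recr /= big_ord0 add0r.
by rewrite big_ord_recr /= IH addrC subrK.
Qed.

Lemma measurable_merge4 d (T : measurableType d) d' (S : measurableType d') (E G1 G2 Z : nat -> T -> S) :
  (forall k, measurable_fun setT (E k)) -> (forall k, measurable_fun setT (G1 k)) ->
  (forall k, measurable_fun setT (G2 k)) -> (forall k, measurable_fun setT (Z k)) ->
  forall i, measurable_fun setT (merge4 E G1 G2 Z i).
Proof. by move=> ? ? ? ? [[]|[]]. Qed.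

Theorem theorem4 (R : realType) (d : measure_display) (T : measurableType d)
    (P : probability T R) (alpha : R) (halpha : 0 < alpha < 2)
    (m : {finite_measure set (measurableTypeR R) -> \bar R})
    (hm : m setT = 1%E)
    (f : R -> R) (hf : is_symmetric_spectral_density m f)
    (X : R -> {RV P >-> R}) (hX : is_SRH_SaS alpha m X)
    (Gam G1 G2 Z : nat -> {RV P >-> R}) (hL : LePage_variables f Gam G1 G2 Z)
    (a b : nat -> T -> R)
    (ha : a = LePage_coef alpha (fine (m setT)) Gam G1)
    (hb : b = LePage_coef alpha (fine (m setT)) Gam G2)
    (hXL : is_LePage_series a b Z X)
    (delta : R) (hdelta : 0 < delta)
    (x : nat -> T -> R) (hx : forall j w, x j w = X (j%:R * delta) w)
    (N : nat)
    (Zhat : nat -> nat -> T -> R)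
    (xres : nat -> nat -> T -> nat -> R)
    (hxres : forall k n w, xres k n w
       = residual delta n (fun j => x j w) (fun i => Zhat i n w) k)
    (hpeak : forall k n w, (k < N)%N -> (0 < n)%N ->
       is_largest_peak delta n (xres k n w) (Zhat k n w))
    (hband : forall k, (k < N)%N -> {ae P, forall w, \forall n \near \oo,
       same_Nyquist_band delta (Zhat k n w) `|by_amplitude a b Z k w|})
    (ahat bhat : nat -> nat -> T -> R)
    (hahat : forall k n w,
       ahat k n w = cos_regression delta n (xres k n w) (Zhat k n w))
    (hbhat : forall k n w,
       bhat k n w = sin_regression delta n (xres k n w) (Zhat k n w)) :
  {ae P, forall w, forall k, (k < N)%N ->
    [/\ (n%:R * (`|by_amplitude a b Z k w| - Zhat k n w)) @[n --> \oo] --> (0 : R),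
        ahat k n w @[n --> \oo] --> by_amplitude a b a k w &
        bhat k n w @[n --> \oo]
          --> Num.sg (by_amplitude a b Z k w) * by_amplitude a b b k w]}.
Proof.
have [hE hG hZ hind] := hL; have [mf _ _ _] := hf.
set E := interarrival (fun k => Gam k : T -> R) in hE hind.
have GamE k w : arrival E k w = Gam k w by exact: arrival_interarrival.
have mE k : measurable_fun setT (E k).
  case: k => [|k]; first exact: (measurable_funPT (Gam 0%N)).
  exact: (measurable_funB (measurable_funPT (Gam k.+1)) (measurable_funPT (Gam k))).
have mV := measurable_merge4 mE (fun k => measurable_funPT (G1 k)) (fun k => measurable_funPT (G2 k))
  (fun k => measurable_funPT (Z k)).
have indE : mutually_independent P E.
  apply: (sub_mutually_independent (h := fun k => inl (inl k)) _ hind).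
  by move=> j l [].
pose kap := (C_stable alpha * (b_stable alpha)^-1 * fine (m setT)) `^ alpha^-1.
have kap0 : 0 < kap.
  rewrite /kap hm mulr1; apply/powR_gt0/mulr_gt0; first exact: C_stable_gt0.
  by rewrite invr_gt0; exact: b_stable_gt0.
have G1_gauss k (A : set (measurableTypeR R)) : measurable A -> P (G1 k @^-1` A) = normal_prob 0 1 A.
  exact: (hG k).1.
have G2_gauss k (A : set (measurableTypeR R)) : measurable A -> P (G2 k @^-1` A) = normal_prob 0 1 A.
  exact: (hG k).2.
have grow := ae_arrival_growth mE indE hE.
have gen := ae_generic alpha mV hind G1_gauss mf hZ (lt0r_neq0 hdelta) kap0 hE.
have tail := tail_mean_square (alpha := alpha) (kap := kap) (delta := delta) mV hind G1_gauss G2_gauss halpha (x := x) _ grow.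
have /tail appr0 : forall j, {ae P, forall w, series (fun k =>
     scaled_gauss E alpha kap G1 k w * cos (Z k w * (j%:R * delta))
   + scaled_gauss E alpha kap G2 k w * sin (Z k w * (j%:R * delta))) @ \oo --> x j w}.
  move=> j; have := hXL (j%:R * delta); apply: filterS => w; rewrite ha hb hx /LePage_coef.
  by under [in X in _ -> X]eq_fun do rewrite /scaled_gauss !GamE.
have band : {ae P, forall w, forall k, (k < N)%N -> \forall n \near \oo,
    same_Nyquist_band delta (Zhat k n w) `|by_amplitude a b Z k w|}.
  apply/ae_foralln => k; have [kN|Nk] := ltnP k N; last by apply: nearW.
  by apply: filterS (hband k kN).
apply: filterS3 gen appr0 band => w [sinZ cosZ amp0 ampI] appr bw k kN.
have aE i : a i w = scaled_gauss E alpha kap G1 i w by rewrite ha /LePage_coef /scaled_gauss GamE.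
have bE i : b i w = scaled_gauss E alpha kap G2 i w by rewrite hb /LePage_coef /scaled_gauss GamE.
have [] // := @periodogram_iteration_consistent R (fun k => a k w) (fun k => b k w) (fun k => Z k w)
  (fun j => x j w) delta N (fun k n => Zhat k n w) hdelta sinZ cosZ _ _ _ _ bw k kN.
- by move=> i; rewrite /amp aE bE.
- by move=> i l il; rewrite /amp !aE !bE; exact: ampI.
- move=> e K1 /(appr e K1)[K K1K HK]; exists K => //; exists 0%N => n _.
  rewrite [leLHS](_ : _ = mean_square n (fun j => x j w - \sum_(k < K)
     (scaled_gauss E alpha kap G1 k w * cos (Z k w * (j%:R * delta))
    + scaled_gauss E alpha kap G2 k w * sin (Z k w * (j%:R * delta)))))//.
  congr mean_square; apply/funext => j; congr (_ - _); apply: eq_bigr => i _.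
  have e0 : j%:R * (delta * Z i w) = Z i w * (j%:R * delta) by ring.
  by rewrite /tone /wave e0 aE bE.
- by move=> l n lN n0; rewrite -hxres; exact: hpeak.
move=> cvgZ cvga cvgb; split; first exact: cvgZ.
  by under eq_fun do rewrite hahat hxres; exact: cvga.
by under eq_fun do rewrite hbhat hxres; exact: cvgb.
Qed.
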